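(* Let $a,b>0$, $\alpha\ge0$, $\xi\in(0,1)$ with $\xi\notin\mathbb Q$, and let $\mathcal A$ be the operator on $\mathcal H$ defined in the context (depending on $\alpha$). For $\alpha=0$: if $b\le 2\sqrt a\,\pi^2$, then $\sup_{\mu\in\sigma(\mathcal A)}\Re(\mu)=-\frac b2$; if $b>2\sqrt a\,\pi^2$, then $\sup_{\mu\in\sigma(\mathcal A)}\Re(\mu)=\frac12\left(-b+\sqrt{b^2-4a\pi^4}\right)$. For any $\epsilon>0$, there exists $\alpha_0>0$ such that, if $0<\alpha<\alpha_0$, every eigenvalue $\mu$ of $\mathcal A$ satisfies: if $b\le 2\sqrt a\,\pi^2$, then $$\Re(\mu)\le-\frac b2+\epsilon;$$ if $b>2\sqrt a\,\pi^2$, then $$\Re(\mu)\le\frac12\left(-b+\sqrt{b^2-4a\pi^4}\right)+\epsilon.$$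
   Context: Let $a,b>0$, $\alpha\ge0$ be constants and $\xi\in(0,1)$. The energy space is $\mathcal H=[H^2(0,1)\cap H^1_0(0,1)]\times L^2(0,1)$ with inner product $(U_1,U_2)_{\mathcal H}=\int_0^1(a\,u_{1,xx}\overline{u_{2,xx}}+v_1\overline{v_2})\,dx$ for $U_i=(u_i,v_i)$. The domain $D(\mathcal A)$ is the set of $(u,v)\in[H^4(0,\xi)\cap H^4(\xi,1)\cap H^2(0,1)]\times H^2(0,1)$ such that $u(0)=v(0)=u(1)=v(1)=0$, $u_{xx}(0)=u_{xx}(1)=0$, $u_{xx}(\xi^-)=u_{xx}(\xi^+)$ and $u_{xxx}(\xi^+)-u_{xxx}(\xi^-)=-\frac{\alpha}{a}v(\xi)$. The operator is $\mathcal A(u,v)=(v,\,-a\,u_{xxxx}-b\,v-\alpha v(\xi)\delta_\xi)$, where $\delta_\xi$ is the Dirac mass at $\xi$ and derivatives are taken in the sense of distributions on $(0,1)$ (the domain condition on the jump of $u_{xxx}$ makes the second component an $L^2(0,1)$ function). $\sigma(\mathcal A)$ denotes the spectrum of $\mathcal A$. *)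

(* Defs.v *)
From HB Require Import structures.
From mathcomp Require Import all_boot all_order all_algebra.
From mathcomp Require Import all_classical all_reals all_analysis.
From mathcomp Require Import complex.
Set Implicit Arguments.
Unset Strict Implicit.
Unset Printing Implicit Defensive.
Import Order.TTheory GRing.Theory Num.Theory.
Import numFieldNormedType.Exports.
Local Open Scope classical_set_scope.
Local Open Scope ring_scope.
Local Open Scope complex_scope.

Notation leb R := (@lebesgue_measure R).

Section Sobolev.
Context {R : realType}.
Implicit Types (c d x : R) (k : nat) (phi : R -> R) (f g u : R -> R[i]).

Definition cintegral (D : set R) f : R[i] :=
  (\int[leb R]_(x in D) complex.Re (f x)) +i* (\int[leb R]_(x in D) complex.Im (f x)).

(* An element of L^2(c,d) is represented by a function on all of R whose values
   outside (c,d) are irrelevant; equality in L^2(c,d) is [aeeq c d]. *)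
Definition L2 c d f : Prop :=
  [/\ measurable_fun `]c, d[ (fun x => complex.Re (f x)),
      measurable_fun `]c, d[ (fun x => complex.Im (f x))
    & (\int[leb R]_(x in `]c, d[) ((complex.Re (f x) ^+ 2 + complex.Im (f x) ^+ 2)%:E)
        < +oo)%E].

Definition aeeq c d f g : Prop := f = g %[ae leb R in `]c, d[%classic].

Definition sqdistL2 c d f g : R :=
  \int[leb R]_(x in `]c, d[) (complex.Re (f x - g x) ^+ 2 + complex.Im (f x - g x) ^+ 2).

(* C_c^oo(c,d), extended by 0 to R *)
Definition test_fun c d phi : Prop :=
  (forall k x, derivable (derive1n k phi) x 1) /\
  (exists c' d', [/\ c < c', d' < d &
     forall x, x \notin `[c', d'] -> phi x = 0]).

(* g is the k-th derivative of u in the sense of distributions on (c,d).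
   Real-valued test functions suffice, by linearity. *)
Definition is_wderivn k c d u g : Prop :=
  forall phi, test_fun c d phi ->
    cintegral `]c, d[ (fun x => u x * (derive1n k phi x)%:C) =
    (-1) ^+ k * cintegral `]c, d[ (fun x => g x * (phi x)%:C).

Definition Hk k c d u : Prop :=
  L2 c d u /\
  forall j, (j <= k)%N -> exists g, L2 c d g /\ is_wderivn j c d u g.

(* The k-th weak derivative on (c,d), meaningful for u in H^k(c,d), where it is
   determined up to a.e. equality on (c,d). *)
Definition wderivn k c d u : R -> R[i] :=
  xget (fun=> 0) [set g | L2 c d g /\ is_wderivn k c d u g].

(* [trace c d u x], for x in [c,d], is the value at x of the continuous
   representative of u on [c,d]; for u in H^1(c,d) this representative exists
   and is unique on [c,d].  At x = d (resp. x = c) it is u(d^-) (resp. u(c^+)). *)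
Definition trace c d u : R -> R[i] :=
  xget (fun=> 0)
    [set g | [/\ {within `[c, d], continuous (fun x => complex.Re (g x))},
                 {within `[c, d], continuous (fun x => complex.Im (g x))}
               & aeeq c d u g]].

(* H^1_0(c,d): the closure in H^1(c,d) of the complex-valued test functions *)
Definition H10 c d u : Prop :=
  Hk 1 c d u /\
  forall e : R, 0 < e -> exists phi psi,
    [/\ test_fun c d phi, test_fun c d psi &
        sqdistL2 c d u (fun x => phi x +i* psi x)
        + sqdistL2 c d (wderivn 1 c d u)
            (fun x => (derive1 phi x) +i* (derive1 psi x)) < e].

End Sobolev.

(* pairs (u,v) of representatives *)
Definition state (R : realType) : Type := ((R -> R[i]) * (R -> R[i]))%type.

Section Energy.
Context {R : realType}.
Implicit Types (U V F : state R) (a : R) (mu : R[i]).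

Definition energy_space : set (state R) :=
  [set U | [/\ Hk 2 0 1 U.1, H10 0 1 U.1 & L2 0 1 U.2]].

(* equality of the classes represented by U and V *)
Definition state_eq U V : Prop := aeeq 0 1 U.1 V.1 /\ aeeq 0 1 U.2 V.2.

Definition energy_dot a U V : R[i] :=
  cintegral `]0, 1[ (fun x =>
    a%:C * wderivn 2 0 1 U.1 x * conjc (wderivn 2 0 1 V.1 x)
    + U.2 x * conjc (V.2 x)).

Definition energy_norm a U : R := Num.sqrt (complex.Re (energy_dot a U U)).

Definition state0 : state R := (fun=> 0, fun=> 0).

Definition state_scale mu U : state R :=
  (fun x => mu * U.1 x, fun x => mu * U.2 x).

Definition state_sub U V : state R :=
  (fun x => U.1 x - V.1 x, fun x => U.2 x - V.2 x).

(* Resolvent set of an operator A with domain D on the energy space: mu - A is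
   a bijection from D onto the whole space, with bounded inverse. *)
Definition resolvent_set a (D : set (state R)) (A : state R -> state R) :
    set R[i] :=
  [set mu | let T := fun U => state_sub (state_scale mu U) (A U) in
    [/\ forall U V, D U -> D V -> state_eq (T U) (T V) -> state_eq U V,
        forall F, energy_space F -> exists U, D U /\ state_eq (T U) F
      & exists C : R, forall U, D U ->
          energy_norm a U <= C * energy_norm a (T U)]].

Definition spectrum a D A : set R[i] := ~` resolvent_set a D A.

Definition eigenvalue_of (D : set (state R)) (A : state R -> state R) :
    set R[i] :=
  [set mu | exists U,
    [/\ D U, ~ state_eq U state0 & state_eq (A U) (state_scale mu U)]].

End Energy.

Section Beam.
Context {R : realType}.
Variables a b alpha xi : R.
Implicit Types (U : state R) (phi : R -> R).

Definition beam_dom : set (state R) :=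
  [set U | let: (u, v) := U in
    [/\ [/\ Hk 4 0 xi u, Hk 4 xi 1 u, Hk 2 0 1 u & Hk 2 0 1 v],
        [/\ trace 0 1 u 0 = 0, trace 0 1 v 0 = 0,
            trace 0 1 u 1 = 0 & trace 0 1 v 1 = 0],
        trace 0 xi (wderivn 2 0 xi u) 0 = 0 /\
          trace xi 1 (wderivn 2 xi 1 u) 1 = 0,
        trace 0 xi (wderivn 2 0 xi u) xi = trace xi 1 (wderivn 2 xi 1 u) xi
      & trace xi 1 (wderivn 3 xi 1 u) xi - trace 0 xi (wderivn 3 0 xi u) xi
          = - (alpha / a)%:C * trace 0 1 v xi]].

(* The distribution - a u_xxxx - b v - alpha v(xi) delta_xi on (0,1), with
   <u_xxxx, phi> = (-1)^4 <u, phi_xxxx>. *)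
Definition beam_distr U phi : R[i] :=
  - a%:C * cintegral `]0, 1[ (fun x => U.1 x * (derive1n 4 phi x)%:C)
  - b%:C * cintegral `]0, 1[ (fun x => U.2 x * (phi x)%:C)
  - alpha%:C * trace 0 1 U.2 xi * (phi xi)%:C.

(* On the domain this distribution is an L^2 function, unique up to a.e.
   equality, and the second component of A U is that function. *)
Definition beam_op U : state R :=
  (U.2,
   xget (fun=> 0) [set w | L2 0 1 w /\ forall phi, test_fun 0 1 phi ->
     cintegral `]0, 1[ (fun x => w x * (phi x)%:C) = beam_distr U phi]).

Definition beam_spectrum : set R[i] := spectrum a beam_dom beam_op.

Definition beam_eigenvalue : set R[i] := eigenvalue_of beam_dom beam_op.

End Beam.

(* Main.v *)
Require Import Defs.
From HB Require Import structures.
From mathcomp Require Import all_boot all_order all_algebra.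
From mathcomp Require Import all_classical all_reals all_analysis.
From mathcomp Require Import complex.
From mathcomp Require Import measurable_realfun ring lra.
Set Implicit Arguments.
Unset Strict Implicit.
Unset Printing Implicit Defensive.
Import Order.TTheory GRing.Theory Num.Theory.
Import numFieldNormedType.Exports.
Local Open Scope classical_set_scope.
Local Open Scope ring_scope.

(* Pairing the eigenvalue equation A(u, mu u) = mu (u, mu u) with u gives
   a |u''|^2 + (mu^2 + b mu) |u|^2 + alpha mu |u(xi)|^2 = 0. Its imaginary part
   forces Re mu <= -b/2 when mu is not real; its real part, with the sharp
   inequality pi^4 |u|^2 <= |u''|^2 and |u(xi)|^2 <= 2 |u''|^2, locates the real
   eigenvalues up to an error that vanishes with alpha.
   For alpha = 0 the same estimate applied to (mu - A) U = F bounds the resolvent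
   as soon as Re mu > -b/2 and (Re mu)^2 + b Re mu + a pi^4 > 0. Surjectivity of
   mu - A comes from solving u'''' - k^2 u = h, a k^2 = - (mu^2 + b mu), through
   the factorization D^4 - k^2 = (D^2 - k)(D^2 + k). The bound is attained since
   (sin (pi x), mu sin (pi x)) is an eigenvector for the roots of
   mu^2 + b mu + a pi^4 = 0. Weak derivatives are handled by du Bois-Reymond:
   functions in H^k are a.e. iterated primitives. *)

(** * Integrals, primitives and Fubini *)

(** The sharp constant [pi ^+ 4] fixes both the threshold on [b] and the supremum. It is obtained
    without Fourier series: one completed square gives the first-order inequality, a second one
    lifts it to u''.

    The delicate sign is that of the damping term in the real part of the eigenvalue identity. When
    Re mu < 0 the term alpha Re mu |u(xi)|^2 is nonpositive; to the right of -b/2 it costs at most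
    alpha b |u''|^2. It is absorbed into a |u''|^2 before the inequality with [pi ^+ 4] is applied,
    which asks for alpha b < a and lowers the quadratic Re(mu)^2 + b Re(mu) + a pi^4 by alpha b
    pi^4. Beyond the claimed bound that quadratic is at least eps^2, and these two requirements give
    the value of alpha_0.

    Weak derivatives, traces and the second component of the operator are picked by [xget]: nothing
    about them computes, and the operator is linear only up to a.e. equality. The domain is
    therefore translated once into explicit functions ([beam_data]), and the estimates are carried
    out there. *)

Section Integral.
Context {R : realType}.
Notation mu := (@lebesgue_measure R).
Implicit Types (c d x y : R) (f g : R -> R).

Definition itg c d f : R := \int[mu]_(x in `]c, d[) f x.
Definition itgb c d f : Prop := mu.-integrable `]c, d[ (EFin \o f).
Definition aeP (P : R -> Prop) : Prop := {ae mu, forall x : R, P x}.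
Definition aer c d f g : Prop := aeP (fun x => `]c, d[%classic x -> f x = g x).

Lemma itgb_meas c d f : itgb c d f -> measurable_fun `]c, d[ f.
Proof. by move=> /measurable_int /measurable_EFinP. Qed.

Lemma eq_itg c d f g : (forall x, c < x < d -> f x = g x) -> itg c d f = itg c d g.
Proof.
by move=> h; apply: eq_Rintegral => x; rewrite inE /= in_itv /= => /h.
Qed.

Lemma eq_itgb c d f g : (forall x, c < x < d -> f x = g x) -> itgb c d f -> itgb c d g.
Proof.
move=> h; apply: eq_integrable => //.
by move=> x; rewrite inE /= in_itv /= => /h ->.
Qed.

Lemma itgbD c d f g : itgb c d f -> itgb c d g -> itgb c d (fun x => f x + g x).
Proof.
move=> hf hg.
suff h : mu.-integrable `]c, d[ ((EFin \o f) \+ (EFin \o g))%E by exact: h.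
exact: integrableD.
Qed.

Lemma itgbZ c d k f : itgb c d f -> itgb c d (fun x => k * f x).
Proof.
move=> hf.
suff h : mu.-integrable `]c, d[ (fun x => k%:E * (EFin \o f) x)%E by exact: h.
exact: integrableZl.
Qed.

Lemma itgbN c d f : itgb c d f -> itgb c d (fun x => - f x).
Proof. by move=> /(itgbZ (-1)); apply: eq_itgb => x _; rewrite mulN1r. Qed.

Lemma itgbB c d f g : itgb c d f -> itgb c d g -> itgb c d (fun x => f x - g x).
Proof. by move=> hf hg; apply: itgbD => //; apply: itgbN. Qed.

Lemma itgb_le c d f g : measurable_fun `]c, d[ f -> itgb c d g ->
  (forall x, c < x < d -> `|f x| <= g x) -> itgb c d f.
Proof.
move=> mf ig h; apply: (le_integrable _ _ _ ig) => //.
  exact/measurable_EFinP.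
move=> x /=; rewrite in_itv /= => /h fg.
by rewrite lee_fin (le_trans fg)// ler_norm.
Qed.

Lemma itgb_norm c d f : itgb c d f -> itgb c d (fun x => `|f x|).
Proof. exact: integrable_norm. Qed.

Lemma itgb_sub c d c' d' f : c <= c' -> d' <= d -> itgb c d f -> itgb c' d' f.
Proof. by move=> h1 h2; apply: integrableS => //; apply: subset_itvSoo; rewrite bnd_simp. Qed.

Lemma itgD c d f g : itgb c d f -> itgb c d g ->
  itg c d (fun x => f x + g x) = itg c d f + itg c d g.
Proof. by move=> hf hg; rewrite /itg RintegralD. Qed.

Lemma itgB c d f g : itgb c d f -> itgb c d g ->
  itg c d (fun x => f x - g x) = itg c d f - itg c d g.
Proof. by move=> hf hg; rewrite /itg RintegralB. Qed.

Lemma itgZ c d k f : itgb c d f -> itg c d (fun x => k * f x) = k * itg c d f.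
Proof. by move=> hf; rewrite /itg RintegralZl. Qed.

Lemma le_itg c d f g : itgb c d f -> itgb c d g ->
  (forall x, c < x < d -> f x <= g x) -> itg c d f <= itg c d g.
Proof. by move=> hf hg h; apply: le_Rintegral => // x /=; rewrite in_itv /= => /h. Qed.

Lemma itg_ge0 c d f : (forall x, c < x < d -> 0 <= f x) -> 0 <= itg c d f.
Proof. by move=> h; apply: Rintegral_ge0 => x /=; rewrite in_itv /= => /h. Qed.

Lemma le_abs_itg c d f : itgb c d f -> `|itg c d f| <= itg c d (fun x => `|f x|).
Proof. by move=> hf; apply: le_normr_Rintegral. Qed.

Lemma intgP (D : set R) f : measurable D -> mu.-integrable D (EFin \o f) <->
  measurable_fun D f /\ (\int[mu]_(x in D) `|f x|%:E < +oo)%E.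
Proof.
move=> mD; split.
  by move=> /integrableP[mf i]; split => //; exact/measurable_EFinP.
move=> [mf i]; apply/integrableP; split => //.
exact/measurable_EFinP.
Qed.

Lemma itg_cst c d k : c <= d -> itg c d (fun=> k) = k * (d - c).
Proof.
move=> cd; rewrite /itg Rintegral_cst//.
have -> : fine (mu `]c, d[) = fine (if (c%:E < d%:E)%E then (d%:E - c%:E)%E else 0%E).
  by congr fine; exact: (@lebesgue_measure_itv R `]c, d[).
by move: cd; rewrite lte_fin -EFinB le_eqVlt => /predU1P[->|->//]; rewrite ltxx subrr.
Qed.

Lemma itgb_cst c d k : itgb c d (fun=> k).
Proof.
suff h : mu.-integrable `[c, d] (EFin \o (fun _ : R => k)).
  apply: integrableS h => //; exact: subset_itv_oo_cc.
apply: continuous_compact_integrable.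
exact: segment_compact.
by move=> x; exact: cst_continuous.
Qed.

Lemma itgb_cont c d f : {within `[c, d], continuous f} -> itgb c d f.
Proof.
move=> cf.
suff h : mu.-integrable `[c, d] (EFin \o f).
  apply: integrableS h => //; exact: subset_itv_oo_cc.
by apply: continuous_compact_integrable; [exact: segment_compact|].
Qed.

Lemma itgbcc c d f : itgb c d f <-> mu.-integrable `[c, d] (EFin \o f).
Proof.
split=> [h|]; last by apply: integrableS => //; exact: subset_itv_oo_cc.
move: h => /intgP[]// mf fi; apply/intgP => //; split.
  by apply: measurable_fun_itv_cc mf.
rewrite integral_itv_bndoo//.
apply/measurable_EFinP.
exact: measurableT_comp.
Qed.

Lemma itgcc c d f : itgb c d f -> itg c d f = \int[mu]_(x in `[c, d]) f x.
Proof.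
move=> /itgb_meas h; rewrite /itg /Rintegral [in RHS]integral_itv_bndoo//.
apply/measurable_EFinP; exact h.
Qed.

Lemma itg_ge c d f : d <= c -> itg c d f = 0.
Proof. by move=> dc; rewrite /itg set_itv_ge ?Rintegral_set0 // bnd_simp -leNgt. Qed.

Lemma itgb_union c m d f : c <= m -> m <= d -> itgb c m f -> itgb m d f -> itgb c d f.
Proof.
move=> cm md /itgbcc h1 /itgbcc h2; apply/itgbcc.
have -> : `[c, d]%classic = `[c, m]%classic `|` `[m, d]%classic.
  apply/seteqP; split => x /=; rewrite !in_itv /=.
    by move=> /andP[-> ->]; rewrite andbT; case: leP => [|/ltW]; auto.
  by move=> [/andP[-> h]|/andP[h ->]] /=; rewrite ?andbT; [apply: le_trans md|apply: le_trans h].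
move: h1 h2 => /intgP[]// m1 i1 /intgP[]// m2 i2; apply/intgP; first exact: measurableU.
split; first by apply/measurable_funU.
apply: le_lt_trans (_ : (\int[mu]_(x in `[c, m]) `|f x|%:E + \int[mu]_(x in `[m, d]) `|f x|%:E)%E
  < +oo)%E; last exact: lte_add_pinfty.
(* Additivity of the integral needs disjoint pieces, so the point [m] is removed from the second
   one. *)
have -> : `[c, m]%classic `|` `[m, d]%classic = `[c, m]%classic `|` `]m, d]%classic.
  apply/seteqP; split => x /=; rewrite !in_itv /=.
    move=> [|/andP[h ->]]; first by left.
    by move: h; rewrite le_eqVlt => /orP[/eqP <-|->]; [left; rewrite lexx cm|right].
  by move=> [|/andP[/ltW -> ->]]; [left|right].
have m2' : measurable_fun `]m, d] f.
  by apply: measurable_funS m2 => //; exact: subset_itv_oc_cc.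
rewrite ge0_integral_setU//=; first last.
- apply/disj_setPS => x /=; rewrite !in_itv /= => -[/andP[_ h] /andP[h2 _]].
  by move: h; rewrite leNgt h2.
- apply/measurable_EFinP.
  suff h : measurable_fun (`[c, m] `|` `]m, d]) (fun x : R => `|f x|) by exact: h.
  by apply: measurableT_comp => //; apply/measurable_funU.
apply: leeD => //.
apply: ge0_subset_integral => //; last exact: subset_itv_oc_cc.
apply/measurable_EFinP.
suff h : measurable_fun `[m, d] (fun x : R => `|f x|) by exact: h.
exact: measurableT_comp.
Qed.

Lemma itg_split c m d f : c <= m -> m <= d -> itgb c d f ->
  itg c d f = itg c m f + itg m d f.
Proof.
move=> cm md h.
have h1 := itgb_sub (lexx c) md h; have h2 := itgb_sub cm (lexx d) h.
have /itgbcc h' := h.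
rewrite !itgcc//.
have := @Rintegral_itvB R f (BLeft c) (BRight d) m h'; rewrite !bnd_simp => /(_ cm md).
rewrite Rintegral_itv_obnd_cbnd; last first.
  apply: integrableS h' => //; apply: subset_itvScc; rewrite !bnd_simp //.
by move=> <-; rewrite addrC subrK.
Qed.

Lemma ae_imp (P Q : R -> Prop) : aeP P -> (forall x, P x -> Q x) -> aeP Q.
Proof. by move=> h PQ; apply: filterS h => //; exact: (ae_filter_ringOfSetsType mu). Qed.

Lemma ae_imp2 (P Q S : R -> Prop) : aeP P -> aeP Q ->
  (forall x, P x -> Q x -> S x) -> aeP S.
Proof. by move=> h h' PQ; apply: filterS2 h h' => //; exact: (ae_filter_ringOfSetsType mu). Qed.

Lemma ae_all (P : R -> Prop) : (forall x, P x) -> aeP P.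
Proof. by move=> h; apply: aeW. Qed.

Lemma ae_itg c d f g : measurable_fun `]c, d[ f -> measurable_fun `]c, d[ g ->
  aer c d f g -> itg c d f = itg c d g.
Proof.
move=> mf mg h; rewrite /itg /Rintegral; congr fine.
apply: ae_eq_integral => //; [exact/measurable_EFinP..|].
suff k : aeP (fun x => `]c, d[%classic x -> (f x)%:E = (g x)%:E) by exact: k.
by apply: (ae_imp h) => x /= k0 /k0 ->.
Qed.

Lemma ae_itgb c d f g : measurable_fun `]c, d[ g -> aer c d f g -> itgb c d f -> itgb c d g.
Proof.
move=> mg h /intgP[]// mf i; apply/intgP => //; split => //.
rewrite (_ : (\int[mu]_(x in `]c, d[) `|g x|%:E)%E =
  (\int[mu]_(x in `]c, d[) `|f x|%:E)%E)//.
apply: ae_eq_integral => //.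
- apply/measurable_EFinP; suff k : measurable_fun `]c, d[ (fun x : R => `|g x|) by exact: k.
  exact: measurableT_comp.
- apply/measurable_EFinP; suff k : measurable_fun `]c, d[ (fun x : R => `|f x|) by exact: k.
  exact: measurableT_comp.
suff k : aeP (fun x => `]c, d[%classic x -> `|g x|%:E = `|f x|%:E) by exact: k.
by apply: (ae_imp h) => x /= k0 /k0 ->.
Qed.

End Integral.

(** * Absolutely continuous functions on an interval *)

Section Prim.
Context {R : realType}.
Notation mu := (@lebesgue_measure R).
Implicit Types (c d x y : R) (f g F G : R -> R).

(** Absolute continuity of [F] on [c,d] with density [f]. The values of [F] matter at every point,
    those of [f] only almost everywhere; this is how an L^2 class is integrated into a function that
    has end values. *)
Definition prim c d F f : Prop :=
  itgb c d f /\ forall x, c <= x <= d -> F x = F c + itg c x f.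

Lemma prim_incr c d F f x y : prim c d F f -> c <= x -> x <= y -> y <= d ->
  F y - F x = itg x y f.
Proof.
move=> [hf hF] cx xy yd; rewrite (hF y) ?(le_trans cx xy)// (hF x) ?cx ?(le_trans xy)//.
rewrite (itg_split cx xy (itgb_sub (lexx c) yd hf)) opprD addrACA subrr add0r.
by rewrite addrAC subrr add0r.
Qed.

Lemma prim_end c d F f : c <= d -> prim c d F f -> F d - F c = itg c d f.
Proof. by move=> cd h; apply: prim_incr h _ _ _. Qed.

Lemma prim_restr c d c' d' F f : c <= c' -> d' <= d -> prim c d F f -> prim c' d' F f.
Proof.
move=> cc dd h; split; first by apply: itgb_sub h.1.
move=> x /andP[cx xd]; rewrite -(prim_incr h cc cx (le_trans xd dd)).
by rewrite addrC subrK.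
Qed.

Lemma eq_prim c d F G f g : (forall x, c <= x <= d -> F x = G x) ->
  (forall x, c < x < d -> f x = g x) -> prim c d F f -> prim c d G g.
Proof.
move=> FG fg [h1 h2]; split; first exact: eq_itgb h1.
move=> x /andP[cx xd]; rewrite -FG ?cx// h2 ?cx// FG ?lexx ?(le_trans cx)//.
congr (_ + _); apply: eq_itg => y /andP[cy yx]; apply: fg.
by rewrite cy (lt_le_trans yx).
Qed.

Lemma primD c d F f G g : prim c d F f -> prim c d G g ->
  prim c d (fun x => F x + G x) (fun x => f x + g x).
Proof.
move=> hf hg; split; first exact: itgbD hf.1 hg.1.
move=> x /andP[cx xd]; have s := itgb_sub (lexx c) xd.
rewrite itgD; [|exact: s hf.1|exact: s hg.1].
by rewrite hf.2 ?cx// hg.2 ?cx// addrACA.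
Qed.

Lemma primZ c d k F f : prim c d F f -> prim c d (fun x => k * F x) (fun x => k * f x).
Proof.
move=> hf; split; first exact: itgbZ hf.1.
move=> x /andP[cx xd]; have s := itgb_sub (lexx c) xd.
by rewrite itgZ; [rewrite hf.2 ?cx// mulrDr|exact: s hf.1].
Qed.

Lemma primB c d F f G g : prim c d F f -> prim c d G g ->
  prim c d (fun x => F x - G x) (fun x => f x - g x).
Proof.
move=> hf /(primZ (-1)) hg; have := primD hf hg.
by apply: eq_prim => x _; rewrite mulN1r.
Qed.

Lemma prim_itg c d f : itgb c d f -> prim c d (fun x => itg c x f) f.
Proof. by move=> h; split => // x _; rewrite (itg_ge _ (lexx c)) add0r. Qed.

Lemma prim_cont c d F f : prim c d F f -> {within `[c, d], continuous F}.
Proof.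
move=> h; have [cd|dc] := leP c d; last first.
  by rewrite set_itv_ge; [exact: continuous_subspace0|rewrite bnd_simp -ltNge].
have := parameterized_integral_continuous cd ((itgbcc _ _ _).1 h.1) => k.
have k2 : {within `[c, d], continuous (fun x => F c + parameterized_integral mu c x f)}.
  by move=> x; apply: cvgD; [exact: cvg_cst|exact: k].
apply: subspace_eq_continuous k2 => x; rewrite inE /= in_itv /= => /andP[cx xd].
rewrite /from_subspace /= (h.2 x) ?cx// /parameterized_integral; congr (_ + _).
by apply/esym/itgcc/(itgb_sub _ xd h.1).
Qed.

Lemma prim_deriv c d F f : {within `[c, d], continuous f} ->
  (forall x, c <= x <= d -> is_derive x 1 F (f x)) -> prim c d F f.
Proof.
move=> cf dF; split; first exact: itgb_cont.
move=> x /andP[]; rewrite le_eqVlt => /predU1P[<- _|cx xd]; first by rewrite itg_ge// addr0.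
have sub : `[c, x] `<=` `[c, d] by apply: subset_itvScc; rewrite bnd_simp.
have cf' : {within `[c, x], continuous f} by apply: continuous_subspaceW cf.
have dF' y : y \in `[c, x] -> is_derive y 1 F (f y).
  by rewrite in_itv /= => /andP[cy yx]; apply: dF; rewrite cy (le_trans yx).
have cF y : y \in `[c, x] -> {for y, continuous F}.
  by move=> /dF' [dy _]; apply/differentiable_continuous/derivable1_diffP.
have := @continuous_FTC2 R f F c x cx cf'.
have -> : (\int[mu]_(y in `[c, x]) (f y)%:E)%E = (itg c x f)%:E.
  rewrite (itgcc (itgb_cont cf')) /Rintegral fineK//.
  by apply: integrable_fin_num => //; apply/itgbcc/itgb_cont.
rewrite -EFinB => h; have [] : (itg c x f)%:E = (F x - F c)%:E.
  apply: h.
    split.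
    - move=> y yI; by have /dF' [] := subset_itv_oo_cc yI.
    - by apply: cvg_at_right_filter; apply: cF; rewrite in_itv /= lexx ltW.
    - by apply: cvg_at_left_filter; apply: cF; rewrite in_itv /= lexx ltW.
  move=> y yI; have /dF' [_ hy] := subset_itv_oo_cc yI.
  by rewrite derive1E.
by move=> ->; rewrite addrC subrK.
Qed.

(** Lebesgue differentiation: extended by 0 to the line, [f] is almost everywhere the derivative of
    its primitive from -oo, and that primitive is identically zero. *)
Lemma itg_zero_ae c d f : itgb c d f -> (forall x, c <= x <= d -> itg c x f = 0) ->
  aer c d f (fun=> 0).
Proof.
move=> hf h0.
have [cd|dc] := ltP c d; last first.
  by apply: ae_all => x /=; rewrite in_itv /= => /andP[cx /(lt_trans cx)]; rewrite ltNge dc.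
pose f' := f \_ `]c, d[.
have if' : mu.-integrable setT (EFin \o f').
  by rewrite -restrict_EFin; apply/integrable_restrict => //; rewrite setTI.
have F0 x : \int[mu]_(t in `]-oo, x]) f' t = 0.
  rewrite /f' -Rintegral_mkcondr.
  have [xc|cx] := leP x c.
    rewrite (_ : _ `&` _ = set0) ?Rintegral_set0//.
    rewrite -subset0 => y /= []; rewrite !in_itv /= => yx /andP[cy _].
    by have := lt_le_trans cy (le_trans yx xc); rewrite ltxx.
  have [xd|dx] := ltP x d.
    rewrite (_ : _ `&` _ = `]c, x]%classic); last first.
      apply/seteqP; split => y /=; rewrite !in_itv /=.
        by move=> [-> /andP[-> _]].
      by move=> /andP[-> yx]; rewrite yx (le_lt_trans yx).
    rewrite -Rintegral_itv_bndo_bndc; first by rewrite -/(itg c x f) h0// !ltW.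
    exact: itgb_sub (lexx c) (ltW xd) hf.
  rewrite (_ : _ `&` _ = `]c, d[%classic) -?/(itg c d f) ?h0 ?lexx ?ltW//.
  apply/seteqP; split => y /=; rewrite !in_itv /=; first by case.
  by move=> /andP[-> yd]; rewrite yd (le_trans (ltW yd)).
have := @FTC1Ny R f'.
have loc : locally_integrable setT f' by apply: open_integrable_locally => //; exact: openT.
have int' y : mu.-integrable `]-oo, y] (EFin \o f') by apply: integrableS if'.
move=> /(_ int' loc) /= k.
have k' : aeP (fun x => f' x = 0).
  refine (ae_imp k _) => x [_ <-].
  by rewrite (_ : (fun _ => _) = cst 0) ?derive1_cst//; apply/funext => y; exact: F0.
apply: (ae_imp k') => x + xI; rewrite /f' patchE mem_set//.
Qed.

Lemma prim_uniq c d F f g : prim c d F f -> prim c d F g -> aer c d f g.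
Proof.
move=> hf hg.
have k := primB hf hg.
have : aer c d (fun x => f x - g x) (fun=> 0).
  apply: itg_zero_ae k.1 _ => x /andP[cx xd].
  by rewrite -(prim_incr k (lexx c) cx xd) !subrr.
by move=> {}k; apply: (ae_imp k) => x h /h /eqP; rewrite subr_eq0 => /eqP.
Qed.

End Prim.

Section ContAe.
Context {R : realType}.
Notation mu := (@lebesgue_measure R).
Implicit Types (c d x y : R) (f g F G : R -> R).

(** At an interior point a continuous [F] is the derivative of [itg c x F], which vanishes; the end
    points follow by one-sided limits. *)
Lemma cont_ae0 c d F : c < d -> {within `[c, d], continuous F} -> aer c d F (fun=> 0) ->
  forall x, c <= x <= d -> F x = 0.
Proof.
move=> cd cF F0.
have mF : measurable_fun `]c, d[ F by exact: itgb_meas (itgb_cont cF).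
have i0 x : c <= x <= d -> itg c x F = 0.
  move=> /andP[cx xd].
  transitivity (itg c x (fun=> 0)); last by rewrite itg_cst// mul0r.
  apply: ae_itg => //.
    by apply: measurable_funS mF => //; apply: subset_itvSoo; rewrite bnd_simp.
  apply: (ae_imp F0) => y h; rewrite /= in_itv /= => /andP[cy yx]; apply: h.
  by rewrite /= in_itv /= cy (lt_le_trans yx).
have /(continuous_within_itvP _ cd) [cI cc cD] := cF.
have int0 x : c < x < d -> F x = 0.
  move=> /andP[cx xd].
  have Fx : {for x, continuous F} by apply: cI; rewrite in_itv /= cx.
  have /itgbcc iF := itgb_cont cF.
  have [_ <-] := continuous_FTC1_closed xd iF cx Fx.
  rewrite derive1E.
  rewrite (@near_eq_derive _ _ _ _ (cst 0)) ?derive_cst//.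
  near=> y; rewrite -itgcc.
    rewrite i0//; apply/andP; split; apply: ltW; near: y.
      by apply: lt_nbhsr.
    by apply: lt_nbhsl.
  apply: itgb_sub (lexx c) _ (itgb_cont cF); apply: ltW; near: y; exact: lt_nbhsl.
move=> x /andP[]; rewrite le_eqVlt => /predU1P[<- _|cx].
  apply/esym/(cvg_unique _ _ cc) => //.
  apply: (@cvg_trans _ ((fun=> 0 : R) y @[y --> c^'+])); last exact: cvg_cst.
  apply: near_eq_cvg; near=> y; rewrite int0//.
  by apply/andP; split; near: y; [exact: nbhs_right_gt|exact: nbhs_right_lt].
rewrite le_eqVlt => /predU1P[->|xd]; last by apply: int0; rewrite cx.
apply/esym/(cvg_unique _ _ cD) => //.
apply: (@cvg_trans _ ((fun=> 0 : R) y @[y --> d^'-])); last exact: cvg_cst.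
apply: near_eq_cvg; near=> y; rewrite int0//.
by apply/andP; split; near: y; [exact: nbhs_left_gt|exact: nbhs_left_lt].
Unshelve. all: by end_near. Qed.

Lemma cont_ae_eq c d F G : c < d -> {within `[c, d], continuous F} ->
  {within `[c, d], continuous G} -> aer c d F G ->
  forall x, c <= x <= d -> F x = G x.
Proof.
move=> cd cF cG h x xI; apply/eqP; rewrite -subr_eq0; apply/eqP.
apply: (cont_ae0 cd (F := fun x => F x - G x)) xI.
  by move=> y; apply: cvgB; [exact: cF|exact: cG].
by apply: (ae_imp h) => y k /k ->; rewrite subrr.
Qed.

End ContAe.

(** * Products of absolutely continuous functions *)

Section Mul.
Context {R : realType}.
Notation mu := (@lebesgue_measure R).
Implicit Types (c d x y : R) (f g F G : R -> R).

Lemma itgb_patch c d f : itgb c d f <-> mu.-integrable setT (EFin \o (f \_ `]c, d[)).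
Proof.
by rewrite -restrict_EFin; split => h; [|rewrite /itgb -(setTI `]c, d[%classic)];
  apply/integrable_restrict => //; rewrite ?setTI.
Qed.

Lemma itg_patch c d f : \int[mu]_x (f \_ `]c, d[) x = itg c d f.
Proof. by rewrite -Rintegral_mkcond. Qed.

(* Fubini on the triangle [t <= s]. *)
Lemma itg_exchange c d f g : itgb c d f -> itgb c d g ->
  itg c d (fun s => f s * itg c s g) = itg c d (fun t => g t * itg t d f).
Proof.
move=> hf hg.
pose f' := f \_ `]c, d[; pose g' := g \_ `]c, d[.
have /itgb_patch if' := hf.
have /itgb_patch ig' := hg.
have mf' : measurable_fun setT f' by have /intgP[] := if'.
have mg' : measurable_fun setT g' by have /intgP[] := ig'.
pose K (z : R * R) : R := if z.2 <= z.1 then f' z.1 * g' z.2 else 0.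
have mK : measurable_fun setT K.
  apply: measurable_fun_ifT => //.
    by apply: measurable_fun_ler.
  by apply: measurable_funM; apply: measurableT_comp.
have Kx s t : s \notin `]c, d[ -> K (s, t) = 0.
  by move=> h; rewrite /K /= /f' patchE memNset ?mul0r ?if_same// => /=; exact/negP.
have Kt s t : t \notin `]c, d[ -> K (s, t) = 0.
  by move=> h; rewrite /K /= /g' (patchE _ _ t) memNset ?mulr0 ?if_same// => /=; exact/negP.
have iK : (mu \x mu)%E.-integrable setT (EFin \o K).
  apply/integrable12ltyP; first by apply/measurable_EFinP.
  (* Tonelli yields the integrability of [K]: for fixed s, the integral of its modulus in t is at
     most [C], the L^1 norm of [g], times the modulus of [f' s]. *)
  have [C C0 hC] : exists2 C : R, 0 <= C & (\int[mu]_y `|g' y|%:E = C%:E)%E.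
    exists (\int[mu]_y `|g' y|); first by apply: Rintegral_ge0.
    rewrite /Rintegral fineK//.
    by apply: integrable_fin_num => //; apply: integrable_norm.
  apply: (@le_lt_trans _ _ (\int[mu]_x (C * `|f' x|)%:E)%E).
    apply: ge0_le_integral => //.
    - by move=> x _; apply: integral_ge0.
    - apply: (@measurable_fun_fubini_tonelli_F _ _ _ _ _ mu (fun z => `|(K z)%:E|%E)) => //.
      by apply: measurableT_comp => //; apply/measurable_EFinP.
    - apply/measurable_EFinP.
      suff h : measurable_fun setT (fun x : R => C * `|f' x|) by exact: h.
      by apply: measurable_funM => //; apply: measurableT_comp.
    move=> x _.
    have mgn : measurable_fun setT (fun x : R => `|g' x|) by apply: measurableT_comp.
    have -> : (C * `|f' x|)%:E = (\int[mu]_y (`|f' x| * `|g' y|)%:E)%E.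
      rewrite mulrC EFinM -hC -ge0_integralZl//.
      by apply/measurable_EFinP; exact: mgn.
    apply: ge0_le_integral => //.
    - apply: measurableT_comp => //; apply/measurable_EFinP.
      have := measurableT_comp mK (@pair1_measurable _ _ _ _ x); exact.
    - apply/measurable_EFinP.
      suff h : measurable_fun setT (fun y : R => `|f' x| * `|g' y|) by exact: h.
      by apply: measurable_funM.
    move=> y _; rewrite /= lee_fin /K /=; case: ifP => _; first by rewrite normrM.
    by rewrite normr0 mulr_ge0.
  have : itgb c d (fun x => C * `|f x|) by apply/itgbZ/itgb_norm.
  move=> /itgb_patch /intgP[]// _; congr (_ < _)%E.
  apply: eq_integral => x _; congr EFin; rewrite /f' !patchE.
  by case: ifP => _; rewrite ?normr0 ?mulr0// ger0_norm// mulr_ge0.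
have patchZ (k : R) (h : R -> R) (A : set R) : measurable A -> mu.-integrable A (EFin \o h) ->
    (\int[mu]_y (k * (h \_ A) y)%:E = (k * \int[mu]_(y in A) h y)%:E)%E.
  move=> mA ih; rewrite -RintegralZl// /Rintegral fineK; last first.
    apply: integrable_fin_num => //.
    suff w : mu.-integrable A (fun x => k%:E * (EFin \o h) x)%E by exact: w.
    exact: integrableZl.
  rewrite [in RHS]integral_mkcond; apply: eq_integral => x _.
  by rewrite !patchE; case: ifP => // _; rewrite mulr0.
have E1 s : (\int[mu]_t (K (s, t))%:E = (((fun s => f s * itg c s g) \_ `]c, d[) s)%:E)%E.
  rewrite patchE; case: ifPn => [|sI]; last first.
    rewrite (_ : (fun t => (K (s, t))%:E) = cst 0%E) ?integral0//.
    by apply/funext => t; rewrite Kx//; apply: contra sI; rewrite inE.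
  rewrite inE /= in_itv /= => /andP[cs sd].
  have hgs := itgb_sub (lexx c) (ltW sd) hg.
  rewrite /itg Rintegral_itv_bndo_bndc// -patchZ//; last first.
    by apply: integrableS hg => // y /=; rewrite !in_itv /= => /andP[-> ys]; rewrite (le_lt_trans
      ys).
  congr (integral _ _ _); apply/funext => t; congr EFin.
  rewrite /K /= /f' /g' !patchE !mem_setE !in_itv /= cs sd /=.
  have [ts|ts] := leP t s; last by rewrite andbF mulr0.
  by rewrite (le_lt_trans ts sd) andbT.
have E2 t : (\int[mu]_s (K (s, t))%:E = (((fun t => g t * itg t d f) \_ `]c, d[) t)%:E)%E.
  rewrite patchE; case: ifPn => [|tI]; last first.
    rewrite (_ : (fun s => (K (s, t))%:E) = cst 0%E) ?integral0//.
    by apply/funext => s; rewrite Kt//; apply: contra tI; rewrite inE.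
  rewrite inE /= in_itv /= => /andP[ct td].
  have hfs := itgb_sub (ltW ct) (lexx d) hf.
  rewrite /itg Rintegral_itv_obnd_cbnd// -patchZ//; last first.
    by apply: integrableS hf => // y /=; rewrite !in_itv /= => /andP[ty ->]; rewrite (lt_le_trans
      ct).
  congr (integral _ _ _); apply/funext => s; congr EFin.
  rewrite /K /= /f' /g' !patchE !mem_setE !in_itv /= ct td /=.
  have [ts|ts] := leP t s; last by rewrite mulr0.
  by rewrite (lt_le_trans ct ts) mulrC.
have := Fubini iK; rewrite /=.
under eq_integral do rewrite E1.
under [X in _ = X]eq_integral do rewrite E2.
move=> h; rewrite -itg_patch -[RHS]itg_patch /Rintegral.
by rewrite h.
Qed.

Lemma itgb_mul_cont c d F g : {within `[c, d], continuous F} -> itgb c d g ->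
  itgb c d (fun x => F x * g x).
Proof.
move=> cF ig.
have mF := itgb_meas (itgb_cont cF).
have /compact_bounded [M [_ hM]] := continuous_compact cF (@segment_compact _ c d).
apply: (@itgb_le _ _ _ _ (fun x => (M + 1) * `|g x|)).
- by apply: measurable_funM => //; exact: itgb_meas ig.
- by apply/itgbZ/itgb_norm.
move=> x /andP[cx xd]; rewrite normrM ler_wpM2r//; apply: hM; first by rewrite ltrDl.
by exists x => //=; rewrite in_itv /= !ltW.
Qed.

(** As [f] and [g] are merely integrable, the product rule cannot come from pointwise derivatives.
    Once the constants [F c] and [G c] are split off, only the product of two primitives vanishing
    at [c] is left, and that is Fubini on a triangle. *)
Lemma prim_mul c d F G f g : prim c d F f -> prim c d G g ->
  prim c d (fun x => F x * G x) (fun x => f x * G x + F x * g x).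
Proof.
move=> hF hG.
have cF := prim_cont hF; have cG := prim_cont hG.
have i1 : itgb c d (fun x => f x * G x).
  by apply: eq_itgb (itgb_mul_cont cG hF.1) => x _; rewrite mulrC.
have i2 := itgb_mul_cont cF hG.1.
split; first exact: itgbD.
move=> x /andP[cx xd].
have s := itgb_sub (lexx c) xd.
have hF' := prim_restr (lexx c) xd hF; have hG' := prim_restr (lexx c) xd hG.
pose P s := itg c s f; pose Q s := itg c s g.
have cP := prim_cont (prim_itg hF'.1); have cQ := prim_cont (prim_itg hG'.1).
have iQ := itgb_mul_cont cQ hF'.1; have iP := itgb_mul_cont cP hG'.1.
(* The exchange turns the first integral into that of [g t] times [P x - P t], and the second
   integral cancels the [P t] part. *)
have E : itg c x (fun s => Q s * f s) + itg c x (fun s => P s * g s) = P x * Q x.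
  have -> : itg c x (fun s => Q s * f s) = itg c x (fun t => g t * itg t x f).
    by rewrite -itg_exchange; [apply: eq_itg => y _; rewrite mulrC|exact: hF'.1|exact: hG'.1].
  have -> : itg c x (fun t => g t * itg t x f) = itg c x (fun t => P x * g t - P t * g t).
    apply: eq_itg => t /andP[ct tx].
    rewrite -mulrBl mulrC; congr (_ * _).
    by rewrite /P (itg_split (ltW ct) (ltW tx) hF'.1) addrC addrA [_ + itg c t f]addrC subrr
      add0r.
  rewrite itgB//; last exact/itgbZ/hG'.1.
  by rewrite subrK itgZ//; exact: hG'.1.
have -> : itg c x (fun y => f y * G y + F y * g y) =
    itg c x (fun y => (G c * f y + F c * g y) + (Q y * f y + P y * g y)).
  apply: eq_itg => y /andP[cy yx].
  have yI : c <= y <= x by rewrite !ltW.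
  rewrite (hF'.2 y yI) (hG'.2 y yI) -/(P y) -/(Q y); ring.
have j1 := itgbZ (G c) hF'.1; have j2 := itgbZ (F c) hG'.1.
rewrite itgD; [|exact: itgbD|exact: itgbD].
rewrite itgD// itgD// E !itgZ; [|exact: hG'.1|exact: hF'.1].
rewrite (hF.2 x) ?cx// (hG.2 x) ?cx// -/(P x) -/(Q x); ring.
Qed.

End Mul.

(** * Smooth functions, test functions and the du Bois-Reymond lemma *)

Section Smooth.
Context {R : realType}.
Implicit Types (f g : R -> R) (x : R) (k : nat).

Lemma der_eq f x (a b : R) : is_derive x 1 f a -> a = b -> is_derive x 1 f b.
Proof. by move=> h <-. Qed.

Lemma der_add f g x (a b : R) : is_derive x 1 f a -> is_derive x 1 g b ->
  is_derive x 1 (fun y => f y + g y) (a + b).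
Proof. by move=> hf hg; exact: is_deriveD. Qed.

Lemma der_sub f g x a b : is_derive x 1 f a -> is_derive x 1 g b ->
  is_derive x 1 (fun y => f y - g y) (a - b).
Proof. by move=> hf hg; exact: is_deriveB. Qed.

Lemma der_mul f g x a b : is_derive x 1 f a -> is_derive x 1 g b ->
  is_derive x 1 (fun y => f y * g y) (a * g x + f x * b).
Proof. by move=> hf hg; apply: der_eq (is_deriveM hf hg) _; rewrite addrC mulrC. Qed.

Lemma der_scale f x (k a : R) : is_derive x 1 f a -> is_derive x 1 (fun y => k * f y) (k * a).
Proof.
by move=> hf; apply: der_eq (der_mul (is_derive_cst k x 1) hf) _; rewrite mul0r add0r.
Qed.

Lemma der_comp f g x a b : is_derive (g x) 1 f a -> is_derive x 1 g b ->
  is_derive x 1 (fun y => f (g y)) (a * b).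
Proof. by move=> hf hg; exact: is_derive1_comp. Qed.

Lemma der_derive1 f x : derivable f x 1 -> is_derive x 1 f (derive1 f x).
Proof. by move=> h; apply: DeriveDef => //; rewrite derive1E. Qed.

Lemma derive1_der f x a : is_derive x 1 f a -> derive1 f x = a.
Proof. by move=> [_ <-]; rewrite derive1E. Qed.

Lemma der_continuous f x a : is_derive x 1 f a -> {for x, continuous f}.
Proof. by move=> [dy _]; apply/differentiable_continuous/derivable1_diffP. Qed.

(** The recursion peels off the innermost derivative, so an induction hypothesis applies to
    [derive1 f]; Leibniz and chain rules need it in this form, whereas [smooth] iterates on the
    outside. *)
Fixpoint derivable_upto k f : Prop :=
  (forall x, derivable f x 1) /\
  (if k is k'.+1 then derivable_upto k' (derive1 f) else True).

Definition smooth f : Prop := forall k x, derivable (derive1n k f) x 1.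

Lemma smoothP f : smooth f <-> forall k, derivable_upto k f.
Proof.
split=> [sf k|h k].
  elim: k f sf => [|k IH] f sf /=; first by split => // x; exact: sf 0%N x.
  split; first exact: sf 0%N.
  by apply: IH => j x; rewrite -derive1Sn; exact: sf.
elim: k f h => [|k IH] f h; first by have [] := h 0%N.
by move=> x; rewrite derive1Sn; apply: IH => j; have [] := h j.+1.
Qed.

Lemma derivable_upto_pred k f : derivable_upto k.+1 f -> derivable_upto k f.
Proof.
elim: k f => [|k IH] f [h1 h2]; first by split.
by split => //; apply: IH.
Qed.

Lemma derive1_sum f g : (forall x, derivable f x 1) -> (forall x, derivable g x 1) ->
  derive1 (fun y => f y + g y) = (fun y => derive1 f y + derive1 g y).
Proof.
move=> hf hg; apply/funext => x; apply: derive1_der.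
by apply: der_add; exact: der_derive1.
Qed.

Lemma derivable_uptoD k f g : derivable_upto k f -> derivable_upto k g ->
  derivable_upto k (fun y => f y + g y).
Proof.
elim: k f g => [|k IH] f g [hf hf'] [hg hg'].
  by split; [move=> x; exact: derivableD (hf x) (hg x)|exact: I].
split; first by move=> x; apply: derivableD.
by rewrite derive1_sum//; apply: IH.
Qed.

Lemma derivable_uptoM k f g : derivable_upto k f -> derivable_upto k g ->
  derivable_upto k (fun y => f y * g y).
Proof.
elim: k f g => [|k IH] f g hf hg.
  by split; [move=> x; exact: derivableM (hf.1 x) (hg.1 x)|exact: I].
split; first by move=> x; apply: derivableM; [apply: hf.1|apply: hg.1].
have -> : derive1 (fun y => f y * g y) = (fun y => derive1 f y * g y + f y * derive1 g y).
  apply/funext => x; apply: derive1_der.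
  by apply: der_mul; apply: der_derive1; [apply: hf.1|apply: hg.1].
apply: derivable_uptoD; apply: IH; try exact: derivable_upto_pred.
  exact: hf.2.
exact: hg.2.
Qed.

Lemma smoothD f g : smooth f -> smooth g -> smooth (fun y => f y + g y).
Proof.
by move=> /smoothP hf /smoothP hg; apply/smoothP => k; apply: derivable_uptoD.
Qed.

Lemma smoothM f g : smooth f -> smooth g -> smooth (fun y => f y * g y).
Proof.
by move=> /smoothP hf /smoothP hg; apply/smoothP => k; apply: derivable_uptoM.
Qed.

Lemma smooth_cst (k : R) : smooth (fun=> k).
Proof.
apply/smoothP => n; elim: n k => [|n IH] k; first by split.
split=> //; rewrite (_ : derive1 _ = fun=> 0); first exact: IH.
by apply/funext => x; rewrite derive1_cst.
Qed.

Lemma smooth_comp_affine f p q : smooth f -> smooth (fun y => f (p * y + q)).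
Proof.
have d x g : (forall x, derivable g x 1) ->
    is_derive x 1 (fun y => g (p * y + q)) (derive1 g (p * x + q) * p).
  move=> hg; apply: der_comp; first exact: der_derive1.
  apply: der_eq (der_add (der_scale p (is_derive_id x 1)) (is_derive_cst q x 1)) _.
  by rewrite addr0 mulr1.
move=> /smoothP hf; apply/smoothP => k.
have {hf} : derivable_upto k f by [].
elim: k f => [|k IH] f [hf hf'].
  by split; [move=> x; have [] := d x f hf|exact: I].
split; first by move=> x; have [] := d x f hf.
have -> : derive1 (fun y => f (p * y + q)) = (fun y => derive1 f (p * y + q) * p).
  by apply/funext => x; apply/derive1_der/d.
apply: derivable_uptoM; first exact: IH.
by apply: (smoothP _).1 (@smooth_cst p) k.
Qed.

Lemma smooth_derive1 f : smooth f -> smooth (derive1 f).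
Proof. by move=> h k x; rewrite -derive1Sn; exact: h. Qed.

Lemma smooth_der f x : smooth f -> is_derive x 1 f (derive1 f x).
Proof. by move=> h; apply: der_derive1; exact: (h 0%N). Qed.

Lemma smooth_continuous f : smooth f -> continuous f.
Proof. by move=> h x; apply: der_continuous (smooth_der x h). Qed.

Lemma smooth_antiderivative f g : (forall x, is_derive x 1 f (g x)) -> smooth g -> smooth f.
Proof.
move=> fg /smoothP hg; apply/smoothP => -[|k]; first by split => // x; have [] := fg x.
split; first by move=> x; have [] := fg x.
have -> : derive1 f = g by apply/funext => x; exact: derive1_der.
exact: hg.
Qed.

Lemma poly_bound (p : {poly R}) : exists2 n : nat, (0 < n)%N & exists2 C : R, 0 <= C & forall t :
  R, 1 <= t -> `|p.[t]| <= C * t ^+ n.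
Proof.
exists (size p).+1 => //.
exists (\sum_(i < size p) `|p`_i|); first exact: sumr_ge0.
move=> t t1; rewrite horner_coef mulr_suml.
apply: le_trans (ler_norm_sum _ _ _) _; apply: ler_sum => i _.
rewrite normrM ler_wpM2l// normrX ger0_norm ?(le_trans ler01)//.
by rewrite ler_weXn2l// ltnW// ltnS ltnW.
Qed.

(** From [t ^+ n / n! <= expR t], applied to X^2 p instead of p. The gain of t^-2 is what makes the
    difference quotient of [flat p] at 0 tend to 0. *)
Lemma poly_expN_bound (p : {poly R}) : exists2 C : R, 0 <= C &
  forall t : R, 1 <= t -> `|p.[t] * expR (- t)| <= C / t ^+ 2.
Proof.
have [[//|n] _ [C C0 hC]] := poly_bound ('X ^+ 2 * p).
exists (C * n.+1`!%:R); first by rewrite mulr_ge0.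
move=> t t1; have t0 : 0 < t by rewrite (lt_le_trans ltr01).
have := @expR_ge1Dxn _ t n (ltW t0) => h1.
have h2 : t ^+ n.+1 <= n.+1`!%:R * expR t.
  rewrite mulrC -ler_pdivrMr ?ltr0n ?fact_gt0//; apply: le_trans h1.
  by rewrite lerDr.
have := hC t t1; rewrite hornerM hornerXn normrM (ger0_norm (exprn_ge0 2 (ltW t0))) => h.
rewrite ler_pdivlMr ?exprn_gt0// normrM (ger0_norm (expR_ge0 _)).
have -> : C * n.+1`!%:R = C * (n.+1`!%:R * expR t) * expR (- t).
  by rewrite -!mulrA -expRD subrr expR0 mulr1.
rewrite mulrAC ler_wpM2r ?expR_ge0// mulrC (le_trans h)// ler_wpM2l//.
Qed.

(* [p(1/y) e^{-1/y}] extended by 0 to [y <= 0]; these functions are stable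
   under differentiation. *)
Definition flat (p : {poly R}) (y : R) : R :=
  if 0 < y then p.[y^-1] * expR (- y^-1) else 0.

(** For y > 0 each of the two terms of the product rule carries a factor y^-2, hence X^2 (p - p').
    At 0 the slope [flat p z / z] is at most C z for small z > 0 and vanishes for z <= 0, so
    Caratheodory's criterion gives derivative 0. *)
Lemma der_flat (p : {poly R}) (y : R) :
  is_derive y 1 (flat p) (flat ('X ^+ 2 * (p - p^`())) y).
Proof.
have [y0|y0|->] := ltgtP y 0.
- have := is_derive_cst (0 : R) y 1.
  rewrite {2}/flat ltNge (ltW y0) /=; apply: near_eq_is_derive.
  near=> z; rewrite /flat ltNge (_ : z <= 0)//.
  by apply: ltW; near: z; exact: lt_nbhsl.
- have d1 : is_derive y 1 (fun z : R => z^-1) (- y ^- 2).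
    by apply: der_eq (is_deriveV (lt0r_neq0 y0) (is_derive_id y 1)) _; rewrite /GRing.scale/=
      mulr1.
  have d2 := der_comp (is_derive_poly p y^-1) d1.
  have d3 : is_derive y 1 (fun z => expR (- z^-1)) (expR (- y^-1) * y ^- 2).
    apply: (der_comp (g := fun z : R => - z^-1)) => //.
    by apply: der_eq (is_deriveN d1) _; rewrite opprK.
  have d4 : is_derive y 1 (fun z : R => p.[z^-1] * expR (- z^-1)) (flat ('X ^+ 2 * (p - p^`()))
    y).
    apply: der_eq (der_mul d2 d3) _.
    rewrite /flat y0 hornerM hornerXn hornerD hornerN -exprVn; ring.
  move: d4; apply: near_eq_is_derive.
  near=> z; rewrite /flat (_ : 0 < z)//; near: z; exact: lt_nbhsr.
- have [C C0 hC] := poly_expN_bound p.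
  rewrite {2}/flat ltxx; apply/is_derive1_caratheodory.
  exists (fun z => flat p z / z); split; last by rewrite /flat ltxx mul0r.
    move=> z; rewrite {2}/flat ltxx !subr0.
    have [->|z0] := eqVneq z 0; first by rewrite /flat ltxx mulr0.
    by rewrite divfK.
  apply/cvgrPdist_le => e e0 /=.
  have f0 : flat p 0 = 0 by rewrite /flat ltxx.
  near=> z; rewrite f0 mul0r sub0r normrN.
  have [z0|z0] := ltP 0 z; last by rewrite /flat ltNge z0 mul0r normr0 ltW.
  have z1 : z <= 1 by apply: ltW; near: z; exact: lt_nbhsl.
  have ze : C * z <= e.
    have zz : z <= e / (C + 1).
      by apply: ltW; near: z; apply: lt_nbhsl; rewrite divr_gt0// ltr_wpDl.
    rewrite ler_pdivlMr ?ltr_wpDl// in zz.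
    by apply: le_trans zz; rewrite mulrC ler_pM2l// lerDl.
  have := hC z^-1; rewrite invf_ge1// => /(_ z1).
  rewrite /flat z0 [`|_ / z|]normrM normfV (gtr0_norm z0) ler_pdivrMr// => h.
  apply: le_trans h _; rewrite exprVn invrK.
  by rewrite expr2 mulrA ler_wpM2r// ltW.
Unshelve. all: by end_near. Qed.

Lemma smooth_flat (p : {poly R}) : smooth (flat p).
Proof.
apply/smoothP => k; elim: k p => [|k IH] p.
  by split => // x; have [] := der_flat p x.
split; first by move=> x; have [] := der_flat p x.
rewrite (_ : derive1 (flat p) = flat ('X ^+ 2 * (p - p^`())))//.
by apply/funext => x; apply: derive1_der; exact: der_flat.
Qed.

End Smooth.

(** * Test functions, and recovering a function from its weak derivative *)

Section TestFunctions.
Context {R : realType}.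
Implicit Types (f g u phi psi : R -> R) (c d s t x : R) (k : nat).

(** The integral from 0 is signed by hand, since [itg] vanishes on reversed intervals. Near a given
    x it differs by a constant from the integral based at a point [c] left of both x and 0, where
    the fundamental theorem applies. *)
Lemma antiderivative f : continuous f -> exists F : R -> R, forall x, is_derive x 1 F (f x).
Proof.
move=> cf.
have ib c d : itgb c d f by apply: itgb_cont; exact: continuous_subspaceT.
exists (fun x => if 0 <= x then itg 0 x f else - itg x 0 f) => x.
pose c := Num.min x 0 - 1.
have cx : c < x.
  rewrite /c; have : Num.min x 0 <= x by rewrite ge_min lexx.
  lra.
have c0 : c < 0.
  rewrite /c; have : Num.min x 0 <= 0 by rewrite ge_min lexx orbT.
  lra.
have x1 : x < x + 1 by rewrite ltrDl.
have [dF Fx] := continuous_FTC1_closed x1 ((itgbcc _ _ _).1 (ib c (x + 1))) cx (cf x).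
have : is_derive x 1 (fun y => \int[lebesgue_measure]_(t in `[c, y]) f t - itg c 0 f) (f x).
  apply: der_eq (der_sub (DeriveDef dF _) (is_derive_cst (itg c 0 f) x 1)) _.
  rewrite -derive1E; exact: Fx. by rewrite subr0.
apply: near_eq_is_derive; near=> y.
have cy : c < y by near: y; exact: lt_nbhsr.
rewrite -itgcc//.
have [y0|y0] := leP 0 y.
  by rewrite (itg_split (ltW c0) y0 (ib _ _)) addrC addKr.
by rewrite (itg_split (ltW cy) (ltW y0) (ib _ _)) opprD addrA subrr sub0r.
Unshelve. all: by end_near. Qed.

Lemma test_smooth c d phi : test_fun c d phi -> smooth phi.
Proof. by case. Qed.

Lemma test_cont c d phi s t : test_fun c d phi -> {within `[s, t], continuous phi}.
Proof. by move=> h; apply: continuous_subspaceT; exact/smooth_continuous/test_smooth/h. Qed.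

Lemma test_itgb c d phi s t : test_fun c d phi -> itgb s t phi.
Proof. by move=> h; apply/itgb_cont/test_cont/h. Qed.

Lemma test_supp c d phi : test_fun c d phi -> exists c' d', [/\ c < c', d' < d &
  forall x, (x <= c') || (d' <= x) -> phi x = 0].
Proof.
move=> [_ [c' [d' [cc dd h]]]].
exists ((c + c') / 2), ((d' + d) / 2); split; [lra|lra|move=> x /orP hx].
apply: h; rewrite in_itv /= negb_and -!ltNge.
by case: hx => hx; apply/orP; [left|right]; lra.
Qed.

Lemma test_out c d phi x : test_fun c d phi -> (x <= c) || (d <= x) -> phi x = 0.
Proof.
move=> /test_supp [c' [d' [cc dd h]]] /orP hx; apply: h.
by case: hx => hx; apply/orP; [left|right]; lra.
Qed.

Lemma test_derive1 c d phi : test_fun c d phi -> test_fun c d (derive1 phi).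
Proof.
move=> h; have [c' [d' [cc dd h0]]] := test_supp h.
split; first by apply: smooth_derive1; exact: test_smooth h.
exists c', d'; split => // x; rewrite in_itv /= negb_and -!ltNge => hx.
apply: derive1_der; have := is_derive_cst (0 : R) x 1; apply: near_eq_is_derive.
case/orP: hx => hx; near=> y; rewrite h0//; apply/orP; [left|right]; apply: ltW; near: y.
  exact: lt_nbhsl.
exact: lt_nbhsr.
Unshelve. all: by end_near. Qed.

Lemma test_derive1n c d phi k : test_fun c d phi -> test_fun c d (derive1n k phi).
Proof.
by elim: k => [//|k IH] h; rewrite derive1nS; apply/test_derive1/IH.
Qed.

Lemma testD c d phi psi : test_fun c d phi -> test_fun c d psi -> test_fun c d (fun x => phi x +
  psi x).
Proof.
move=> h1 h2; split; first by apply: smoothD; [exact: test_smooth h1|exact: test_smooth h2].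
have [c1 [d1 [cc1 dd1 hh1]]] := test_supp h1.
have [c2 [d2 [cc2 dd2 hh2]]] := test_supp h2.
exists (Num.min c1 c2), (Num.max d1 d2); split.
- by rewrite lt_min cc1.
- by rewrite gt_max dd1.
move=> x; rewrite in_itv /= negb_and -!ltNge lt_min gt_max => hx.
rewrite hh1 ?hh2 ?addr0//.
  by case/orP: hx => /andP[/ltW h /ltW h']; rewrite ?h' ?orbT.
by case/orP: hx => /andP[/ltW h /ltW h']; rewrite ?h ?orbT.
Qed.

Lemma testZ c d (r : R) phi : test_fun c d phi -> test_fun c d (fun x => r * phi x).
Proof.
move=> h1; split; first by apply: smoothM; [exact: smooth_cst|exact: test_smooth h1].
have [c1 [d1 [cc1 dd1 hh1]]] := test_supp h1.
exists c1, d1; split => // x; rewrite in_itv /= negb_and -!ltNge => hx.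
by rewrite hh1 ?mulr0//; case/orP: hx => /ltW ->; rewrite ?orbT.
Qed.

Lemma prim_test c d phi s t : test_fun c d phi -> prim s t phi (derive1 phi).
Proof.
move=> h; apply: prim_deriv; first by apply/test_cont/test_derive1/h.
by move=> x _; apply/smooth_der/test_smooth/h.
Qed.

Lemma prim_parts c d F f phi : c <= d -> prim c d F f -> test_fun c d phi ->
  itg c d (fun x => F x * derive1 phi x) = - itg c d (fun x => f x * phi x).
Proof.
move=> cd hF hp; have hm := prim_mul hF (prim_test c d hp).
have := prim_end cd hm.
rewrite !(test_out hp) ?lexx ?orbT// !mulr0 subrr itgD.
- by move/eqP; rewrite eq_sym addrC addr_eq0 => /eqP.
- have i1 := itgb_mul_cont (test_cont hp) hF.1.
  by apply: eq_itgb i1 => x _; rewrite mulrC.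
- by apply: itgb_mul_cont (prim_cont hF) _; exact/test_itgb/test_derive1/hp.
Qed.

(* [e^{-1/(n(x-s))} e^{-1/(n(t-x))}] on [(s,t)]: tends to its indicator. *)
Definition bump s t (n : nat) (x : R) : R :=
  flat 1%:P (n.+1%:R * (x - s)) * flat 1%:P (n.+1%:R * (t - x)).

Lemma flat1_le1 (y : R) : 0 <= flat 1%:P y <= 1.
Proof.
rewrite /flat; case: ifP => y0; last by rewrite lexx ler01.
by rewrite hornerC mul1r expR_ge0/= -expR0 ler_expR oppr_le0 invr_ge0 ltW.
Qed.

Lemma bump_le1 s t n x : 0 <= bump s t n x <= 1.
Proof.
have /andP[a1 a2] := flat1_le1 (n.+1%:R * (x - s)).
have /andP[b1 b2] := flat1_le1 (n.+1%:R * (t - x)).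
by rewrite /bump mulr_ge0//= mulr_ile1.
Qed.

Lemma flat1_gt0 (y : R) : 0 < y -> 0 < flat 1%:P y.
Proof. by move=> y0; rewrite /flat y0 hornerC mul1r expR_gt0. Qed.

Lemma bump_gt0 s t n x : s < x < t -> 0 < bump s t n x.
Proof. by move=> /andP[sx xt]; apply: mulr_gt0; apply/flat1_gt0/mulr_gt0; rewrite ?subr_gt0. Qed.

Lemma bump_out s t n x : ~~ (s < x < t) -> bump s t n x = 0.
Proof.
move=> h; rewrite /bump /flat !pmulr_rgt0 ?subr_gt0 ?ltr0n//.
by case/nandP: h => /negbTE ->; rewrite ?mul0r ?mulr0.
Qed.

Lemma test_bump c d s t n : c < s -> t < d -> test_fun c d (bump s t n).
Proof.
move=> cs td; split.
  apply: smoothM.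
    have := smooth_comp_affine (p := n.+1%:R) (q := - (n.+1%:R * s)) (@smooth_flat R 1%:P).
    by congr smooth; apply/funext => x; rewrite mulrBr.
  have := smooth_comp_affine (p := - n.+1%:R) (q := n.+1%:R * t) (@smooth_flat R 1%:P).
  by congr smooth; apply/funext => x; rewrite mulrBr mulNr addrC.
exists s, t; split => // x; rewrite in_itv /= => h; apply: bump_out.
by apply: contra h => /andP[/ltW -> /ltW ->].
Qed.

Lemma flat1_cvg (y : R) : 0 < y -> (fun n : nat => flat 1%:P (n.+1%:R * y)) @ \oo --> (1 : R).
Proof.
move=> y0.
have -> : (fun n : nat => flat 1%:P (n.+1%:R * y)) = (fun n => expR (- (y^-1 * n.+1%:R^-1))).
  by apply/funext => n; rewrite /flat pmulr_rgt0// y0 hornerC mul1r invfM mulrC.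
rewrite -[X in _ --> X]expR0; apply: continuous_cvg; first exact: continuous_expR.
rewrite -[X in _ --> X]oppr0 -[X in _ --> - X](mulr0 y^-1); apply: cvgN; apply: cvgM; first
  exact: cvg_cst.
exact: cvg_harmonic.
Qed.

Lemma bump_cvg s t x : (fun n => bump s t n x) @ \oo --> (if s < x < t then 1 else 0 : R).
Proof.
case: ifPn => h; last first.
  by rewrite (_ : (fun n => _) = fun=> 0); [exact: cvg_cst|apply/funext => n; exact: bump_out].
case/andP: h => sx xt; rewrite -[X in _ --> X]mulr1.
by apply: cvgM; apply: flat1_cvg; rewrite subr_gt0.
Qed.

Lemma measurable_EFin (D : set R) f : measurable_fun D f ->
  @measurable_fun _ _ (measurableTypeR R) _ D (fun x => (f x)%:E).
Proof. by move=> mf; apply/measurable_EFinP; exact: mf. Qed.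

Lemma itg_dct c d (fn : nat -> R -> R) f h :
  (forall n, measurable_fun `]c, d[ (fn n)) -> measurable_fun `]c, d[ f -> itgb c d h ->
  (forall n x, c < x < d -> `|fn n x| <= h x) ->
  (forall x, c < x < d -> (fun n => fn n x) @ \oo --> f x) ->
  (fun n => itg c d (fn n)) @ \oo --> itg c d f.
Proof.
move=> mfn mf ih hb hc.
have ifn n : itgb c d (fn n) by apply: itgb_le ih (hb n).
have := @dominated_convergence _ _ _ (@lebesgue_measure R) `]c, d[ (measurable_itv _)
  (fun n x => (fn n x)%:E) (fun x => (f x)%:E) (fun x => (h x)%:E).
case.
- by move=> n; exact: measurable_EFin.
- exact: measurable_EFin.
- apply: aeW => x /=; rewrite in_itv /= => /hc k.
  by apply: cvg_EFin => //; exact: nearW.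
- exact: ih.
- by apply: aeW => x n /=; rewrite in_itv /= => /(hb n); rewrite lee_fin.
move=> iff _ k.
by rewrite /itg /Rintegral; apply: fine_cvg; rewrite fineK//; exact: integrable_fin_num.
Qed.

(** Bumps converge boundedly to the indicator of ]s,t[, so by dominated convergence [g] has zero
    integral over every interval strictly inside ]c,d[. Its primitive is then constant, and it
    vanishes at [c]. *)
Lemma test_zero_ae c d g : c < d -> itgb c d g ->
  (forall phi, test_fun c d phi -> itg c d (fun x => g x * phi x) = 0) ->
  aer c d g (fun=> 0).
Proof.
move=> cd ig h.
have mg := itgb_meas ig.
have z s t : c < s -> s <= t -> t < d -> itg s t g = 0.
  move=> cs st td.
  pose chi x : R := if s < x < t then 1 else 0.
  have mchi : measurable_fun `]c, d[ chi.
    suff mT : measurable_fun setT chi by exact: measurable_funS mT.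
    by apply: measurable_fun_ifT => //; apply: measurable_and; exact: measurable_fun_ltr.
  have k : (fun n => itg c d (fun x => g x * bump s t n x)) @ \oo --> itg c d (fun x => g x * chi
    x).
    apply: (@itg_dct c d (fun n x => g x * bump s t n x) _ (fun x => `|g x|)).
    - move=> n; apply: measurable_funM => //.
      apply: itgb_meas; exact: (test_itgb c d (test_bump n cs td)).
    - by apply: measurable_funM.
    - exact: itgb_norm.
    - move=> n x _; have /andP[b0 b1] := bump_le1 s t n x.
      by rewrite normrM (ger0_norm b0) ler_piMr.
    - by move=> x _; apply: cvgM; [exact: cvg_cst|exact: bump_cvg].
  have k0 : (fun n => itg c d (fun x => g x * bump s t n x)) = fun=> 0.
    by apply/funext => n; apply: h; exact: test_bump.
  have : itg c d (fun x => g x * chi x) = 0.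
    by rewrite k0 in k; apply: (cvg_unique _ k) => //; exact: cvg_cst.
  have ichi : itgb c d (fun x => g x * chi x).
    apply: itgb_le (itgb_norm ig) _; first exact: measurable_funM.
    move=> x _; rewrite /chi; case: ifP => _; first by rewrite mulr1.
    by rewrite mulr0 normr0.
  rewrite (itg_split (ltW cs) (le_trans st (ltW td)) ichi).
  rewrite (itg_split st (ltW td) (itgb_sub (ltW cs) (lexx d) ichi)).
  have -> : itg c s (fun x => g x * chi x) = 0.
    rewrite -[RHS](mul0r (s - c)) -itg_cst ?(ltW cs)//; apply: eq_itg => x /andP[_ xs].
    by rewrite /chi ltNge (ltW xs) mulr0.
  have -> : itg t d (fun x => g x * chi x) = 0.
    rewrite -[RHS](mul0r (d - t)) -itg_cst ?(ltW td)//; apply: eq_itg => x /andP[tx _].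
    by rewrite /chi (ltNge x t) (ltW tx) andbF mulr0.
  rewrite add0r addr0 => <-; apply: eq_itg => x sxt; by rewrite /chi sxt mulr1.
(* Claim [z] only covers intervals away from both ends, so increments are measured from an interior
   point and continuity carries the equality to [c] and [d]. *)
pose m := (c + d) / 2.
have [cm md] : c < m /\ m < d by rewrite /m; split; lra.
have pG := prim_itg ig.
have cG : {within `[c, d], continuous (fun x => itg c x g - itg c m g)}.
  by move=> x; apply: cvgB; [exact: (prim_cont pG)|exact: cvg_cst].
have G0 := cont_ae0 cd cG.
have {}G0 x : c <= x <= d -> itg c x g = itg c m g.
  move=> xI; apply/eqP; rewrite -subr_eq0; apply/eqP/G0 => //; apply: ae_all => y.
  rewrite /= in_itv /= => /andP[cy yd].
  have [ym|my] := leP y m.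
    by rewrite -opprB (prim_incr pG (ltW cy) ym (ltW md)) z ?oppr0.
  by rewrite (prim_incr pG (ltW cm) (ltW my) (ltW yd)) z// ltW.
apply: itg_zero_ae ig _ => x xI.
by rewrite (G0 x xI) -(G0 c) ?lexx ?ltW// itg_ge.
Qed.

(** A bump on the middle third, normalised. Its integral is positive: otherwise the bump would
    vanish a.e., hence everywhere by continuity, against its value at the midpoint. *)
Lemma test_exists c d : c < d -> exists2 psi, test_fun c d psi & itg c d psi = 1.
Proof.
move=> cd.
pose s := (2 * c + d) / 3; pose t := (c + 2 * d) / 3.
have [cs st td] : [/\ c < s, s < t & t < d] by rewrite /s /t; split; lra.
have tb := test_bump 0 cs td.
have ib := test_itgb c d tb.
have b0 x : 0 <= bump s t 0 x by have /andP[] := bump_le1 s t 0 x.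
have I0 : 0 < itg c d (bump s t 0).
  rewrite lt_neqAle itg_ge0 ?andbT => [|x _]; last exact: b0.
  apply/eqP => /esym I0.
  have pb := prim_itg ib.
  have Iz x : c <= x <= d -> itg c x (bump s t 0) = 0.
    move=> /andP[cx xd]; apply/eqP; rewrite eq_le itg_ge0 ?andbT => [|y _]; last exact: b0.
    by rewrite -I0 (itg_split cx xd ib) lerDl itg_ge0.
  have ae := itg_zero_ae ib Iz.
  have := cont_ae0 cd (test_cont tb) ae (x := (s + t) / 2).
  have h : s < (s + t) / 2 < t by apply/andP; split; lra.
  have := bump_gt0 0 h => h1 h2; move: h1; rewrite h2 ?ltxx//.
  by apply/andP; split; lra.
exists (fun x => (itg c d (bump s t 0))^-1 * bump s t 0 x); first exact: testZ.
by rewrite itgZ// mulVf// gt_eqF.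
Qed.

(** The antiderivative vanishing at [c] is constant on both sides of the support; mean zero makes
    the constant on the right equal to 0 too. *)
Lemma test_antiderivative c d phi : c < d -> test_fun c d phi -> itg c d phi = 0 ->
  exists2 Phi, test_fun c d Phi & derive1 Phi = phi.
Proof.
move=> cd tphi I0.
have [F hF] := antiderivative (smooth_continuous (test_smooth tphi)).
have dF : derive1 F = phi by apply/funext => x; exact: derive1_der.
have [c' [d' [cc dd h0]]] := test_supp tphi.
have cst x y : x <= y -> (forall z, x <= z <= y -> phi z = 0) -> F x = F y.
  move=> xy z0; have p : prim x y F phi.
    by apply: prim_deriv; exact: test_cont tphi.
  have := prim_end xy p; rewrite (@eq_itg _ _ _ _ (fun=> 0)); last first.
    by move=> z /andP[xz zy]; rewrite z0// !ltW.
  by rewrite itg_cst// mul0r => /eqP; rewrite subr_eq0 => /eqP.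
have Fcd : F d = F c.
  have p : prim c d F phi by apply: prim_deriv; exact: test_cont tphi.
  by apply/eqP; rewrite -subr_eq0 (prim_end (ltW cd) p) I0.
have dPhi x : is_derive x 1 (fun y => F y - F c) (phi x).
  by apply: der_eq (der_sub (hF x) (is_derive_cst (F c) x 1)) _; rewrite subr0.
exists (fun x => F x - F c); last by apply/funext => x; exact: derive1_der.
split; first by apply: smooth_antiderivative dPhi _; exact: test_smooth tphi.
exists c', d'; split => // x; rewrite in_itv /= negb_and -!ltNge => /orP hx.
apply/eqP; rewrite subr_eq0; apply/eqP; case: hx => hx.
  have [xc|cx] := leP x c.
    by apply: cst => // z /andP[_ zc]; apply: h0; rewrite (le_trans zc (ltW cc)).
  by apply/esym/cst; [exact: ltW|move=> z /andP[_ zc]; apply: h0; rewrite (le_trans zc (ltW hx))].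
rewrite -Fcd; have [xd|dx] := leP x d.
  by apply: cst => // z /andP[xz _]; apply: h0; rewrite (le_trans (ltW hx) xz) orbT.
by apply/esym/cst; [exact: ltW|move=> z /andP[xz _]; apply: h0; rewrite (le_trans (ltW dd) xz)
  orbT].
Qed.

(* du Bois-Reymond lemma *)
Lemma weak_derivative_prim c d u g : c < d -> itgb c d u -> itgb c d g ->
  (forall phi, test_fun c d phi ->
    itg c d (fun x => u x * derive1 phi x) = - itg c d (fun x => g x * phi x)) ->
  exists C : R, aer c d u (fun x => C + itg c x g).
Proof.
move=> cd iu ig h.
have [psi tpsi psi1] := test_exists cd.
have pG := prim_itg ig.
pose w x := u x - itg c x g.
have iw : itgb c d w by apply: itgbB => //; exact/itgb_cont/prim_cont/pG.
have mul_test f phi : itgb c d f -> test_fun c d phi -> itgb c d (fun x => f x * phi x).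
  move=> ihf tphi; have i1 := itgb_mul_cont (test_cont tphi) ihf.
  by apply: eq_itgb i1 => x _; rewrite mulrC.
have w0 phi : test_fun c d phi -> itg c d (fun x => w x * derive1 phi x) = 0.
  move=> tphi; have t' := test_derive1 tphi.
  transitivity (itg c d (fun x => u x * derive1 phi x - itg c x g * derive1 phi x)).
    by apply: eq_itg => x _; rewrite -mulrBl.
  rewrite itgB; [|exact: mul_test|by apply: mul_test => //; exact/itgb_cont/prim_cont/pG].
  by rewrite h// (prim_parts (ltW cd) pG)// subrr.
pose C := itg c d (fun x => w x * psi x).
have z : aer c d (fun x => w x - C) (fun=> 0).
  apply: test_zero_ae => //; first exact: itgbB iw (itgb_cst _ _ _).
  move=> phi tphi.
  (* Subtracting the right multiple of [psi] gives mean zero, hence the derivative of a test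
     function, against which [w] integrates to 0. So [w] acts on every [phi] as the constant [C]. *)
  have tb : test_fun c d (fun x => phi x + (- itg c d phi) * psi x) by apply/testD/testZ.
  have [] := test_antiderivative cd tb.
    rewrite itgD; [|exact/test_itgb/tphi|exact/itgbZ/test_itgb/tpsi].
    by rewrite itgZ; [rewrite psi1 mulr1 subrr|exact/test_itgb/tpsi].
  move=> Phi tPhi ePhi; have := w0 _ tPhi; rewrite ePhi.
  have -> : itg c d (fun x => w x * (phi x + - itg c d phi * psi x)) =
            itg c d (fun x => w x * phi x + - itg c d phi * (w x * psi x)).
    by apply: eq_itg => x _; ring.
  rewrite itgD; [|exact: mul_test|exact/itgbZ/mul_test].
  rewrite itgZ; last exact: mul_test.
  rewrite -/C => e.
  transitivity (itg c d (fun x => w x * phi x - C * phi x)).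
    by apply: eq_itg => x _; ring.
  rewrite itgB; [|exact: mul_test|exact/itgbZ/test_itgb/tphi].
  rewrite itgZ; last exact/test_itgb/tphi.
  by rewrite -e; ring.
exists C; apply: (ae_imp z) => x hx /hx /eqP.
by rewrite /w subr_eq0 subr_eq => /eqP.
Qed.

End TestFunctions.

(** * The Poincare inequalities *)

Section Wirtinger.
Context {R : realType}.
Implicit Types (c d x : R) (f g : R -> R).

Lemma within_contM c d f g : {within `[c, d], continuous f} -> {within `[c, d], continuous g} ->
  {within `[c, d], continuous (fun x => f x * g x)}.
Proof. by move=> cf cg x; apply: cvgM; [exact: cf|exact: cg]. Qed.

Lemma within_contD c d f g : {within `[c, d], continuous f} -> {within `[c, d], continuous g} ->
  {within `[c, d], continuous (fun x => f x + g x)}.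
Proof. by move=> cf cg x; apply: cvgD; [exact: cf|exact: cg]. Qed.

Lemma der_within c d f g : (forall x, c <= x <= d -> is_derive x 1 f (g x)) ->
  {within `[c, d], continuous f}.
Proof.
move=> h; apply: continuous_in_subspaceT => x; rewrite inE /= in_itv /= => /h.
exact: der_continuous.
Qed.

(* [int (g' + T g)^2 >= 0] with [T = c tan (c (x - 1/2))], [T' = c^2 + T^2]. *)
Lemma wirtinger_lt c (g0 g1 : R -> R) : 0 < c -> c < pi -> prim 0 1 g0 g1 ->
  {within `[0, 1], continuous g1} -> g0 0 = 0 -> g0 1 = 0 ->
  c ^+ 2 * itg 0 1 (fun x => g0 x ^+ 2) <= itg 0 1 (fun x => g1 x ^+ 2).
Proof.
move=> c0 cpi pg cg1 g00 g01.
pose T x : R := c * tan (c * (x - 2^-1)).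
(* Since c < pi, the argument stays strictly between -pi/2 and pi/2; for c = pi the tangent would
   blow up at both ends. *)
have cos0 x : 0 <= x <= 1 -> cos (c * (x - 2^-1)) != 0 :> R.
  move=> /andP[x0 x1]; apply: lt0r_neq0; apply: cos_gt0_pihalf; apply/andP; split.
    have : 0 <= c * x by rewrite mulr_ge0// ltW. lra.
  have : c * x <= c by rewrite ler_piMr// ltW. lra.
have dT x : 0 <= x <= 1 -> is_derive x 1 T (c ^+ 2 + T x ^+ 2).
  move=> /cos0 cx.
  have d1 : is_derive x 1 (fun y : R => c * (y - 2^-1)) c.
    apply: der_eq (der_scale c (der_sub (is_derive_id x 1) (is_derive_cst (2^-1 : R) x 1))) _.
    by rewrite subr0 mulr1.
  have d2 : is_derive (c * (x - 2^-1)) 1 (@tan R) (cos (c * (x - 2^-1)) ^- 2) by exact: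
    is_derive_tan.
  apply: der_eq (der_scale c (der_comp (g := fun y => c * (y - 2^-1)) d2 d1)) _.
  rewrite /T /tan; set C := cos _ in cx *; set S := sin _.
  have -> : C ^- 2 = (C ^+ 2 + S ^+ 2) / C ^+ 2 by rewrite cos2Dsin2 div1r.
  by field.
have cT : {within `[0, 1], continuous T} by apply: der_within dT.
have cg0 := prim_cont pg.
have cT' : {within `[0, 1], continuous (fun x => c ^+ 2 + T x ^+ 2)}.
  apply: within_contD; first by move=> x; exact: cvg_cst.
  exact: within_contM.
have pT : prim 0 1 T (fun x => c ^+ 2 + T x ^+ 2) by apply: prim_deriv.
have p := prim_mul pT (prim_mul pg pg).
have := prim_end ler01 p; rewrite g00 g01 !mulr0 subrr => /esym I0.
have ig0 : itgb 0 1 (fun x => g0 x ^+ 2) by apply: itgb_cont; exact: within_contM.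
have ig1 : itgb 0 1 (fun x => g1 x ^+ 2) by apply: itgb_cont; exact: within_contM.
rewrite -itgZ// -subr_ge0 -itgB//; last exact: itgbZ.
have -> : itg 0 1 (fun x => g1 x ^+ 2 - c ^+ 2 * g0 x ^+ 2) =
    itg 0 1 (fun x => g1 x ^+ 2 - c ^+ 2 * g0 x ^+ 2) +
    itg 0 1 (fun x => (c ^+ 2 + T x ^+ 2) * (g0 x * g0 x) + T x * (g1 x * g0 x + g0 x * g1 x)).
  by rewrite I0 addr0.
rewrite -itgD; [|exact: itgbB ig1 (itgbZ _ ig0)|exact: p.1].
rewrite (@eq_itg _ _ _ _ (fun x => (g1 x + T x * g0 x) ^+ 2)).
  by apply: itg_ge0 => x _; exact: sqr_ge0.
by move=> x _; ring.
Qed.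

(** The constant pi itself is out of reach of the tangent argument and is obtained as the limit of c
    = pi - d. *)
Lemma wirtinger (g0 g1 : R -> R) : prim 0 1 g0 g1 ->
  {within `[0, 1], continuous g1} -> g0 0 = 0 -> g0 1 = 0 ->
  pi ^+ 2 * itg 0 1 (fun x => g0 x ^+ 2) <= itg 0 1 (fun x => g1 x ^+ 2).
Proof.
move=> pg cg1 g00 g01.
set N0 := itg 0 1 _; set N1 := itg 0 1 _.
have N00 : 0 <= N0 by apply: itg_ge0 => x _; exact: sqr_ge0.
have pi0 := pi_gt0 R.
apply/ler_addgt0Pr => e e0.
have M0 : 0 < 2 * pi * N0 + 1 by rewrite ltr_wpDl// !mulr_ge0// ltW.
(* The first bound keeps pi - d positive; the second keeps the loss 2 pi d N0 below [e], the added 1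
   protecting the division when N0 = 0. *)
pose d : R := Num.min (pi / 2) (e / (2 * pi * N0 + 1)).
have d0 : 0 < d by rewrite lt_min !divr_gt0.
have d1 : d <= pi / 2 by rewrite ge_min lexx.
have d2 : d * (2 * pi * N0 + 1) <= e by rewrite -ler_pdivlMr// ge_min lexx orbT.
have := @wirtinger_lt (pi - d) g0 g1 _ _ pg cg1 g00 g01; rewrite -/N0 -/N1 => h.
have {}h : (pi - d) ^+ 2 * N0 <= N1 by apply: h; lra.
have : (pi - d) ^+ 2 * N0 = pi ^+ 2 * N0 - 2 * pi * d * N0 + d ^+ 2 * N0 by ring.
have : 0 <= d ^+ 2 * N0 by rewrite mulr_ge0// sqr_ge0.
have : d * (2 * pi * N0 + 1) = 2 * pi * d * N0 + d by ring.
lra.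
Qed.

Definition l2 c d f : Prop := measurable_fun `]c, d[ f /\ itgb c d (fun x => f x ^+ 2).

Lemma l2_mul c d f g : l2 c d f -> l2 c d g -> itgb c d (fun x => f x * g x).
Proof.
move=> [mf i_f] [mg i_g]; apply: itgb_le (itgbD i_f i_g) _; first exact: measurable_funM.
move=> x _; rewrite normrM -[f x ^+ 2]real_normK ?num_real// -[g x ^+ 2]real_normK ?num_real//.
have := sqr_ge0 (`|f x| - `|g x|); have := normr_ge0 (f x); have := normr_ge0 (g x).
nra.
Qed.

Lemma l2_itgb c d f : l2 c d f -> itgb c d f.
Proof.
move=> [mf i_f]; apply: itgb_le (itgbD i_f (itgb_cst c d 1)) _ => // x _.
rewrite -[f x ^+ 2]real_normK ?num_real//.
have := sqr_ge0 (`|f x| - 1); have := normr_ge0 (f x); nra.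
Qed.

Lemma l2D c d f g : l2 c d f -> l2 c d g -> l2 c d (fun x => f x + g x).
Proof.
move=> hf hg; split; first exact: measurable_funD hf.1 hg.1.
have := itgbD (itgbD hf.2 hg.2) (itgbZ 2 (l2_mul hf hg)).
by apply: eq_itgb => x _; ring.
Qed.

Lemma l2Z c d k f : l2 c d f -> l2 c d (fun x => k * f x).
Proof.
move=> hf; split; first by apply: measurable_funM => //; exact: hf.1.
by have := itgbZ (k ^+ 2) hf.2; apply: eq_itgb => x _; rewrite exprMn.
Qed.

Lemma l2B c d f g : l2 c d f -> l2 c d g -> l2 c d (fun x => f x - g x).
Proof.
by move=> hf hg; have := l2D hf (l2Z (-1) hg); congr l2; apply/funext => x; rewrite mulN1r.
Qed.

Lemma l2_cont c d f : {within `[c, d], continuous f} -> l2 c d f.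
Proof.
move=> cf; split; first by apply: itgb_meas; exact: itgb_cont.
by apply: itgb_cont; exact: within_contM.
Qed.

Lemma l2_sub c d c' d' f : c <= c' -> d' <= d -> l2 c d f -> l2 c' d' f.
Proof.
move=> h1 h2 [mf i_f]; split; last exact: itgb_sub i_f.
by apply: measurable_funS mf => //; apply: subset_itvSoo; rewrite bnd_simp.
Qed.

(** A function of H^2(c,d) with its derivatives: [g0] and [g1] are continuous representatives, [g2]
    is only an L^2 function. *)
Definition chain2 c d (g0 g1 g2 : R -> R) : Prop :=
  [/\ prim c d g0 g1, prim c d g1 g2 & l2 c d g2].

(** Write N_i for the squared norms. As [g0] vanishes at the ends, the integral of g0 g2 is -N1, so
    expanding the square of pi^2 g0 + g2 gives 2 pi^2 N1 <= pi^4 N0 + N2. Wirtinger bounds pi^4 N0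
    by pi^2 N1, and both claims follow with no boundary condition on [g1]. *)
Lemma chain2_poincare (g0 g1 g2 : R -> R) : chain2 0 1 g0 g1 g2 -> g0 0 = 0 -> g0 1 = 0 ->
  pi ^+ 4 * itg 0 1 (fun x => g0 x ^+ 2) <= itg 0 1 (fun x => g2 x ^+ 2) /\
  pi ^+ 2 * itg 0 1 (fun x => g1 x ^+ 2) <= itg 0 1 (fun x => g2 x ^+ 2).
Proof.
move=> [p0 p1 h2] g00 g01.
have cg0 := prim_cont p0; have cg1 := prim_cont p1.
have h0 := l2_cont cg0; have h1 := l2_cont cg1.
have W := wirtinger p0 cg1 g00 g01.
have p := prim_mul p0 p1.
have := prim_end ler01 p; rewrite g00 g01 !mul0r subrr itgD; [|exact: l2_mul|exact: l2_mul].
set N0 := itg 0 1 (fun x => g0 x ^+ 2) in W *; set N2 := itg 0 1 (fun x => g2 x ^+ 2).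
rewrite (@eq_itg _ _ _ (fun x => g1 x * g1 x) (fun x => g1 x ^+ 2))//.
set N1 := itg 0 1 (fun x => g1 x ^+ 2) in W *; set P := itg 0 1 _ => E.
have pi0 := pi_gt0 R.
have Q : 0 <= pi ^+ 4 * N0 + 2 * pi ^+ 2 * P + N2.
  rewrite /N0 /P /N2 -!itgZ; [|exact: l2_mul|exact: h0.2].
  rewrite -!itgD.
  - apply: itg_ge0 => x _.
    by have := sqr_ge0 (pi ^+ 2 * g0 x + g2 x); congr (_ <= _); ring.
  - by apply/itgbD/itgbZ/l2_mul => //; apply/itgbZ/h0.2.
  - exact: h2.2.
  - exact/itgbZ/h0.2.
  - exact/itgbZ/l2_mul.
have P1 : P = - N1 by lra.
rewrite P1 in Q.
have W2 : pi ^+ 4 * N0 <= pi ^+ 2 * N1.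
  have -> : pi ^+ 4 * N0 = pi ^+ 2 * (pi ^+ 2 * N0) by ring.
  by rewrite ler_pM2l// exprn_gt0.
split; lra.
Qed.

(** The square g0(x)^2 is the integral of 2 g0 g1 from 0 to x, hence at most N0 + N1, and each of
    these is at most N2 because pi >= 1. *)
Lemma chain2_sup (g0 g1 g2 : R -> R) x : chain2 0 1 g0 g1 g2 -> g0 0 = 0 -> g0 1 = 0 ->
  0 <= x <= 1 -> g0 x ^+ 2 <= 2 * itg 0 1 (fun x => g2 x ^+ 2).
Proof.
move=> ch g00 g01 /andP[x0 x1]; have [P1 P2] := chain2_poincare ch g00 g01.
case: ch => p0 p1 h2.
have h0 := l2_cont (prim_cont p0); have h1 := l2_cont (prim_cont p1).
have pi2 : (2 : R) <= pi by exact: pi_ge2.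
have p := prim_mul p0 p0.
have := prim_incr p (lexx 0) x0 x1; rewrite g00 mul0r subr0 -expr2 => ->.
have i1 := itgbD h0.2 h1.2.
apply: le_trans (_ : itg 0 x (fun y => g0 y ^+ 2 + g1 y ^+ 2) <= _).
  apply: le_itg; [exact: itgb_sub p.1|exact: itgb_sub i1|move=> y _].
  have := sqr_ge0 (g0 y - g1 y); lra.
apply: le_trans (_ : itg 0 1 (fun y => g0 y ^+ 2 + g1 y ^+ 2) <= _).
  rewrite (itg_split x0 x1 i1) lerDl; apply: itg_ge0 => y _.
  by rewrite addr_ge0// sqr_ge0.
rewrite itgD; [|exact: h0.2|exact: h1.2].
have N0 : 0 <= itg 0 1 (fun x => g0 x ^+ 2) by apply: itg_ge0 => y _; exact: sqr_ge0.
have N1 : 0 <= itg 0 1 (fun x => g1 x ^+ 2) by apply: itg_ge0 => y _; exact: sqr_ge0.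
have q2 : (1 : R) <= pi ^+ 2 by nra.
have q4 : (1 : R) <= pi ^+ 4 by rewrite (_ : pi ^+ 4 = pi ^+ 2 * pi ^+ 2); [nra|ring].
nra.
Qed.

End Wirtinger.

(** * The Navier problem *)

Section ComplexODE.
Context {R : realType}.
Local Notation C := R[i].
Local Notation Re := (@complex.Re R).
Local Notation Im := (@complex.Im R).
Implicit Types (f g : R -> C) (r k : C) (x : R).
Local Open Scope complex_scope.

Lemma cReD (a b : C) : Re (a + b) = Re a + Re b. Proof. by case: a b => ? ? []. Qed.

Lemma cImD (a b : C) : Im (a + b) = Im a + Im b. Proof. by case: a b => ? ? []. Qed.

Lemma cReN (a : C) : Re (- a) = - Re a. Proof. by case: a. Qed.

Lemma cImN (a : C) : Im (- a) = - Im a. Proof. by case: a. Qed.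

Lemma cReB (a b : C) : Re (a - b) = Re a - Re b. Proof. by rewrite cReD cReN. Qed.

Lemma cImB (a b : C) : Im (a - b) = Im a - Im b. Proof. by rewrite cImD cImN. Qed.

Lemma cReM (a b : C) : Re (a * b) = Re a * Re b - Im a * Im b.
Proof. by case: a b => ? ? []. Qed.

Lemma cImM (a b : C) : Im (a * b) = Re a * Im b + Im a * Re b.
Proof. by case: a b => ? ? []. Qed.

Lemma ceq (a b : C) : Re a = Re b -> Im a = Im b -> a = b.
Proof. by case: a b => ? ? [? ?] /= -> ->. Qed.

Definition complexE := (cReB, cImB, cReD, cImD, cReN, cImN, cReM, cImM).

Definition cder f g : Prop := forall x,
  is_derive x 1 (fun y => Re (f y)) (Re (g x)) /\ is_derive x 1 (fun y => Im (f y)) (Im (g x)).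

Definition ccont f : Prop :=
  continuous (fun y => Re (f y)) /\ continuous (fun y => Im (f y)).

Lemma cder_ccont f g : cder f g -> ccont f.
Proof. by move=> h; split => x; have [h1 h2] := h x; [exact: der_continuous h1|exact:
  der_continuous h2]. Qed.

Lemma cder_eq f g g' : (forall x, g x = g' x) -> cder f g -> cder f g'.
Proof. by move=> e h x; rewrite -e. Qed.

Lemma cderD f f' g g' : cder f f' -> cder g g' ->
  cder (fun x => f x + g x) (fun x => f' x + g' x).
Proof.
move=> hf hg x; have [f1 f2] := hf x; have [g1 g2] := hg x; split.
  under eq_fun do rewrite cReD.
  by rewrite cReD; exact: der_add.
under eq_fun do rewrite cImD.
by rewrite cImD; exact: der_add.
Qed.

Lemma cderM f f' g g' : cder f f' -> cder g g' ->
  cder (fun x => f x * g x) (fun x => f' x * g x + f x * g' x).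
Proof.
move=> hf hg x; have [f1 f2] := hf x; have [g1 g2] := hg x; split.
  under eq_fun do rewrite cReM.
  apply: der_eq (der_sub (der_mul f1 g1) (der_mul f2 g2)) _.
  by rewrite !complexE; ring.
under eq_fun do rewrite cImM.
apply: der_eq (der_add (der_mul f1 g2) (der_mul f2 g1)) _.
by rewrite !complexE; ring.
Qed.

Lemma cder_cst k : cder (fun=> k) (fun=> 0).
Proof. by move=> x; split => /=; exact: is_derive_cst. Qed.

Lemma cderZ k f f' : cder f f' -> cder (fun x => k * f x) (fun x => k * f' x).
Proof. by move=> h; apply: cder_eq (cderM (cder_cst k) h) => x; rewrite mul0r add0r. Qed.

Lemma ccontD f g : ccont f -> ccont g -> ccont (fun x => f x + g x).
Proof.
move=> [f1 f2] [g1 g2]; split.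
  by under eq_fun do rewrite cReD; move=> x; apply: cvgD; [exact: f1|exact: g1].
by under eq_fun do rewrite cImD; move=> x; apply: cvgD; [exact: f2|exact: g2].
Qed.

Lemma ccontM f g : ccont f -> ccont g -> ccont (fun x => f x * g x).
Proof.
move=> [f1 f2] [g1 g2]; split.
  by under eq_fun do rewrite cReM; move=> x; apply: cvgB; apply: cvgM;
    [exact: f1|exact: g1|exact: f2|exact: g2].
by under eq_fun do rewrite cImM; move=> x; apply: cvgD; apply: cvgM;
    [exact: f1|exact: g2|exact: f2|exact: g1].
Qed.

Lemma ccont_cst k : ccont (fun=> k).
Proof. by split => x; exact: cvg_cst. Qed.

Lemma cantiderivative f : ccont f -> forall k, exists2 F, cder F f & F 0 = k.
Proof.
move=> [/antiderivative [F1 h1] /antiderivative [F2 h2]] k.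
exists (fun x => (F1 x - F1 0 + Re k) +i* (F2 x - F2 0 + Im k)) => /=.
  move=> x; split => /=.
    apply: der_eq (der_add (der_sub (h1 x) (is_derive_cst (F1 0) x 1)) (is_derive_cst (Re k) x
      1)) _.
    by rewrite subr0 addr0.
  apply: der_eq (der_add (der_sub (h2 x) (is_derive_cst (F2 0) x 1)) (is_derive_cst (Im k) x 1))
    _.
  by rewrite subr0 addr0.
by apply: ceq => /=; rewrite subrr add0r.
Qed.

Definition cexp r x : C :=
  (expR (Re r * x) * cos (Im r * x)) +i* (expR (Re r * x) * sin (Im r * x)).

Lemma cder_cexp r : cder (cexp r) (fun x => r * cexp r x).
Proof.
move=> x.
have dl (s : R) : is_derive x 1 (fun y => s * y) s.
  by apply: der_eq (der_scale s (is_derive_id x 1)) _; rewrite mulr1.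
have de := der_comp (is_derive_expR (Re r * x)) (dl (Re r)).
have dc := der_comp (is_derive_cos (Im r * x)) (dl (Im r)).
have ds := der_comp (is_derive_sin (Im r * x)) (dl (Im r)).
split.
  by apply: der_eq (der_mul de dc) _; rewrite cReM /=; ring.
by apply: der_eq (der_mul de ds) _; rewrite cImM /=; ring.
Qed.

Lemma cexp0 r : cexp r 0 = 1.
Proof. by apply: ceq => /=; rewrite !mulr0 expR0 ?cos0 ?sin0 mul1r. Qed.

Lemma cexpN r x : cexp r x * cexp (- r) x = 1.
Proof.
apply: ceq; rewrite !complexE /= !cReN !cImN !mulNr cosN sinN expRN.
  have e0 : expR (Re r * x) != 0 by rewrite gt_eqF// expR_gt0.
  have := cos2Dsin2 (Im r * x) => h.
  by rewrite -[RHS]h; field.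
ring.
Qed.

(** Variation of constants: [F] is an antiderivative of exp(-r x) f. *)
Lemma linear_ode1 r f k : ccont f ->
  exists2 w, cder w (fun x => r * w x + f x) & w 0 = k.
Proof.
move=> cf.
have c1 : ccont (fun x => cexp (- r) x * f x).
  by apply: ccontM => //; exact: cder_ccont (cder_cexp _).
have [F dF F0] := cantiderivative c1 k.
exists (fun x => cexp r x * F x); last by rewrite cexp0 F0 mul1r.
apply: cder_eq (cderM (cder_cexp r) dF) => x.
by rewrite !mulrA cexpN mul1r.
Qed.

(** With r^2 = k the equation factors as (D - r)(D + r) z = f. The intermediate unknown y = z' + r z
    satisfies a first-order equation and starts at B + r A. *)
Lemma linear_ode2 k f (A B : C) : ccont f -> exists z z1,
  [/\ cder z z1, cder z1 (fun x => k * z x + f x), z 0 = A & z1 0 = B].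
Proof.
move=> cf.
have [r rk] : exists r : C, r * r = k by exists (sqrtC k); rewrite -expr2 sqrtCK.
have [y dy y0] := linear_ode1 r (B + r * A) cf.
have [z dz z0] := linear_ode1 (- r) A (cder_ccont dy).
exists z, (fun x => - r * z x + y x); split => //; last by rewrite z0 y0 mulNr addrC addrK.
by apply: cder_eq (cderD (cderZ (- r) dz) dy) => x; rewrite -rk; ring.
Qed.

(** Says that [k] is not a Dirichlet eigenvalue of D^2 on (0,1), in the form that shooting uses. *)
Definition nonresonant k : Prop := forall S S1, cder S S1 -> cder S1 (fun x => k * S x) ->
  S 0 = 0 -> S1 0 = 1 -> S 1 != 0.

(** Shooting: the particular solution with zero initial data is corrected by the multiple of the
    homogeneous solution [S] that cancels its value at 1. *)
Lemma dirichlet2 k f : nonresonant k -> ccont f -> exists z z1,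
  [/\ cder z z1, cder z1 (fun x => k * z x + f x), z 0 = 0 & z 1 = 0].
Proof.
move=> nr cf.
have [z [z1 [dz dz1 z0 _]]] := linear_ode2 k 0 0 cf.
have [S [S1 [dS dS1 S0 S10]]] := linear_ode2 k 0 1 (ccont_cst 0).
have {}dS1 : cder S1 (fun x => k * S x) by apply: cder_eq dS1 => x; rewrite addr0.
have Sn := nr S S1 dS dS1 S0 S10.
exists (fun x => z x + (- (z 1 / S 1)) * S x), (fun x => z1 x + (- (z 1 / S 1)) * S1 x); split.
- exact/cderD/cderZ.
- by apply: cder_eq (cderD dz1 (cderZ (- (z 1 / S 1)) dS1)) => x; ring.
- by rewrite z0 S0 mulr0 addr0.
- by rewrite mulNr divfK// subrr.
Qed.

(* [D^4 - k^2 = (D^2 - k)(D^2 + k)] *)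
Lemma navier4 k f : nonresonant k -> nonresonant (- k) -> ccont f -> exists u u1 u2 u3,
  [/\ cder u u1, cder u1 u2, cder u2 u3 & cder u3 (fun x => k ^+ 2 * u x + f x)] /\
  [/\ u 0 = 0, u 1 = 0, u2 0 = 0 & u2 1 = 0].
Proof.
move=> n1 n2 cf.
have [w [w1 [dw dw1 w0 w_1]]] := dirichlet2 n1 cf.
have [u [u1 [du du1 u0 u_1]]] := dirichlet2 n2 (cder_ccont dw).
exists u, u1, (fun x => - k * u x + w x), (fun x => - k * u1 x + w1 x); split; split => //.
- exact/cderD/dw/cderZ.
- by apply: cder_eq (cderD (cderZ (- k) du1) dw1) => x; ring.
- by rewrite u0 w0 mulr0 addr0.
- by rewrite u_1 w_1 mulr0 addr0.
Qed.

End ComplexODE.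

(** * The Navier problem with a merely integrable right-hand side *)

Section NavierL2.
Context {R : realType}.
Local Notation C := R[i].
Local Notation Re := (@complex.Re R).
Local Notation Im := (@complex.Im R).
Implicit Types (c d x : R).

(** Extends a function continuous on [c,d] by its end values, because [antiderivative] asks for
    continuity on the whole line. *)
Lemma clamp_continuous c d (f : R -> R) : c <= d -> {within `[c, d], continuous f} ->
  continuous (fun x => f (Num.max c (Num.min x d))).
Proof.
move=> cd /subspace_continuousP cf x.
pose cl (y : R) := Num.max c (Num.min y d).
have clI y : `[c, d]%classic (cl y).
  by rewrite /= in_itv /= le_max lexx /= ge_max cd ge_min lexx orbT.
apply: (@cvg_comp _ _ _ cl f _ (within `[c, d]%classic (nbhs (cl x)))); last exact: cf.
have ccl : {for x, continuous cl}.
  apply: continuous_max; first exact: cvg_cst.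
  by apply: continuous_min; [exact: cvg_id|exact: cvg_cst].
move=> A hA.
have h : nbhs x (fun y => `[c, d]%classic (cl y) -> A (cl y)) by exact: ccl hA.
suff k : nbhs x (fun y => A (cl y)) by exact: k.
by apply: filterS h => y; apply; exact: clI.
Qed.

Lemma antiderivative01 (f : R -> R) : continuous f -> exists k (F : R -> R),
  [/\ forall x, is_derive x 1 F (f x - k), F 0 = 0 & F 1 = 0].
Proof.
move=> /antiderivative[F dF].
exists (F 1 - F 0), (fun x => F x - F 0 - (F 1 - F 0) * x); split; last 2 first.
- by rewrite mulr0 !subrr.
- by rewrite mulr1 subrr.
move=> x; apply: der_eq (der_sub (der_sub (dF x) (is_derive_cst (F 0) x 1))
  (der_scale (F 1 - F 0) (is_derive_id x 1))) _.
by rewrite subr0 mulr1.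
Qed.

(** Two integration constants are spent on making [H2] vanish at both ends, the other two on [H4].
    As H4'' = H2, the fourfold primitive satisfies the Navier conditions by itself. *)
Lemma iterated_primitive (h : R -> R) : itgb 0 1 h -> exists H1 H2 H3 H4 : R -> R,
  [/\ prim 0 1 H1 h, continuous H1, forall x, is_derive x 1 H2 (H1 x),
      forall x, is_derive x 1 H3 (H2 x) & forall x, is_derive x 1 H4 (H3 x)] /\
  [/\ H2 0 = 0, H2 1 = 0, H4 0 = 0 & H4 1 = 0].
Proof.
move=> ih; have p := prim_itg ih.
pose cl x : R := Num.max 0 (Num.min x 1).
have cH : continuous (fun x => itg 0 (cl x) h).
  exact: clamp_continuous ler01 (prim_cont p).
have [k1 [H2 [d2 H20 H21]]] := antiderivative01 cH.
have cH2 : continuous H2 by move=> x; exact: der_continuous (d2 x).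
have [H3 d3] := antiderivative cH2.
have cH3 : continuous H3 by move=> x; exact: der_continuous (d3 x).
have [k3 [H4 [d4 H40 H41]]] := antiderivative01 cH3.
exists (fun x => itg 0 (cl x) h - k1), H2, (fun x => H3 x - k3), H4; split; split => //.
- have pk : prim 0 1 (fun=> k1) (fun=> 0).
    by split => [|x /andP[x0 _]]; [exact: itgb_cst|rewrite itg_cst// mul0r addr0].
  have := primB p pk; apply: eq_prim => x; last by rewrite subr0.
  by move=> /andP[x0 x1]; rewrite /cl (min_idPl x1) (max_idPr x0).
- by move=> x; apply: cvgB; [exact: cH|exact: cvg_cst].
- by move=> x; apply: der_eq (der_sub (d3 x) (is_derive_cst k3 x 1)) _; rewrite subr0.
Qed.

Definition cprim c d (F f : R -> C) : Prop :=
  prim c d (fun x => Re (F x)) (fun x => Re (f x)) /\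
  prim c d (fun x => Im (F x)) (fun x => Im (f x)).

Lemma cder_cprim c d (F f : R -> C) : ccont f -> cder F f -> cprim c d F f.
Proof.
move=> [c1 c2] dF; split; apply: prim_deriv; try exact: continuous_subspaceT.
  by move=> x _; have [] := dF x.
by move=> x _; have [] := dF x.
Qed.

Lemma eq_cprim c d (F f F' f' : R -> C) : (forall x, F x = F' x) -> (forall x, f x = f' x) ->
  cprim c d F f -> cprim c d F' f'.
Proof. by move=> /funext <- /funext <-. Qed.

Lemma cprimD c d (F f G g : R -> C) : cprim c d F f -> cprim c d G g ->
  cprim c d (fun x => F x + G x) (fun x => f x + g x).
Proof.
move=> [f1 f2] [g1 g2]; split.
  by have := primD f1 g1; apply: eq_prim => x _; rewrite cReD.
by have := primD f2 g2; apply: eq_prim => x _; rewrite cImD.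
Qed.

Lemma cprimZ c d (k : C) (F f : R -> C) : cprim c d F f ->
  cprim c d (fun x => k * F x) (fun x => k * f x).
Proof.
move=> [f1 f2]; split.
  by have := primB (primZ (Re k) f1) (primZ (Im k) f2); apply: eq_prim => x _; rewrite cReM.
by have := primD (primZ (Re k) f2) (primZ (Im k) f1); apply: eq_prim => x _; rewrite cImM.
Qed.

Lemma cprimB c d (F f G g : R -> C) : cprim c d F f -> cprim c d G g ->
  cprim c d (fun x => F x - G x) (fun x => f x - g x).
Proof.
by move=> hf /(cprimZ (-1)) hg; apply: eq_cprim (cprimD hf hg) => x; rewrite mulN1r.
Qed.

Lemma cprim_restr c d c' d' (F f : R -> C) : c <= c' -> d' <= d -> cprim c d F f ->
  cprim c' d' F f.
Proof. by move=> h1 h2 [f1 f2]; split; [exact: prim_restr f1|exact: prim_restr f2]. Qed.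

(* Peeling off a fourfold primitive of the right-hand side makes the remaining
   equation classical. *)
Lemma navier4_l2 (k : C) (h : R -> C) : nonresonant k -> nonresonant (- k) ->
  itgb 0 1 (fun x => Re (h x)) -> itgb 0 1 (fun x => Im (h x)) ->
  exists u0 u1 u2 u3 : R -> C,
  [/\ cprim 0 1 u0 u1, cprim 0 1 u1 u2, cprim 0 1 u2 u3
    & cprim 0 1 u3 (fun x => k ^+ 2 * u0 x + h x)] /\
  [/\ u0 0 = 0, u0 1 = 0, u2 0 = 0 & u2 1 = 0].
Proof.
move=> n1 n2 hr hi.
have [A1 [A2 [A3 [A4 [[a0 a1 a2 a3 a4] [a20 a21 a40 a41]]]]]] := iterated_primitive hr.
have [B1 [B2 [B3 [B4 [[b0 b1 b2 b3 b4] [b20 b21 b40 b41]]]]]] := iterated_primitive hi.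
pose H1 x : C := Complex (A1 x) (B1 x); pose H2 x : C := Complex (A2 x) (B2 x).
pose H3 x : C := Complex (A3 x) (B3 x); pose H4 x : C := Complex (A4 x) (B4 x).
have dH2 : cder H2 H1 by move=> x; split; [exact: a2|exact: b2].
have dH3 : cder H3 H2 by move=> x; split; [exact: a3|exact: b3].
have dH4 : cder H4 H3 by move=> x; split; [exact: a4|exact: b4].
have cH1 : ccont H1 by split.
have cH2 := cder_ccont dH2; have cH3 := cder_ccont dH3; have cH4 := cder_ccont dH4.
(* For u = H4 + z to satisfy u'''' = k^2 u + h, the remainder must solve z'''' = k^2 z + k^2 H4,
   whose source is continuous. *)
have cf : ccont (fun x => k ^+ 2 * H4 x) by apply: ccontM => //; exact: ccont_cst.
have [z0 [z1 [z2 [z3 [[d0 d1 d2 d3] [z00 z01 z20 z21]]]]]] := navier4 n1 n2 cf.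
have cz0 := cder_ccont d0; have cz1 := cder_ccont d1.
have cz2 := cder_ccont d2; have cz3 := cder_ccont d3.
exists (fun x => H4 x + z0 x), (fun x => H3 x + z1 x), (fun x => H2 x + z2 x),
  (fun x => H1 x + z3 x); split; split.
- by apply: cprimD; apply: cder_cprim.
- by apply: cprimD; apply: cder_cprim.
- by apply: cprimD; apply: cder_cprim.
- have pH1 : cprim 0 1 H1 h by split.
  have ck : ccont (fun x => k ^+ 2 * z0 x + k ^+ 2 * H4 x).
    by apply: ccontD => //; apply: ccontM => //; exact: ccont_cst.
  apply: eq_cprim (cprimD pH1 (cder_cprim 0 1 ck d3)) => x //; ring.
- by rewrite z00 addr0 /H4 a40 b40.
- by rewrite z01 addr0 /H4 a41 b41.
- by rewrite z20 addr0 /H2 a20 b20.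
- by rewrite z21 addr0 /H2 a21 b21.
Qed.

Lemma l2_zero_ae c d (f : R -> R) : l2 c d f -> itg c d (fun x => f x ^+ 2) = 0 ->
  aer c d f (fun=> 0).
Proof.
move=> [_ iff2] f0.
have h : aer c d (fun x => f x ^+ 2) (fun=> 0).
  apply: (itg_zero_ae iff2) => x /andP[cx xd].
  apply/eqP; rewrite eq_le itg_ge0 ?andbT => [|y _]; last exact: sqr_ge0.
  rewrite -f0 (itg_split cx xd iff2) lerDl; apply: itg_ge0 => y _; exact: sqr_ge0.
by apply: (ae_imp h) => x hx /hx /eqP; rewrite sqrf_eq0 => /eqP.
Qed.

Lemma itg_comb3 c d (k l : R) (f g h : R -> R) : itgb c d f -> itgb c d g -> itgb c d h ->
  itg c d (fun x => k * f x + l * g x + h x) = k * itg c d f + l * itg c d g + itg c d h.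
Proof.
move=> hf hg hh; have hk := itgbZ k hf; have hl := itgbZ l hg.
by rewrite itgD//; [rewrite itgD// !itgZ|exact: itgbD].
Qed.

(* [S'' = k S] with Dirichlet conditions forces [k = - |S'|^2 / |S|^2 <= - pi^2]. *)
Lemma resonant_le (k : C) : ~ nonresonant k -> Im k = 0 /\ Re k <= - pi ^+ 2.
Proof.
move=> nk; have {nk} [S [S1 [dS dS1 S0 S10 S_1]]] : exists S S1, [/\ cder S S1,
    cder S1 (fun x => k * S x), S 0 = 0, S1 0 = 1 & S 1 = 0].
  apply: contrapT => H; apply: nk => S S1 h1 h2 h3 h4; apply/eqP => h5.
  by apply: H; exists S, S1.
have cS := cder_ccont dS; have cS1 := cder_ccont dS1.
have cS2 : ccont (fun x => k * S x) by apply: ccontM => //; exact: ccont_cst.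
have [p1 p2] := cder_cprim 0 1 cS1 dS.
have [q1 q2] := cder_cprim 0 1 cS2 dS1.
have e0 : Re (S 0) = 0 /\ Im (S 0) = 0 by rewrite S0.
have e1 : Re (S 1) = 0 /\ Im (S 1) = 0 by rewrite S_1.
have W1 := wirtinger p1 (prim_cont q1) e0.1 e1.1.
have W2 := wirtinger p2 (prim_cont q2) e0.2 e1.2.
have lr := l2_cont (prim_cont p1); have li := l2_cont (prim_cont p2).
have lr1 := l2_cont (prim_cont q1); have li1 := l2_cont (prim_cont q2).
have lri := l2_mul lr li; have lri1 := l2_mul lr1 li1.
set r := fun x => Re (S x) in p1 p2 W1 W2 lr li lri.
set i := fun x => Im (S x) in p1 p2 W1 W2 lr li lri.
set r1 := fun x => Re (S1 x) in p1 p2 q1 q2 W1 W2 lr1 li1 lri1.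
set i1 := fun x => Im (S1 x) in p1 p2 q1 q2 W1 W2 lr1 li1 lri1.
(* The four products are the real components of the identity obtained by integrating (S' conj S)'.
   Adding the first two isolates Re k, subtracting the last two isolates Im k. *)
have m1 := prim_end ler01 (prim_mul q1 p1).
have m2 := prim_end ler01 (prim_mul q2 p2).
have m3 := prim_end ler01 (prim_mul q2 p1).
have m4 := prim_end ler01 (prim_mul q1 p2).
have z0 : r 0 = 0 /\ i 0 = 0 by [].
have z1 : r 1 = 0 /\ i 1 = 0 by [].
rewrite z0.1 z1.1 !mulr0 subrr in m1. rewrite z0.2 z1.2 !mulr0 subrr in m2.
rewrite z0.1 z1.1 !mulr0 subrr in m3. rewrite z0.2 z1.2 !mulr0 subrr in m4.
have jr := lr.2; have ji := li.2; have jr1 := lr1.2; have ji1 := li1.2.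
have I1 := m1; rewrite (@eq_itg _ _ _ _ (fun x => Re k * r x ^+ 2 + - Im k * (r x * i x) + r1 x
  ^+ 2)) ?itg_comb3// in I1; last first.
  by move=> x _; rewrite cReM -/(r x) -/(i x); ring.
have I2 := m2; rewrite (@eq_itg _ _ _ _ (fun x => Re k * i x ^+ 2 + Im k * (r x * i x) + i1 x ^+
  2)) ?itg_comb3// in I2; last first.
  by move=> x _; rewrite cImM -/(r x) -/(i x); ring.
have I3 := m3; rewrite (@eq_itg _ _ _ _ (fun x => Re k * (r x * i x) + Im k * r x ^+ 2 + r1 x *
  i1 x)) ?itg_comb3// in I3; last first.
  by move=> x _; rewrite cImM -/(r x) -/(i x); ring.
have I4 := m4; rewrite (@eq_itg _ _ _ _ (fun x => Re k * (r x * i x) + - Im k * i x ^+ 2 + r1 x *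
  i1 x)) ?itg_comb3// in I4; last first.
  by move=> x _; rewrite cReM -/(r x) -/(i x); ring.
set Nr := itg 0 1 (fun x => r x ^+ 2) in W1 I1 I3.
set Ni := itg 0 1 (fun x => i x ^+ 2) in W2 I2 I4.
set Nr1 := itg 0 1 (fun x => r1 x ^+ 2) in W1 I1.
set Ni1 := itg 0 1 (fun x => i1 x ^+ 2) in W2 I2.
have Nr0 : 0 <= Nr by apply: itg_ge0 => x _; exact: sqr_ge0.
have Ni0 : 0 <= Ni by apply: itg_ge0 => x _; exact: sqr_ge0.
(* If the norm vanished, the real part of [S] would be identically zero, contradicting the initial
   slope 1. *)
have N0 : 0 < Nr + Ni.
  rewrite lt_neqAle addr_ge0// andbT; apply/eqP => /esym N0.
  have r0 x : 0 <= x <= 1 -> r x = 0.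
    apply: (cont_ae0 (@ltr01 R) (prim_cont p1)); apply: l2_zero_ae => //.
    by rewrite -/Nr; lra.
  have pz : prim 0 1 r (fun=> 0).
    split=> [|y /andP[y0 y1]]; first exact: itgb_cst.
    by rewrite !r0 ?y0 ?lexx ?ler01// itg_cst// mul0r addr0.
  have := cont_ae0 (@ltr01 R) (prim_cont q1) (prim_uniq p1 pz) (x := 0).
  by rewrite lexx ler01 /r1 S10 => /(_ isT) /eqP; rewrite oner_eq0.
have k0 : Im k * (Nr + Ni) = 0 by lra.
have {}k0 : Im k = 0 by move/eqP: k0; rewrite mulf_eq0 (gt_eqF N0) orbF => /eqP.
split => //.
rewrite -(ler_pM2r N0) mulNr; rewrite k0 in I1 I2; lra.
Qed.

End NavierL2.

(** * Sobolev functions and the domain of the operator *)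

Section SobolevRep.
Context {R : realType}.
Local Notation C := R[i].
Local Notation Re := (@complex.Re R).
Local Notation Im := (@complex.Im R).
Implicit Types (c d x : R) (u g w : R -> C) (phi : R -> R).
Local Open Scope complex_scope.

Lemma cintegralE c d (f : R -> C) :
  cintegral `]c, d[ f = itg c d (fun x => Re (f x)) +i* itg c d (fun x => Im (f x)).
Proof. by []. Qed.

Lemma L2P c d (f : R -> C) :
  L2 c d f <-> l2 c d (fun x => Re (f x)) /\ l2 c d (fun x => Im (f x)).
Proof.
split=> [[mr mi fi]|[[mr ir] [mi ii]]].
  have i2 : itgb c d (fun x => Re (f x) ^+ 2 + Im (f x) ^+ 2).
    apply/intgP => //; split.
      by apply: measurable_funD; apply: measurable_funX.
    move: fi; congr (_ < _)%E; apply: eq_integral => x _.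
    by rewrite ger0_norm// addr_ge0// sqr_ge0.
  split; split => //; apply: (itgb_le _ i2); try exact: measurable_funX.
    by move=> x _; rewrite ger0_norm ?sqr_ge0// lerDl sqr_ge0.
  by move=> x _; rewrite ger0_norm ?sqr_ge0// lerDr sqr_ge0.
split => //.
have /intgP[//|_] := itgbD ir ii; congr (_ < _)%E; apply: eq_integral => x _.
by rewrite ger0_norm// addr_ge0// sqr_ge0.
Qed.

Lemma aeeqP c d (f g : R -> C) : aeeq c d f g <->
  aer c d (fun x => Re (f x)) (fun x => Re (g x)) /\
  aer c d (fun x => Im (f x)) (fun x => Im (g x)).
Proof.
have aeeqE : aeeq c d f g <-> aeP (fun x => `]c, d[%classic x -> f x = g x) by [].
split=> [/aeeqE h|[h1 h2]].
  by split; apply: (ae_imp h) => x hx /hx ->.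
apply/aeeqE; refine (ae_imp2 h1 h2 _) => x hx1 hx2 xI; apply: ceq; [exact: hx1|exact: hx2].
Qed.

Lemma aeeq_imp c d (f g f' g' : R -> C) :
  (forall x, f x = g x -> f' x = g' x) -> aeeq c d f g -> aeeq c d f' g'.
Proof.
move=> h k; have {}k : aeP (fun x => `]c, d[%classic x -> f x = g x) by exact: k.
suff : aeP (fun x => `]c, d[%classic x -> f' x = g' x) by [].
by apply: (ae_imp k) => x hx /hx /h.
Qed.

Lemma aeeq_imp2 c d (f g f' g' f2 g2 : R -> C) :
  (forall x, f x = g x -> f' x = g' x -> f2 x = g2 x) -> aeeq c d f g -> aeeq c d f' g' ->
  aeeq c d f2 g2.
Proof.
move=> h k k'; have {}k : aeP (fun x => `]c, d[%classic x -> f x = g x) by exact: k.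
have {}k' : aeP (fun x => `]c, d[%classic x -> f' x = g' x) by exact: k'.
suff : aeP (fun x => `]c, d[%classic x -> f2 x = g2 x) by [].
by refine (ae_imp2 k k' _) => x h1 h2 xI; apply: h; [exact: h1|exact: h2].
Qed.

Lemma aeeq_refl c d (f : R -> C) : aeeq c d f f.
Proof.
suff : aeP (fun x => `]c, d[%classic x -> f x = f x) by [].
exact: ae_all.
Qed.

Lemma aeeq_sym c d (f g : R -> C) : aeeq c d f g -> aeeq c d g f.
Proof. by apply: aeeq_imp. Qed.

Lemma aeeq_trans c d (f g h : R -> C) : aeeq c d f g -> aeeq c d g h -> aeeq c d f h.
Proof. by apply: aeeq_imp2 => x -> ->. Qed.

Lemma L2D c d (f g : R -> C) : L2 c d f -> L2 c d g -> L2 c d (fun x => f x + g x).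
Proof.
move=> /L2P[f1 f2] /L2P[g1 g2]; apply/L2P; split.
  by under eq_fun do rewrite cReD; exact: l2D.
by under eq_fun do rewrite cImD; exact: l2D.
Qed.

Lemma L2Z c d (k : C) (f : R -> C) : L2 c d f -> L2 c d (fun x => k * f x).
Proof.
move=> /L2P[f1 f2]; apply/L2P; split.
  by under eq_fun do rewrite cReM; apply: l2B; exact: l2Z.
by under eq_fun do rewrite cImM; apply: l2D; exact: l2Z.
Qed.

Lemma L2B c d (f g : R -> C) : L2 c d f -> L2 c d g -> L2 c d (fun x => f x - g x).
Proof.
move=> hf /(L2Z (-1)) hg; have := L2D hf hg.
by congr L2; apply/funext => x; rewrite mulN1r.
Qed.

Lemma L2_sub c d c' d' (f : R -> C) : c <= c' -> d' <= d -> L2 c d f -> L2 c' d' f.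
Proof. by move=> h1 h2 /L2P[f1 f2]; apply/L2P; split; [exact: l2_sub f1|exact: l2_sub f2]. Qed.

Lemma cprim_L2 c d (F f : R -> C) : cprim c d F f -> L2 c d F.
Proof. by move=> [p1 p2]; apply/L2P; split; apply: l2_cont; [exact: prim_cont p1|exact: prim_cont
  p2]. Qed.

Definition pair_re (f : R -> C) phi c d := itg c d (fun x => Re (f x) * phi x).
Definition pair_im (f : R -> C) phi c d := itg c d (fun x => Im (f x) * phi x).

Lemma cintegral_real c d (f : R -> C) phi :
  cintegral `]c, d[ (fun x => f x * (phi x)%:C) = pair_re f phi c d +i* pair_im f phi c d.
Proof.
rewrite cintegralE; congr Complex; apply: eq_itg => x _.
  by rewrite cReM /= mulr0 subr0.
by rewrite cImM /= mulr0 add0r.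
Qed.

Lemma sign_complex k (a b : R) : (-1) ^+ k * (a +i* b) = ((-1) ^+ k * a) +i* ((-1) ^+ k * b).
Proof.
rewrite -signr_odd -[in RHS]signr_odd; case: (odd k); rewrite ?expr1 ?expr0 ?mul1r//.
by rewrite !mulN1r.
Qed.

Lemma is_wderivnP k c d u g : is_wderivn k c d u g <-> forall phi, test_fun c d phi ->
  pair_re u (derive1n k phi) c d = (-1) ^+ k * pair_re g phi c d /\
  pair_im u (derive1n k phi) c d = (-1) ^+ k * pair_im g phi c d.
Proof.
split=> h phi /h.
  by rewrite !cintegral_real sign_complex => -[-> ->].
by rewrite !cintegral_real sign_complex => -[-> ->].
Qed.

Lemma L2_zero c d g : c < d -> L2 c d g ->
  (forall phi, test_fun c d phi -> pair_re g phi c d = 0 /\ pair_im g phi c d = 0) ->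
  aeeq c d g (fun=> 0).
Proof.
move=> cd /L2P[g1 g2] h; apply/aeeqP; split => /=.
  by apply: test_zero_ae => //; [exact: l2_itgb|move=> phi /h[]].
by apply: test_zero_ae => //; [exact: l2_itgb|move=> phi /h[]].
Qed.

Lemma l2_test c d (f : R -> R) phi : l2 c d f -> test_fun c d phi -> itgb c d (fun x => f x * phi
  x).
Proof. by move=> hf hp; apply: l2_mul => //; apply: l2_cont; exact: test_cont hp. Qed.

Lemma L2_eq c d g w : c < d -> L2 c d g -> L2 c d w ->
  (forall phi, test_fun c d phi ->
    pair_re g phi c d = pair_re w phi c d /\ pair_im g phi c d = pair_im w phi c d) ->
  aeeq c d g w.
Proof.
move=> cd hg hw h.
have /(L2_zero cd) z := L2B hg hw.
suff k : aeeq c d (fun x => g x - w x) (fun=> 0).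
  by apply: aeeq_imp k => x /eqP; rewrite subr_eq0 => /eqP.
have /L2P[g1 g2] := hg; have /L2P[w1 w2] := hw.
apply: z => phi tphi; have [e1 e2] := h _ tphi; rewrite /pair_re /pair_im.
have b1 := l2_test g1 tphi; have b2 := l2_test g2 tphi.
have b3 := l2_test w1 tphi; have b4 := l2_test w2 tphi.
split.
  transitivity (pair_re g phi c d - pair_re w phi c d); last by rewrite e1 subrr.
  by rewrite /pair_re -itgB//; apply: eq_itg => x _; rewrite cReB mulrBl.
transitivity (pair_im g phi c d - pair_im w phi c d); last by rewrite e2 subrr.
by rewrite /pair_im -itgB//; apply: eq_itg => x _; rewrite cImB mulrBl.
Qed.

Lemma sign_inj k (a b : R) : (-1) ^+ k * a = (-1) ^+ k * b -> a = b.
Proof. by move=> /(congr1 (fun y => (-1) ^+ k * y)); rewrite !signrMK. Qed.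

Lemma is_wderivn_uniq k c d u g w : c < d -> L2 c d g -> L2 c d w ->
  is_wderivn k c d u g -> is_wderivn k c d u w -> aeeq c d g w.
Proof.
move=> cd hg hw /is_wderivnP h1 /is_wderivnP h2; apply: L2_eq => // phi tphi.
have [a1 a2] := h1 _ tphi; have [b1 b2] := h2 _ tphi.
by split; apply: (@sign_inj k); rewrite -?a1 -?a2.
Qed.

(** Exhibiting one weak derivative keeps [xget] from its default 0, and uniqueness then identifies
    the choice up to null sets. *)
Lemma wderivn_spec k c d u g : c < d -> L2 c d g -> is_wderivn k c d u g ->
  L2 c d (wderivn k c d u) /\ aeeq c d (wderivn k c d u) g.
Proof.
move=> cd hg wg.
have : [set g | L2 c d g /\ is_wderivn k c d u g] (wderivn k c d u).
  by apply: xgetPex; exists g.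
move=> [h1 h2]; split => //; exact: is_wderivn_uniq h2 wg.
Qed.

Lemma trace_spec c d u g : c < d -> aeeq c d u g ->
  {within `[c, d], continuous (fun x => Re (g x))} ->
  {within `[c, d], continuous (fun x => Im (g x))} ->
  forall x, c <= x <= d -> trace c d u x = g x.
Proof.
move=> cd ug c1 c2 x xI.
have [t1 t2 t3] : [set g | [/\ {within `[c, d], continuous (fun x => Re (g x))},
    {within `[c, d], continuous (fun x => Im (g x))} & aeeq c d u g]] (trace c d u).
  by apply: xgetPex; exists g.
have /aeeqP[a1 a2] : aeeq c d (trace c d u) g by apply: aeeq_trans ug; exact: aeeq_sym.
by apply: ceq; [exact: (cont_ae_eq cd t1 c1 a1)|exact: (cont_ae_eq cd t2 c2 a2)].
Qed.

Lemma pair_sub c d c' d' (f : R -> R) phi : c <= c' -> c' < d' -> d' <= d -> l2 c d f ->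
  test_fun c' d' phi -> itg c d (fun x => f x * phi x) = itg c' d' (fun x => f x * phi x).
Proof.
move=> cc cd dd hf tphi.
have ib : itgb c d (fun x => f x * phi x).
  by apply: l2_mul => //; apply: l2_cont; exact: test_cont tphi.
rewrite (itg_split cc (le_trans (ltW cd) dd) ib).
rewrite (itg_split (ltW cd) dd (itgb_sub cc (lexx d) ib)).
have -> : itg c c' (fun x => f x * phi x) = 0.
  rewrite -[RHS](mul0r (c' - c)) -itg_cst//; apply: eq_itg => x /andP[_ xc].
  by rewrite (test_out tphi) ?mulr0// (ltW xc).
have -> : itg d' d (fun x => f x * phi x) = 0.
  rewrite -[RHS](mul0r (d - d')) -itg_cst//; apply: eq_itg => x /andP[xd _].
  by rewrite (test_out tphi) ?mulr0// (ltW xd) orbT.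
by rewrite add0r addr0.
Qed.

Lemma test_fun_sub c d c' d' phi : c <= c' -> d' <= d -> test_fun c' d' phi -> test_fun c d phi.
Proof.
move=> cc dd [h [s [t [h1 h2 h3]]]]; split => //; exists s, t; split => //.
  exact: le_lt_trans h1.
exact: lt_le_trans dd.
Qed.

Lemma is_wderivn_sub k c d c' d' u g : c <= c' -> c' < d' -> d' <= d -> L2 c d u -> L2 c d g ->
  is_wderivn k c d u g -> is_wderivn k c' d' u g.
Proof.
move=> cc cd dd /L2P[u1 u2] /L2P[g1 g2] /is_wderivnP h; apply/is_wderivnP => phi tphi.
have [e1 e2] := h _ (test_fun_sub cc dd tphi).
have tk := test_derive1n k tphi.
by move: e1 e2; rewrite /pair_re /pair_im !(pair_sub cc cd dd).
Qed.

Lemma cprim_wderivn k c d (u F f : R -> C) : c <= d -> is_wderivn k c d u F -> cprim c d F f ->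
  is_wderivn k.+1 c d u f.
Proof.
move=> cd /is_wderivnP h [p1 p2]; apply/is_wderivnP => phi tphi.
have [e1 e2] := h _ (test_derive1 tphi).
rewrite derive1Sn e1 e2 /pair_re /pair_im (prim_parts cd p1 tphi) (prim_parts cd p2 tphi).
by rewrite exprS !mulrN !mulN1r !mulNr.
Qed.

Lemma is_wderivn0 c d u : is_wderivn 0 c d u u.
Proof. by apply/is_wderivnP => phi _; rewrite derive1n0 !mul1r. Qed.

(** Levels below [k] are absolutely continuous representatives of the successive derivatives; level
    [k] carries only an L^2 condition. *)
Definition cchain k c d (G : nat -> R -> C) : Prop :=
  (forall j, (j < k)%N -> cprim c d (G j) (G j.+1)) /\ (forall j, (j <= k)%N -> L2 c d (G j)).

Lemma cchain_wderivn k c d (G : nat -> R -> C) j : c <= d -> cchain k c d G -> (j <= k)%N ->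
  is_wderivn j c d (G 0%N) (G j).
Proof.
move=> cd [h1 _]; elim: j => [_|j IH jk]; first exact: is_wderivn0.
by apply: cprim_wderivn (IH (ltnW jk)) (h1 _ jk).
Qed.

Lemma cchain_Hk k c d (G : nat -> R -> C) : c <= d -> cchain k c d G -> Hk k c d (G 0%N).
Proof.
move=> cd h; split; first exact: h.2.
by move=> j jk; exists (G j); split; [exact: h.2|exact: cchain_wderivn jk].
Qed.

Lemma ae_prim c d (F f g : R -> R) : measurable_fun `]c, d[ g -> aer c d f g ->
  prim c d F f -> prim c d F g.
Proof.
move=> mg fg [ib h]; split; first exact: ae_itgb fg ib.
move=> x /andP[cx xd]; rewrite h ?cx//; congr (_ + _).
have s : `]c, x[ `<=` `]c, d[ by apply: subset_itvSoo; rewrite bnd_simp.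
apply: ae_itg.
- by apply: measurable_funS s _ => //; exact: itgb_meas.
- exact: measurable_funS s mg.
by apply: (ae_imp fg) => y hy yI; apply/hy/s.
Qed.

Lemma ae_cprim c d (F f g : R -> C) : L2 c d g -> aeeq c d f g -> cprim c d F f -> cprim c d F g.
Proof.
move=> /L2P[[m1 _] [m2 _]] /aeeqP[a1 a2] [p1 p2].
by split; [exact: ae_prim a1 p1|exact: ae_prim a2 p2].
Qed.

Lemma weak_derivative_cprim c d u g : c < d -> L2 c d u -> L2 c d g ->
  (forall phi, test_fun c d phi -> pair_re u (derive1 phi) c d = - pair_re g phi c d /\
     pair_im u (derive1 phi) c d = - pair_im g phi c d) ->
  exists2 F, cprim c d F g & aeeq c d u F.
Proof.
move=> cd /L2P[u1 u2] /L2P[g1 g2] h.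
have [k1 a1] := weak_derivative_prim cd (l2_itgb u1) (l2_itgb g1) (fun phi t => (h phi t).1).
have [k2 a2] := weak_derivative_prim cd (l2_itgb u2) (l2_itgb g2) (fun phi t => (h phi t).2).
have pk (k : R) (f : R -> R) : l2 c d f -> prim c d (fun x => k + itg c x f) f.
  move=> /l2_itgb i_f; split => // x _; by rewrite (itg_ge _ (lexx c)) addr0.
exists (fun x => (k1 + itg c x (fun y => Re (g y))) +i* (k2 + itg c x (fun y => Im (g y)))).
  by split; exact: pk.
by apply/aeeqP; split.
Qed.

(** Weak derivatives of all orders are defined directly from [u]. Testing with phi' shows that the
    one of order j+1 is a first weak derivative of the one of order j, and du Bois-Reymond then
    supplies a primitive at each level. *)
Lemma Hk_chain k c d u : c < d -> Hk k c d u -> exists G, [/\ cchain k c d G,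
  forall j, (j <= k)%N -> is_wderivn j c d u (G j) & aeeq c d u (G 0%N)].
Proof.
move=> cd [hu hw].
have [g hg] : {g : nat -> R -> C & forall j, (j <= k)%N -> L2 c d (g j) /\ is_wderivn j c d u (g
  j)}.
  apply: (@choice _ _ (fun j g => (j <= k)%N -> L2 c d g /\ is_wderivn j c d u g)) => j.
  have [jk|jk] := leqP j k; last by exists (fun=> 0).
  by have [g hg] := hw j jk; exists g.
have gF j : (j < k)%N -> exists2 F, cprim c d F (g j.+1) & aeeq c d (g j) F.
  move=> jk; have [l1 w1] := hg j (ltnW jk); have [l2 w2] := hg j.+1 jk.
  apply: weak_derivative_cprim => // phi tphi.
  have /is_wderivnP/(_ _ (test_derive1 tphi))[a1 a2] := w1.
  have /is_wderivnP/(_ _ tphi)[b1 b2] := w2.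
  rewrite derive1Sn a1 exprS mulN1r mulNr -mulrN in b1.
  rewrite derive1Sn a2 exprS mulN1r mulNr -mulrN in b2.
  by split; [exact: sign_inj b1|exact: sign_inj b2].
have [F hF] : {F : nat -> R -> C & forall j, (j < k)%N -> cprim c d (F j) (g j.+1) /\ aeeq c d (g
  j) (F j)}.
  apply: (@choice _ _ (fun j F => (j < k)%N -> cprim c d F (g j.+1) /\ aeeq c d (g j) F)) => j.
  have [jk|jk] := ltnP j k; last by exists (fun=> 0).
  by have [F h1 h2] := gF j jk; exists F.
(* The top level has no primitive representation, so it keeps the chosen L^2 function. *)
pose G j := if (j < k)%N then F j else g j.
have gG j : (j <= k)%N -> aeeq c d (g j) (G j).
  by move=> _; rewrite /G; case: ltnP => [/hF[]//|_]; exact: aeeq_refl.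
have LG j : (j <= k)%N -> L2 c d (G j).
  move=> jk; rewrite /G; case: ltnP => [/hF[p _]|_]; first exact: cprim_L2 p.
  by have [] := hg j jk.
have wG j : (j <= k)%N -> is_wderivn j c d u (G j).
  move=> jk; have [l w] := hg j jk; have /L2P[[m1 _] [m2 _]] := l; have /L2P[[n1 _] [n2 _]] := LG
    j jk.
  have /aeeqP[a1 a2] := gG j jk.
  apply/is_wderivnP => phi tphi; have /is_wderivnP/(_ _ tphi)[-> ->] := w.
  have mphi := itgb_meas (test_itgb c d tphi).
  split; congr (_ * _); apply: ae_itg; try exact: measurable_funM.
    by apply: (ae_imp a1) => x hx /hx ->.
  by apply: (ae_imp a2) => x hx /hx ->.
exists G; split => //.
  split => // j jk; rewrite {1}/G jk; have [p _] := hF j jk.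
  by apply: ae_cprim p; [exact: LG|exact: gG].
have [l0 w0] := hg 0%N (leq0n k).
have z := is_wderivn_uniq cd hu l0 (@is_wderivn0 c d u) w0.
exact: aeeq_trans z (gG 0%N (leq0n k)).
Qed.

End SobolevRep.

(** * The transmission conditions at [xi] in weak form *)

Section BeamDomain.
Context {R : realType}.
Local Notation C := R[i].
Local Notation Re := (@complex.Re R).
Local Notation Im := (@complex.Im R).
Implicit Types (c d x a b al xi : R) (phi : R -> R) (U : state R).
Local Open Scope complex_scope.

Lemma parts4 c d (F2 F3 F4 g0 g1 g2 : R -> R) : c <= d -> prim c d F2 F3 -> prim c d F3 F4 ->
  l2 c d F4 -> chain2 c d g0 g1 g2 ->
  itg c d (fun x => F4 x * g0 x) = F3 d * g0 d - F3 c * g0 c - (F2 d * g1 d - F2 c * g1 c)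
    + itg c d (fun x => F2 x * g2 x).
Proof.
move=> cd p2 p3 l4 [q0 q1 h2].
have c2 := l2_cont (prim_cont p2); have c3 := l2_cont (prim_cont p3).
have d0 := l2_cont (prim_cont q0); have d1 := l2_cont (prim_cont q1).
rewrite (prim_end cd (prim_mul p3 q0)) (prim_end cd (prim_mul p2 q1)).
by rewrite !itgD; [ring|exact: l2_mul..].
Qed.

Lemma l2_glue c m d (F K : R -> R) : c <= m -> m <= d -> l2 c m F -> l2 m d K ->
  l2 c d (fun x => if x < m then F x else K x).
Proof.
move=> cm md [mF i_F] [mK i_K].
have mm : measurable_fun `]c, d[ (fun x => if x < m then F x else K x).
  apply: measurable_fun_if => //; first by apply: measurable_funTS; exact: measurable_fun_ltr.
    apply: measurable_funS mF => //; move=> x /= []; rewrite !in_itv /= => /andP[-> _] //.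
  rewrite (_ : _ `&` _ = `[m, d[%classic `&` `]c, d[%classic); last first.
    apply/seteqP; split => x /= []; rewrite !in_itv /=.
      by move=> [xI]; rewrite (ltNge x m) => /negbFE h; rewrite h; case/andP: xI => -> ->.
    by move=> /andP[h ?] xI; rewrite (ltNge x m) h.
  suff mK' : measurable_fun `[m, d] K.
    apply: measurable_funS mK' => // x /= []; rewrite !in_itv /=.
    by move=> /andP[-> /ltW ->].
  exact: measurable_fun_itv_cc mK.
split => //; apply: (itgb_union cm md).
  by apply: eq_itgb i_F => x /andP[_ ->].
by apply: eq_itgb i_K => x /andP[mx _]; rewrite ltNge (ltW mx).
Qed.

Lemma itg_glue c m d (F K g : R -> R) : c <= m -> m <= d -> l2 c m F -> l2 m d K -> l2 c d g ->
  itg c d (fun x => (if x < m then F x else K x) * g x) =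
  itg c m (fun x => F x * g x) + itg m d (fun x => K x * g x).
Proof.
move=> cm md lF lK lg.
rewrite (itg_split cm md (l2_mul (l2_glue cm md lF lK) lg)); congr (_ + _).
  by apply: eq_itg => x /andP[_ ->].
by apply: eq_itg => x /andP[mx _]; rewrite ltNge (ltW mx).
Qed.

(** Two integrations by parts on each side of [xi]. The outer boundary terms vanish, continuity of
    the second derivative cancels the terms in g1(xi), and the jump of the third derivative leaves J
    g0(xi). *)
Lemma jump_identity xi (F2 F3 F4 K2 K3 K4 m2 g0 g1 g2 : R -> R) (J : R) : 0 < xi -> xi < 1 ->
  prim 0 xi F2 F3 -> prim 0 xi F3 F4 -> l2 0 xi F4 ->
  prim xi 1 K2 K3 -> prim xi 1 K3 K4 -> l2 xi 1 K4 ->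
  l2 0 1 m2 -> aer 0 xi F2 m2 -> aer xi 1 K2 m2 ->
  F2 0 = 0 -> K2 1 = 0 -> F2 xi = K2 xi -> K3 xi - F3 xi = - J ->
  chain2 0 1 g0 g1 g2 -> g0 0 = 0 -> g0 1 = 0 ->
  itg 0 1 (fun x => (if x < xi then F4 x else K4 x) * g0 x) =
  itg 0 1 (fun x => m2 x * g2 x) + J * g0 xi.
Proof.
move=> x0 x1 pF2 pF3 lF4 pK2 pK3 lK4 lm aF aK F20 K21 FK HJ [q0 q1 h2] g00 g01.
have z0 := ltW x0; have z1 := ltW x1.
have cl : chain2 0 xi g0 g1 g2.
  by split; [exact: prim_restr q0|exact: prim_restr q1|exact: l2_sub h2].
have cr : chain2 xi 1 g0 g1 g2.
  by split; [exact: prim_restr q0|exact: prim_restr q1|exact: l2_sub h2].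
have lg := l2_cont (prim_cont q0).
rewrite itg_glue//.
rewrite (parts4 z0 pF2 pF3 lF4 cl) (parts4 z1 pK2 pK3 lK4 cr).
rewrite (itg_split z0 z1 (l2_mul lm h2)) F20 K21 FK g00 g01.
have -> : itg 0 xi (fun x => F2 x * g2 x) = itg 0 xi (fun x => m2 x * g2 x).
  apply: ae_itg.
  - by apply: measurable_funM; [exact: (l2_cont (prim_cont pF2)).1|exact: (l2_sub (lexx 0) z1
    h2).1].
  - by apply: measurable_funM; [exact: (l2_sub (lexx 0) z1 lm).1|exact: (l2_sub (lexx 0) z1
    h2).1].
  by apply: (ae_imp aF) => x hx /hx ->.
have -> : itg xi 1 (fun x => K2 x * g2 x) = itg xi 1 (fun x => m2 x * g2 x).
  apply: ae_itg.
  - by apply: measurable_funM; [exact: (l2_cont (prim_cont pK2)).1|exact: (l2_sub z0 (lexx 1)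
    h2).1].
  - by apply: measurable_funM; [exact: (l2_sub z0 (lexx 1) lm).1|exact: (l2_sub z0 (lexx 1)
    h2).1].
  by apply: (ae_imp aK) => x hx /hx ->.
have -> : J = F3 xi - K3 xi by rewrite -[LHS]opprK -HJ opprB.
ring.
Qed.

Definition cchain2 c d (m0 m1 m2 : R -> C) : Prop :=
  chain2 c d (fun x => Re (m0 x)) (fun x => Re (m1 x)) (fun x => Re (m2 x)) /\
  chain2 c d (fun x => Im (m0 x)) (fun x => Im (m1 x)) (fun x => Im (m2 x)).

Lemma cchain2P c d (m0 m1 m2 : R -> C) : cchain2 c d m0 m1 m2 <->
  [/\ cprim c d m0 m1, cprim c d m1 m2 & L2 c d m2].
Proof.
split=> [[[p1 p2 p3] [q1 q2 q3]]|[[p1 q1] [p2 q2] /L2P[p3 q3]]]; last by split.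
by split => //; apply/L2P.
Qed.

(* Functional content of the domain: [w4] is the regular part of [u_xxxx],
   whose singular part at [xi] is tested against [g0]. *)
Definition beam_data (kap xi : R) (m0 m1 m2 n0 n1 n2 w4 : R -> C) : Prop :=
  [/\ cchain2 0 1 m0 m1 m2, cchain2 0 1 n0 n1 n2, L2 0 1 w4,
   [/\ m0 0 = 0, m0 1 = 0, n0 0 = 0 & n0 1 = 0] &
   forall g0 g1 g2, chain2 0 1 g0 g1 g2 -> g0 0 = 0 -> g0 1 = 0 ->
     pair_re w4 g0 0 1 = pair_re m2 g2 0 1 + kap * Re (n0 xi) * g0 xi /\
     pair_im w4 g0 0 1 = pair_im m2 g2 0 1 + kap * Im (n0 xi) * g0 xi].

Lemma chain2_test c d s t phi : test_fun s t phi ->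
  chain2 c d phi (derive1n 1 phi) (derive1n 2 phi).
Proof.
move=> h; have h1 := test_derive1n 1 h; have h2 := test_derive1n 2 h.
split; first by rewrite derive1n1; exact: prim_test h.
  by rewrite derive1nS; exact: prim_test h1.
by apply: l2_cont; exact: test_cont h2.
Qed.

Lemma beam_op_spec a b al xi U w : L2 0 1 w ->
  (forall phi, test_fun 0 1 phi ->
     cintegral `]0, 1[ (fun x => w x * (phi x)%:C) = beam_distr a b al xi U phi) ->
  L2 0 1 (beam_op a b al xi U).2 /\ aeeq 0 1 (beam_op a b al xi U).2 w.
Proof.
move=> hw h.
have : [set w | L2 0 1 w /\ forall phi, test_fun 0 1 phi ->
     cintegral `]0, 1[ (fun x => w x * (phi x)%:C) = beam_distr a b al xi U phi]
     (beam_op a b al xi U).2.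
  by apply: xgetPex; exists w.
move=> [h1 h2]; split => //; apply: L2_eq => // phi tphi.
have := h2 _ tphi; rewrite -h// !cintegral_real => -[-> ->]; by [].
Qed.

Lemma cprim_cont c d (F f : R -> C) : cprim c d F f ->
  {within `[c, d], continuous (fun x => Re (F x))} /\
  {within `[c, d], continuous (fun x => Im (F x))}.
Proof. by move=> [p q]; split; [exact: prim_cont p|exact: prim_cont q]. Qed.

Lemma trace_cprim c d (u F f : R -> C) x : c < d -> aeeq c d u F -> cprim c d F f ->
  c <= x <= d -> trace c d u x = F x.
Proof. by move=> cd uF /cprim_cont[c1 c2]; apply: trace_spec. Qed.

Lemma Re_if (p : bool) (z w : C) : Re (if p then z else w) = if p then Re z else Re w.
Proof. by case: p. Qed.

Lemma Im_if (p : bool) (z w : C) : Im (if p then z else w) = if p then Im z else Im w.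
Proof. by case: p. Qed.

Lemma pair_ae c d (f g : R -> C) phi : L2 c d f -> L2 c d g -> aeeq c d f g ->
  measurable_fun `]c, d[ phi ->
  pair_re f phi c d = pair_re g phi c d /\ pair_im f phi c d = pair_im g phi c d.
Proof.
move=> /L2P[[f1 _] [f2 _]] /L2P[[g1 _] [g2 _]] /aeeqP[a1 a2] mp; split.
  apply: ae_itg; try exact: measurable_funM.
  by apply: (ae_imp a1) => x hx /hx ->.
apply: ae_itg; try exact: measurable_funM.
by apply: (ae_imp a2) => x hx /hx ->.
Qed.

Lemma pair_comb c d (k l : R) (f g : R -> C) phi : L2 c d f -> L2 c d g -> l2 c d phi ->
  pair_re (fun x => k%:C * f x + l%:C * g x) phi c d = k * pair_re f phi c d + l * pair_re g phi
    c d /\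
  pair_im (fun x => k%:C * f x + l%:C * g x) phi c d = k * pair_im f phi c d + l * pair_im g phi
    c d.
Proof.
move=> /L2P[f1 f2] /L2P[g1 g2] hp.
have j1 := l2_mul f1 hp; have j2 := l2_mul f2 hp.
have j3 := l2_mul g1 hp; have j4 := l2_mul g2 hp.
rewrite /pair_re /pair_im -!itgZ// -!itgD; try exact: itgbZ.
by split; apply: eq_itg => x _; rewrite ?cReD ?cImD ?cReM ?cImM /=; ring.
Qed.

(** Two of the four derivatives on phi are moved through the weak second derivative [m2];
    [beam_data] with g0 = phi moves the other two. The jump term, multiplied by -a, is exactly what
    cancels the Dirac mass, so that a function remains. *)
Lemma beam_op_data a b al xi U (m0 m1 m2 n0 n1 n2 w4 : R -> C) : a != 0 ->
  0 < xi -> xi < 1 -> beam_data (al / a) xi m0 m1 m2 n0 n1 n2 w4 ->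
  L2 0 1 U.2 -> is_wderivn 2 0 1 U.1 m2 -> aeeq 0 1 U.2 n0 ->
  L2 0 1 (beam_op a b al xi U).2 /\
  aeeq 0 1 (beam_op a b al xi U).2 (fun x => (- a)%:C * w4 x + (- b)%:C * n0 x).
Proof.
move=> an0 x0 x1 [cm cn lw [m00 m01 n00 n01] hw] LU w2 aU.
have /cchain2P[pm0 pm1 lm2] := cm; have /cchain2P[pn0 pn1 ln2] := cn.
have Ln := cprim_L2 pn0.
apply: beam_op_spec; first by apply: L2D; exact: L2Z.
move=> phi tphi.
have ch := chain2_test 0 1 tphi.
have [p0 p1] : phi 0 = 0 /\ phi 1 = 0 by rewrite !(test_out tphi) ?lexx ?orbT.
have [e1 e2] := hw _ _ _ ch p0 p1.
have t2 := test_derive1n 2 tphi.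
have /is_wderivnP/(_ _ t2)[d1 d2] := w2.
have lphi : l2 0 1 phi by apply: l2_cont; exact: test_cont tphi.
have [f1 f2] := pair_ae LU Ln aU lphi.1.
have [s1 s2] := pair_comb (- a) (- b) lw Ln lphi.
have tr : trace 0 1 U.2 xi = n0 xi.
  by apply: trace_cprim pn0 _ => //; rewrite !ltW.
rewrite /beam_distr tr !cintegral_real s1 s2 e1 e2.
have dd : derive1n 2 (derive1n 2 phi) = derive1n 4 phi by rewrite !derive1nS.
rewrite dd in d1 d2; rewrite d1 d2 f1 f2 !expr2 !mulrNN !mul1r.
apply: ceq; rewrite !complexE /=; field; exact: an0.
Qed.

(** The domain describes u separately on (0,xi), (xi,1) and (0,1). Each description becomes a chain
    of primitives, in which the traces are ordinary values. *)
Lemma beam_dom_data a b al xi U : a != 0 -> 0 < xi -> xi < 1 -> beam_dom a al xi U ->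
  exists m0 m1 m2 n0 n1 n2 w4 : R -> C,
  [/\ beam_data (al / a) xi m0 m1 m2 n0 n1 n2 w4,
    [/\ aeeq 0 1 U.1 m0, is_wderivn 2 0 1 U.1 m2, aeeq 0 1 U.2 n0 & is_wderivn 2 0 1 U.2 n2],
    L2 0 1 U.1, L2 0 1 U.2 &
    L2 0 1 (beam_op a b al xi U).2 /\
    aeeq 0 1 (beam_op a b al xi U).2 (fun x => (- a)%:C * w4 x + (- b)%:C * n0 x)].
Proof.
move=> an0 x0 x1; case: U => u v [[HF HK Hu Hv] [u0 v0 u1 v1] [s0 s1] sx jx].
have lu := Hu.1; have lv := Hv.1.
have z01 := @ltr01 R.
have [F [[pF lF] wF aF]] := Hk_chain x0 HF.
have [K [[pK lK] wK aK]] := Hk_chain x1 HK.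
have [M [[pM lM] wM aM]] := Hk_chain z01 Hu.
have [N [[pN lN] wN aN]] := Hk_chain z01 Hv.
have z0 := ltW x0; have z1 := ltW x1.
have x01 : 0 <= xi <= 1 by rewrite z0.
have i0 : 0 <= (0:R) <= 1 by rewrite lexx ler01.
have i1 : 0 <= (1:R) <= 1 by rewrite lexx ler01.
have [_ aF2] := wderivn_spec x0 (lF 2 isT) (wF 2 isT).
have [_ aK2] := wderivn_spec x1 (lK 2 isT) (wK 2 isT).
have [_ aF3] := wderivn_spec x0 (lF 3 isT) (wF 3 isT).
have [_ aK3] := wderivn_spec x1 (lK 3 isT) (wK 3 isT).
rewrite (trace_cprim z01 aM (pM 0%N isT) i0) in u0.
rewrite (trace_cprim z01 aM (pM 0%N isT) i1) in u1.
rewrite (trace_cprim z01 aN (pN 0%N isT) i0) in v0.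
rewrite (trace_cprim z01 aN (pN 0%N isT) i1) in v1.
have l0 : 0 <= (0:R) <= xi by rewrite lexx z0.
have lx : 0 <= xi <= xi by rewrite lexx z0.
have rx : xi <= xi <= 1 by rewrite lexx z1.
have r1 : xi <= 1 <= (1:R) by rewrite lexx z1.
rewrite (trace_cprim x0 aF2 (pF 2 isT) l0) in s0.
rewrite (trace_cprim x1 aK2 (pK 2 isT) r1) in s1.
rewrite (trace_cprim x0 aF2 (pF 2 isT) lx) (trace_cprim x1 aK2 (pK 2 isT) rx) in sx.
rewrite (trace_cprim x0 aF3 (pF 3 isT) lx) (trace_cprim x1 aK3 (pK 3 isT) rx) in jx.
rewrite (trace_cprim z01 aN (pN 0%N isT) x01) in jx.
(* Global weak derivatives restrict to subintervals, so uniqueness ties the one-sided second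
   derivatives to the global one. *)
have aFM : aeeq 0 xi (F 2) (M 2).
  apply: (is_wderivn_uniq x0 (lF 2 isT) (L2_sub (lexx 0) z1 (lM 2 isT)) (wF 2 isT)).
  by apply: is_wderivn_sub (wM 2 isT) => //; exact: lM.
have aKM : aeeq xi 1 (K 2) (M 2).
  apply: (is_wderivn_uniq x1 (lK 2 isT) (L2_sub z0 (lexx 1) (lM 2 isT)) (wK 2 isT)).
  by apply: is_wderivn_sub (wM 2 isT) => //; exact: lM.
have /aeeqP[aFMr aFMi] := aFM; have /aeeqP[aKMr aKMi] := aKM.
pose w4 x := if x < xi then F 4 x else K 4 x.
have /L2P[lFr lFi] := lF 4 isT; have /L2P[lKr lKi] := lK 4 isT.
have /L2P[lMr lMi] := lM 2 isT.
have lw : L2 0 1 w4.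
  apply/L2P; rewrite /w4; split.
    by under eq_fun do rewrite Re_if; exact: l2_glue.
  by under eq_fun do rewrite Im_if; exact: l2_glue.
have [pF2r pF2i] := pF 2 isT; have [pF3r pF3i] := pF 3 isT.
have [pK2r pK2i] := pK 2 isT; have [pK3r pK3i] := pK 3 isT.
have D : beam_data (al / a) xi (M 0%N) (M 1%N) (M 2) (N 0%N) (N 1%N) (N 2) w4.
  split => //.
  - by apply/cchain2P; split; [exact: pM|exact: pM|exact: lM].
  - by apply/cchain2P; split; [exact: pN|exact: pN|exact: lN].
  move=> g0 g1 g2 ch g00 g01; rewrite /pair_re /pair_im /w4; split.
    under eq_itg do rewrite Re_if.
    apply: (jump_identity x0 x1 pF2r pF3r lFr pK2r pK3r lKr lMr aFMr aKMr _ _ _ _ ch g00 g01).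
    - by rewrite s0.
    - by rewrite s1.
    - by rewrite sx.
    by rewrite -cReB jx !complexE /=; ring.
  under eq_itg do rewrite Im_if.
  apply: (jump_identity x0 x1 pF2i pF3i lFi pK2i pK3i lKi lMi aFMi aKMi _ _ _ _ ch g00 g01).
  - by rewrite s0.
  - by rewrite s1.
  - by rewrite sx.
  by rewrite -cImB jx !complexE /=; ring.
exists (M 0%N), (M 1%N), (M 2), (N 0%N), (N 1%N), (N 2), w4; split => //.
  by split => //; [exact: wM|exact: wN].
by apply: beam_op_data D _ _ _ => //; exact: wM.
Qed.

End BeamDomain.

(** * Domain elements without jump, and boundary values of H^1_0 functions *)

Section Regular.
Context {R : realType}.
Local Notation C := R[i].
Local Notation Re := (@complex.Re R).
Local Notation Im := (@complex.Im R).
Implicit Types (c d x a b al xi : R) (phi : R -> R) (U : state R) (mu : C).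
Local Open Scope complex_scope.

Lemma cchain_sub (k : nat) c d c' d' (G : nat -> R -> C) : c <= c' -> d' <= d -> cchain k c d G ->
  cchain k c' d' G.
Proof.
move=> h1 h2 [p l]; split => j jk; first exact: cprim_restr (p j jk).
exact: L2_sub (l j jk).
Qed.

(** With alpha = 0 the jump condition asks for continuity of the third derivative, which a chain of
    length 4 on all of (0,1) has at any [xi]. *)
Lemma regular_dom a xi (G : nat -> R -> C) (n0 n1 n2 : R -> C) : 0 < xi -> xi < 1 ->
  cchain 4 0 1 G -> cchain2 0 1 n0 n1 n2 ->
  [/\ G 0%N 0 = 0, G 0%N 1 = 0, G 2%N 0 = 0 & G 2%N 1 = 0] -> n0 0 = 0 -> n0 1 = 0 ->
  beam_dom a 0 xi (G 0%N, n0).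
Proof.
move=> x0 x1 hG hn [G00 G01 G20 G21] n00 n01.
have /cchain2P[pn0 pn1 ln2] := hn.
have z0 := ltW x0; have z1 := ltW x1; have z01 := @ltr01 R.
have x01 : 0 <= xi <= 1 by rewrite z0.
have i0 : 0 <= (0:R) <= 1 by rewrite lexx ler01.
have i1 : 0 <= (1:R) <= 1 by rewrite lexx ler01.
have l0 : 0 <= (0:R) <= xi by rewrite lexx z0.
have lx : 0 <= xi <= xi by rewrite lexx z0.
have rx : xi <= xi <= 1 by rewrite lexx z1.
have r1 : xi <= 1 <= (1:R) by rewrite lexx z1.
have hl := cchain_sub (lexx 0) z1 hG; have hr := cchain_sub z0 (lexx 1) hG.
have [_ aF2] := wderivn_spec x0 (hl.2 2 isT) (cchain_wderivn z0 hl (isT : (2 <= 4)%N)).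
have [_ aK2] := wderivn_spec x1 (hr.2 2 isT) (cchain_wderivn z1 hr (isT : (2 <= 4)%N)).
have [_ aF3] := wderivn_spec x0 (hl.2 3 isT) (cchain_wderivn z0 hl (isT : (3 <= 4)%N)).
have [_ aK3] := wderivn_spec x1 (hr.2 3 isT) (cchain_wderivn z1 hr (isT : (3 <= 4)%N)).
have h2 : cchain 2 0 1 G by split => j jk; [apply: hG.1|apply: hG.2]; exact: leq_trans jk _.
pose N j := nth (fun=> 0) [:: n0; n1; n2] j : R -> C.
have hN : cchain 2 0 1 N.
  split; first by case=> [|[|[]]]//.
  by case=> [|[|[|[]]]]//= _; [exact: cprim_L2 pn0|exact: cprim_L2 pn1].
split.
- split; [exact: cchain_Hk z0 hl|exact: cchain_Hk z1 hr|exact: cchain_Hk ler01 h2|].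
  exact: (cchain_Hk ler01 hN).
- by rewrite !(trace_cprim z01 (aeeq_refl _ _ _) (hG.1 0%N isT))// !(trace_cprim z01 (aeeq_refl _
  _ _) pn0).
- by rewrite (trace_cprim x0 aF2 (hl.1 2 isT))// (trace_cprim x1 aK2 (hr.1 2 isT)).
- by rewrite (trace_cprim x0 aF2 (hl.1 2 isT))// (trace_cprim x1 aK2 (hr.1 2 isT)).
rewrite (trace_cprim x0 aF3 (hl.1 3 isT))// (trace_cprim x1 aK3 (hr.1 3 isT))//.
by rewrite subrr mul0r oppr0 mul0r.
Qed.

Lemma regular_op a b xi (G : nat -> R -> C) (n0 : R -> C) :
  cchain 4 0 1 G -> L2 0 1 n0 ->
  aeeq 0 1 (beam_op a b 0 xi (G 0%N, n0)).2 (fun x => (- a)%:C * G 4 x + (- b)%:C * n0 x).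
Proof.
move=> hG ln; have lG := hG.2 4 isT.
suff [] : L2 0 1 (beam_op a b 0 xi (G 0%N, n0)).2 /\
  aeeq 0 1 (beam_op a b 0 xi (G 0%N, n0)).2 (fun x => (- a)%:C * G 4 x + (- b)%:C * n0 x) by [].
apply: beam_op_spec; first by apply: L2D; exact: L2Z.
move=> phi tphi.
have lphi : l2 0 1 phi by apply: l2_cont; exact: test_cont tphi.
have /is_wderivnP/(_ _ tphi)[d1 d2] := cchain_wderivn ler01 hG (isT : (4 <= 4)%N).
have [s1 s2] := pair_comb (- a) (- b) lG ln lphi.
rewrite /beam_distr /= !cintegral_real s1 s2 d1 d2.
have -> : (-1) ^+ 4 = 1 :> R by ring.
rewrite !mul0r subr0 !mul1r.
by apply: ceq; rewrite !complexE /=; ring.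
Qed.

(** The increments of d0^2 are integrals of 2 d0 d1, hence at most N. Comparing an end value with
    d0(x)^2 and averaging over x gives the bound. *)
Lemma end_values_le (d0 d1 : R -> R) : prim 0 1 d0 d1 -> l2 0 1 d1 ->
  let N := itg 0 1 (fun x => d0 x ^+ 2) + itg 0 1 (fun x => d1 x ^+ 2) in
  d0 0 ^+ 2 <= 2 * N /\ d0 1 ^+ 2 <= 2 * N.
Proof.
move=> p l1 N.
have l0 := l2_cont (prim_cont p).
have pp := prim_mul p p.
have iN := itgbD l0.2 l1.2.
have NE : N = itg 0 1 (fun x => d0 x ^+ 2 + d1 x ^+ 2) by rewrite itgD//; [exact: l0.2|exact:
  l1.2].
have N1 : 0 <= itg 0 1 (fun x => d1 x ^+ 2) by apply: itg_ge0 => x _; exact: sqr_ge0.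
have bnd x y : 0 <= x -> x <= y -> y <= 1 -> `|d0 y ^+ 2 - d0 x ^+ 2| <= N.
  move=> x0 xy y1; rewrite !expr2 (prim_incr pp x0 xy y1).
  have s (f : R -> R) : itgb 0 1 f -> itgb x y f := itgb_sub x0 y1.
  apply: le_trans (le_abs_itg (s _ pp.1)) _.
  apply: le_trans (_ : itg x y (fun z => d0 z ^+ 2 + d1 z ^+ 2) <= _).
    apply: le_itg => [||z _]; [exact/itgb_norm/s/pp.1|exact: s iN|].
    have := sqr_ge0 (d0 z - d1 z); have := sqr_ge0 (d0 z + d1 z).
    rewrite ler_norml; lra.
  have i0 : itgb 0 1 (fun z => d0 z ^+ 2 + d1 z ^+ 2) := iN.
  have g0 s' t : 0 <= itg s' t (fun z => d0 z ^+ 2 + d1 z ^+ 2).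
    by apply: itg_ge0 => z _; rewrite addr_ge0// sqr_ge0.
  rewrite NE (itg_split x0 (le_trans xy y1) i0).
  rewrite (itg_split xy y1 (itgb_sub x0 (lexx 1) i0)).
  have := g0 0 x; have := g0 y 1; lra.
have key e : (forall x, 0 <= x <= 1 -> e <= d0 x ^+ 2 + N) -> e <= 2 * N.
  move=> h; apply: le_trans (_ : itg 0 1 (fun x => d0 x ^+ 2 + N) <= _).
    apply: le_trans (_ : itg 0 1 (fun=> e) <= _); first by rewrite itg_cst ?ler01// subr0 mulr1.
    apply: le_itg => [||x /andP[x0 x1]]; [exact: itgb_cst|exact: itgbD l0.2 (itgb_cst _ _ _)|].
    by apply: h; rewrite !ltW.
  rewrite itgD; [|exact: l0.2|exact: itgb_cst].
  by rewrite itg_cst ?ler01// subr0 mulr1 /N; lra.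
split; apply: key => x /andP[x0 x1].
  by have := bnd 0 x (lexx 0) x0 x1; rewrite ler_norml => /andP[]; lra.
by have := bnd x 1 x0 x1 (lexx 1); rewrite ler_norml => /andP[]; lra.
Qed.

Lemma test_ends phi : test_fun 0 1 phi -> phi 0 = 0 /\ phi 1 = 0.
Proof. by move=> h; rewrite !(test_out h) ?lexx ?orbT. Qed.

(** Test functions vanish at the ends, and end values are continuous for the H^1 norm, so membership
    in the closure gives the Dirichlet conditions. *)
Lemma H10_ends (u m0 m1 m2 : R -> C) : H10 0 1 u -> cchain2 0 1 m0 m1 m2 ->
  L2 0 1 u -> aeeq 0 1 u m0 -> is_wderivn 1 0 1 u m1 -> m0 0 = 0 /\ m0 1 = 0.
Proof.
move=> [_ hu] cm lu am0 w1.
have /cchain2P[p0 p1 _] := cm.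
have l0 := cprim_L2 p0; have l1 := cprim_L2 p1.
have [lw aw] := wderivn_spec ltr01 l1 w1.
have p0r := p0.1; have p0i := p0.2.
have /L2P[l1r l1i] := l1; have /L2P[l0r l0i] := l0.
have small (e : R) : 0 < e -> [/\ Re (m0 0) ^+ 2 <= 2 * e, Im (m0 0) ^+ 2 <= 2 * e,
    Re (m0 1) ^+ 2 <= 2 * e & Im (m0 1) ^+ 2 <= 2 * e].
  move=> e0; have [phi [psi [tphi tpsi]]] := hu e e0.
  have [phi0 phi1] := test_ends tphi; have [psi0 psi1] := test_ends tpsi.
  have tphi' := test_derive1 tphi; have tpsi' := test_derive1 tpsi.
  have lt (s t : R) (f : R -> R) : test_fun s t f -> l2 0 1 f by move=> h; apply: l2_cont; exact:
    test_cont h.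
  have S (f g : R -> C) (p q : R -> R) : L2 0 1 f -> L2 0 1 g -> aeeq 0 1 f g -> l2 0 1 p -> l2 0
    1 q ->
     sqdistL2 0 1 f (fun x => p x +i* q x) =
     itg 0 1 (fun x => (Re (g x) - p x) ^+ 2) + itg 0 1 (fun x => (Im (g x) - q x) ^+ 2).
    move=> /L2P[lf1 lf2] /L2P[lg1 lg2] /aeeqP[a1 a2] lp lq.
    have b1 := l2B lf1 lp; have b2 := l2B lf2 lq.
    have c1 := l2B lg1 lp; have c2 := l2B lg2 lq.
    transitivity (itg 0 1 (fun x => (Re (f x) - p x) ^+ 2 + (Im (f x) - q x) ^+ 2)).
      by apply: eq_itg => x _; rewrite cReB cImB.
    rewrite itgD; [|exact: b1.2|exact: b2.2].
    congr (_ + _); apply: ae_itg; try (by apply: measurable_funX; first [exact: b1.1|exact: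
      b2.1|exact: c1.1|exact: c2.1]).
      by apply: (ae_imp a1) => x hx /hx ->.
    by apply: (ae_imp a2) => x hx /hx ->.
  rewrite (S u m0)//; [|exact: lt tphi|exact: lt tpsi].
  rewrite (S _ m1)//; [|exact: lt tphi'|exact: lt tpsi'].
  have q1 := primB p0r (prim_test 0 1 tphi); have q2 := primB p0i (prim_test 0 1 tpsi).
  have [E1 E2] := end_values_le q1 (l2B l1r (lt _ _ _ tphi')).
  have [E3 E4] := end_values_le q2 (l2B l1i (lt _ _ _ tpsi')).
  rewrite phi0 subr0 in E1; rewrite phi1 subr0 in E2.
  rewrite psi0 subr0 in E3; rewrite psi1 subr0 in E4.
  have pos (f : R -> R) : 0 <= itg 0 1 (fun x => f x ^+ 2) by apply: itg_ge0 => x _; exact: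
    sqr_ge0.
  have := pos (fun x => Re (m0 x) - phi x); have := pos (fun x => Im (m0 x) - psi x).
  have := pos (fun x => Re (m1 x) - derive1 phi x); have := pos (fun x => Im (m1 x) - derive1 psi
    x).
  move: (itg 0 1 _) (itg 0 1 _) (itg 0 1 _) (itg 0 1 _) E1 E2 E3 E4 => A1 A2 A3 A4.
  move: (Re (m0 0) ^+ 2) (Im (m0 0) ^+ 2) (Re (m0 1) ^+ 2) (Im (m0 1) ^+ 2) => B1 B2 B3 B4.
  by clear => *; split; lra.
have z (r : R) : (forall e : R, 0 < e -> r ^+ 2 <= 2 * e) -> r = 0.
  move=> h; apply/eqP; rewrite -sqrf_eq0 eq_le sqr_ge0 andbT.
  apply/ler_addgt0Pr => e e0; have := h (e / 2); rewrite divr_gt0// => /(_ isT); lra.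
split; apply: ceq; apply: z => e /small[]//.
Qed.

End Regular.

(** * Energy estimates and the spectrum *)

Section Energy.
Context {R : realType}.
Local Notation C := R[i].
Local Notation Re := (@complex.Re R).
Local Notation Im := (@complex.Im R).
Implicit Types (c d x a b al xi : R) (phi : R -> R) (U : state R) (mu : C) (f g : R -> C).
Local Open Scope complex_scope.

Definition sqn f : R := itg 0 1 (fun x => Re (f x) ^+ 2 + Im (f x) ^+ 2).
Definition sqmod (z : C) : R := Re z ^+ 2 + Im z ^+ 2.

Lemma sqn_ge0 f : 0 <= sqn f.
Proof. by apply: itg_ge0 => x _; rewrite addr_ge0// sqr_ge0. Qed.

Lemma sqmod_ge0 (z : C) : 0 <= sqmod z.
Proof. by rewrite addr_ge0// sqr_ge0. Qed.

Lemma sqn_itgb f : L2 0 1 f -> itgb 0 1 (fun x => Re (f x) ^+ 2 + Im (f x) ^+ 2).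
Proof. by move=> /L2P[[_ i1] [_ i2]]; exact: itgbD. Qed.

Lemma sqnE f : L2 0 1 f -> sqn f =
  itg 0 1 (fun x => Re (f x) ^+ 2) + itg 0 1 (fun x => Im (f x) ^+ 2).
Proof. by move=> /L2P[[_ i1] [_ i2]]; rewrite /sqn itgD. Qed.

Lemma sqn_ae f g : L2 0 1 f -> L2 0 1 g -> aeeq 0 1 f g -> sqn f = sqn g.
Proof.
move=> lf lg h; have /L2P[[f1 _] [f2 _]] := lf; have /L2P[[g1 _] [g2 _]] := lg.
have [a1 a2] := (aeeqP _ _ _ _).1 h.
apply: ae_itg; try by apply: measurable_funD; exact: measurable_funX.
by refine (ae_imp2 a1 a2 _) => x h1 h2 xI; rewrite h1// h2.
Qed.

Lemma sqnZ mu f : L2 0 1 f -> sqn (fun x => mu * f x) = sqmod mu * sqn f.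
Proof.
move=> lf; rewrite /sqn -itgZ; last exact: sqn_itgb.
by apply: eq_itg => x _; rewrite cReM cImM /sqmod; ring.
Qed.

Lemma sqnD_le f g : L2 0 1 f -> L2 0 1 g -> sqn (fun x => f x + g x) <= 2 * sqn f + 2 * sqn g.
Proof.
move=> lf lg; have i1 := sqn_itgb lf; have i2 := sqn_itgb lg.
rewrite /sqn -!itgZ// -itgD; try exact: itgbZ.
apply: le_itg; [exact: sqn_itgb (L2D lf lg)|by apply: itgbD; exact: itgbZ|].
move=> x _; rewrite cReD cImD.
have := sqr_ge0 (Re (f x) - Re (g x)); have := sqr_ge0 (Im (f x) - Im (g x)); lra.
Qed.

Lemma sqnB_le f g : L2 0 1 f -> L2 0 1 g -> sqn (fun x => f x - g x) <= 2 * sqn f + 2 * sqn g.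
Proof.
move=> lf lg; have := sqnD_le lf (L2Z (-1) lg).
rewrite sqnZ// (_ : sqmod (-1) = 1); last by rewrite /sqmod /=; ring.
rewrite mul1r; congr (_ <= _); congr sqn; apply/funext => x; by rewrite mulN1r.
Qed.

Lemma sqn0_ae f : L2 0 1 f -> sqn f = 0 -> aeeq 0 1 f (fun=> 0).
Proof.
move=> lf f0; have /L2P[l1 l2] := lf.
have N1 : 0 <= itg 0 1 (fun x => Re (f x) ^+ 2) by apply: itg_ge0 => x _; exact: sqr_ge0.
have N2 : 0 <= itg 0 1 (fun x => Im (f x) ^+ 2) by apply: itg_ge0 => x _; exact: sqr_ge0.
rewrite sqnE// in f0.
by apply/aeeqP; split; apply: l2_zero_ae => //; lra.
Qed.

Lemma cchain2_poincare (m0 m1 m2 : R -> C) : cchain2 0 1 m0 m1 m2 -> m0 0 = 0 -> m0 1 = 0 ->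
  pi ^+ 4 * sqn m0 <= sqn m2.
Proof.
move=> ch m00 m01; have /cchain2P[p0 p1 l2] := ch.
have [c1 c2] := ch.
have [] := chain2_poincare c1; [by rewrite m00|by rewrite m01|].
have [] := chain2_poincare c2; [by rewrite m00|by rewrite m01|].
rewrite !sqnE//; [lra|exact: cprim_L2 p0].
Qed.

Lemma cchain2_sup (m0 m1 m2 : R -> C) x : cchain2 0 1 m0 m1 m2 -> m0 0 = 0 -> m0 1 = 0 ->
  0 <= x <= 1 -> sqmod (m0 x) <= 2 * sqn m2.
Proof.
move=> ch m00 m01 xI; have /cchain2P[p0 p1 l2] := ch.
have [c1 c2] := ch.
have h1 := chain2_sup c1 _ _ xI; have h2 := chain2_sup c2 _ _ xI.
rewrite sqnE// mulrDr /sqmod lerD//; first by apply: h1; rewrite ?m00 ?m01.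
by apply: h2; rewrite ?m00 ?m01.
Qed.

(** Real part, and below it imaginary part, of the L^2 product of [f] with the conjugate of [g]. *)
Definition dot_re f g : R := itg 0 1 (fun x => Re (f x) * Re (g x) + Im (f x) * Im (g x)).
Definition dot_im f g : R := itg 0 1 (fun x => Im (f x) * Re (g x) - Re (f x) * Im (g x)).

Lemma dot_itgb f g : L2 0 1 f -> L2 0 1 g ->
  itgb 0 1 (fun x => Re (f x) * Re (g x) + Im (f x) * Im (g x)) /\
  itgb 0 1 (fun x => Im (f x) * Re (g x) - Re (f x) * Im (g x)).
Proof.
move=> /L2P[f1 f2] /L2P[g1 g2].
by split; [apply: itgbD|apply: itgbB]; exact: l2_mul.
Qed.

(** Cauchy-Schwarz before optimisation: the squared norm of s g + c f, with c a suitable unit, is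
    nonnegative for s = t and s = -t. The free parameter avoids square roots later. *)
Lemma dot_bound f g (t : R) : L2 0 1 f -> L2 0 1 g ->
  2 * t * `|dot_re f g| <= t ^+ 2 * sqn g + sqn f /\
  2 * t * `|dot_im f g| <= t ^+ 2 * sqn g + sqn f.
Proof.
move=> lf lg; have i1 := sqn_itgb lf; have i2 := sqn_itgb lg.
have [d1 d2] := dot_itgb lf lg.
have key (p : R -> R) : itgb 0 1 p ->
    (forall s x : R, 0 <= s ^+ 2 * (Re (g x) ^+ 2 + Im (g x) ^+ 2) + 2 * s * p x + (Re (f x) ^+ 2
      + Im (f x) ^+ 2)) ->
    2 * t * `|itg 0 1 p| <= t ^+ 2 * sqn g + sqn f.
  move=> ip h.
  have P s : 0 <= s ^+ 2 * sqn g + 2 * s * itg 0 1 p + sqn f.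
    rewrite /sqn -itg_comb3//; apply: itg_ge0 => x _; exact: h.
  have := P t; have := P (- t); rewrite sqrrN.
  by case: ler0P => _; lra.
split; apply: key => // s x.
  have := sqr_ge0 (s * Re (g x) + Re (f x)); have := sqr_ge0 (s * Im (g x) + Im (f x)); lra.
have := sqr_ge0 (s * Re (g x) + Im (f x)); have := sqr_ge0 (s * Im (g x) - Re (f x)); lra.
Qed.

(** The real and imaginary parts of [m0] are admissible choices of [g0]; combining the two gives
    <w4, m0> = |m2|^2 + kap n0(xi) conj m0(xi). *)
Lemma data_dot (kap xi : R) (m0 m1 m2 n0 n1 n2 w4 : R -> C) :
  beam_data kap xi m0 m1 m2 n0 n1 n2 w4 ->
  dot_re w4 m0 = sqn m2 + kap * (Re (n0 xi) * Re (m0 xi) + Im (n0 xi) * Im (m0 xi)) /\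
  dot_im w4 m0 = kap * (Im (n0 xi) * Re (m0 xi) - Re (n0 xi) * Im (m0 xi)).
Proof.
move=> [cm cn lw [m00 m01 n00 n01] h].
have /cchain2P[p0 p1 l2m] := cm; have l0 := cprim_L2 p0.
have [c1 c2] := cm.
have [e1 e2] := h _ _ _ c1 (congr1 Re m00) (congr1 Re m01).
have [e3 e4] := h _ _ _ c2 (congr1 Im m00) (congr1 Im m01).
have /L2P[w1 w2] := lw; have /L2P[k1 k2] := l0; have /L2P[j1 j2] := l2m.
rewrite /dot_re /dot_im itgD ?itgB; try exact: l2_mul.
move: e1 e2 e3 e4; rewrite /pair_re /pair_im => -> -> -> ->.
rewrite sqnE//; split.
  rewrite -!(eq_itg (fun x _ => expr2 _)) /=; ring.
rewrite (@eq_itg _ _ _ (fun x => Im (m2 x) * Re (m2 x)) (fun x => Re (m2 x) * Im (m2 x))); first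
  ring.
by move=> x _; rewrite mulrC.
Qed.

Lemma comb_dot (a : R) (l : C) (m0 w4 : R -> C) : L2 0 1 m0 -> L2 0 1 w4 ->
  dot_re (fun x => a%:C * w4 x + l * m0 x) m0 = a * dot_re w4 m0 + Re l * sqn m0 /\
  dot_im (fun x => a%:C * w4 x + l * m0 x) m0 = a * dot_im w4 m0 + Im l * sqn m0.
Proof.
move=> l0 lw; have [d1 d2] := dot_itgb lw l0; have i0 := sqn_itgb l0.
rewrite /dot_re /dot_im /sqn -!itgZ// -!itgD; try exact: itgbZ.
by split; apply: eq_itg => x _; rewrite !complexE /=; ring.
Qed.

(** Here A + iB stands for <h, u> with h = a u'''' + l u, l = lr + i li, and H, N0, N2 for the
    squared norms of h, u, u''. Either B controls N0, or A does through pi^4 N0 <= N2; in both cases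
    A then controls N2. *)
Lemma coercive (a lr li : R) : 0 < a -> li != 0 \/ 0 < lr + a * pi ^+ 4 ->
  exists2 K : R, 0 <= K & forall N0 N2 H A B : R, 0 <= N0 -> pi ^+ 4 * N0 <= N2 -> 0 <= H ->
    A = a * N2 + lr * N0 -> B = li * N0 ->
    (forall t, 2 * t * `|A| <= t ^+ 2 * N0 + H) -> (forall t, 2 * t * `|B| <= t ^+ 2 * N0 + H) ->
    N0 <= K * H /\ N2 <= K * H.
Proof.
move=> a0 hl.
have [l l0 hN] : exists2 l : R, 0 < l & forall N0 N2 H A B : R, 0 <= N0 -> pi ^+ 4 * N0 <= N2 ->
  0 <= H ->
    A = a * N2 + lr * N0 -> B = li * N0 ->
    (forall t, 2 * t * `|A| <= t ^+ 2 * N0 + H) -> (forall t, 2 * t * `|B| <= t ^+ 2 * N0 + H) ->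
    l ^+ 2 * N0 <= H.
  case: hl => hl.
    exists `|li|; first by rewrite normr_gt0.
    move=> N0 N2 H A B N00 _ _ _ -> _ /(_ `|li|).
    by rewrite normrM (ger0_norm N00) => h; lra.
  exists (lr + a * pi ^+ 4) => // N0 N2 H A B N00 h2 H0 AE _ /(_ (lr + a * pi ^+ 4)) hA _.
  set k := lr + _ in hl hA *.
  have kA : k * N0 <= `|A|.
    apply: le_trans (ler_norm A); rewrite AE.
    have : a * (pi ^+ 4 * N0) <= a * N2 by rewrite ler_pM2l.
    rewrite /k; lra.
  have : 2 * k * (k * N0) <= 2 * k * `|A| by rewrite ler_pM2l// mulr_gt0.
  lra.
(* First N0 <= H / l^2. Then a N2 <= |A| + |lr| N0, where t = 1 bounds |A| by (N0 + H) / 2. *)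
exists ((l ^- 2) + (((l ^- 2 + 1) / 2 + `|lr| * l ^- 2) / a)).
  rewrite addr_ge0 ?invr_ge0 ?exprn_ge0 ?(ltW l0)// divr_ge0 ?(ltW a0)//.
  by rewrite addr_ge0 ?mulr_ge0 ?divr_ge0 ?addr_ge0 ?invr_ge0 ?exprn_ge0 ?(ltW l0).
move=> N0 N2 H A B N00 h2 H0 AE BE hA hB.
have hN0 : N0 <= l ^- 2 * H.
  by rewrite ler_pdivlMl ?exprn_gt0//; exact: (hN N0 N2 H A B).
have hi : 0 <= l ^- 2 * H by rewrite mulr_ge0 ?invr_ge0 ?exprn_ge0 ?(ltW l0).
have hN2 : a * N2 <= ((l ^- 2 + 1) / 2 + `|lr| * l ^- 2) * H.
  have := hA 1; have := ler_norm A.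
  have : - lr * N0 <= `|lr| * N0 by rewrite ler_wpM2r// -normrN ler_norm.
  have : `|lr| * N0 <= `|lr| * (l ^- 2 * H) by rewrite ler_wpM2l.
  have -> : ((l ^- 2 + 1) / 2 + `|lr| * l ^- 2) * H = (l ^- 2 * H + H) / 2 + `|lr| * (l ^- 2 * H)
    by ring.
  lra.
have {}hN2 : N2 <= (((l ^- 2 + 1) / 2 + `|lr| * l ^- 2) / a) * H.
  by rewrite mulrAC ler_pdivlMr// mulrC.
have : 0 <= (((l ^- 2 + 1) / 2 + `|lr| * l ^- 2) / a) * H.
  rewrite mulr_ge0// divr_ge0 ?(ltW a0)//.
  by rewrite addr_ge0 ?mulr_ge0 ?divr_ge0 ?addr_ge0 ?invr_ge0 ?exprn_ge0 ?(ltW l0).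
rewrite mulrDl; split; lra.
Qed.

Lemma beam_data_sub kap xi (m0 m1 m2 n0 n1 n2 w4 m0' m1' m2' n0' n1' n2' w4' : R -> C) :
  beam_data kap xi m0 m1 m2 n0 n1 n2 w4 -> beam_data kap xi m0' m1' m2' n0' n1' n2' w4' ->
  beam_data kap xi (fun x => m0 x - m0' x) (fun x => m1 x - m1' x) (fun x => m2 x - m2' x)
    (fun x => n0 x - n0' x) (fun x => n1 x - n1' x) (fun x => n2 x - n2' x)
    (fun x => w4 x - w4' x).
Proof.
move=> [/cchain2P[a1 a2 a3] /cchain2P[b1 b2 b3] c1 [d1 d2 d3 d4] e].
move=> [/cchain2P[a1' a2' a3'] /cchain2P[b1' b2' b3'] c1' [d1' d2' d3' d4'] e'].
split.
- by apply/cchain2P; split; [exact: cprimB|exact: cprimB|exact: L2B].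
- by apply/cchain2P; split; [exact: cprimB|exact: cprimB|exact: L2B].
- exact: L2B.
- by rewrite d1 d2 d3 d4 d1' d2' d3' d4' subrr.
move=> g0 g1 g2 ch g00 g01; have [h1 h2] := e _ _ _ ch g00 g01; have [h1' h2'] := e' _ _ _ ch g00
  g01.
have lg0 : l2 0 1 g0 by case: ch => p _ _; exact: l2_cont (prim_cont p).
have lg2 : l2 0 1 g2 by case: ch.
have B (f g : R -> C) (p : R -> R) : L2 0 1 f -> L2 0 1 g -> l2 0 1 p ->
    pair_re (fun x => f x - g x) p 0 1 = pair_re f p 0 1 - pair_re g p 0 1 /\
    pair_im (fun x => f x - g x) p 0 1 = pair_im f p 0 1 - pair_im g p 0 1.
  move=> /L2P[f1 f2] /L2P[k1 k2] lp; rewrite /pair_re /pair_im -!itgB; try exact: l2_mul.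
  by split; apply: eq_itg => x _; rewrite ?cReB ?cImB mulrBl.
have [-> ->] := B _ _ _ c1 c1' lg0; have [-> ->] := B _ _ _ a3 a3' lg2.
rewrite h1 h2 h1' h2' !complexE; split; ring.
Qed.

(** Write (f, g) for the image of the state (m0, n0) under mu - A. Eliminating n0 = mu m0 - f leaves
    a w4 + l m0 = g + (mu + b) f with l = mu^2 + b mu. If mu is not real then Im l = Im mu (2 Re mu
    + b) is nonzero; if it is real, the second hypothesis is coercivity. *)
Lemma data_estimate (a b : R) mu : 0 < a -> 0 < 2 * Re mu + b ->
  0 < Re mu ^+ 2 + b * Re mu + a * pi ^+ 4 ->
  exists2 K : R, 0 <= K & forall xi (m0 m1 m2 n0 n1 n2 w4 : R -> C),
    beam_data 0 xi m0 m1 m2 n0 n1 n2 w4 ->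
    a * sqn m2 + sqn n0 <= K * (a * sqn (fun x => mu * m2 x - n2 x) +
      sqn (fun x => mu * n0 x + (a%:C * w4 x + b%:C * n0 x))).
Proof.
move=> a0 hb hl.
pose l : C := mu ^+ 2 + b%:C * mu.
have hl' : Im l != 0 \/ 0 < Re l + a * pi ^+ 4.
  have [im0|im0] := eqVneq (Im mu) 0.
    right; rewrite /l expr2 !complexE /= im0; move: hl; congr (_ < _); ring.
  left; have -> : Im l = Im mu * (2 * Re mu + b) by rewrite /l expr2 !complexE /=; ring.
  by rewrite mulf_neq0// gt_eqF.
have [K K0 hK] := coercive a0 hl'.
pose s := sqmod (mu + b%:C); pose t := sqmod mu.
have s0 : 0 <= s by exact: sqmod_ge0. have t0 : 0 <= t by exact: sqmod_ge0.
have z1 : 0 <= a + 2 * t by rewrite addr_ge0 ?mulr_ge0 ?(ltW a0).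
have z4 : 0 <= 2 * s / a by rewrite divr_ge0 ?(ltW a0)// mulr_ge0.
have z2 : 0 <= 2 + 2 * s / a by rewrite addr_ge0.
have z3 : 0 <= 2 / a by rewrite divr_ge0 ?(ltW a0).
(* With Q and G the squared norms of f'' and g: the left side is at most (a + 2 t) K H + 2 Q, while
   H <= 2 G + 2 s Q, and both are then compared with a Q + G. *)
exists ((a + 2 * t) * K * (2 + 2 * s / a) + 2 / a).
  by rewrite addr_ge0// mulr_ge0// mulr_ge0.
move=> xi m0 m1 m2 n0 n1 n2 w4 D.
have [cm cn lw [m00 m01 n00 n01] _] := D.
have /cchain2P[p0 p1 l2m] := cm; have /cchain2P[q0 q1 l2n] := cn.
have l0 := cprim_L2 p0; have ln := cprim_L2 q0.
pose f x := mu * m0 x - n0 x; pose f2 x := mu * m2 x - n2 x.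
pose g x := mu * n0 x + (a%:C * w4 x + b%:C * n0 x).
pose h x := a%:C * w4 x + l * m0 x.
have lf : L2 0 1 f by apply: L2B => //; exact: L2Z.
have lf2 : L2 0 1 f2 by apply: L2B => //; exact: L2Z.
have lg : L2 0 1 g by apply: L2D; [exact: L2Z|apply: L2D; exact: L2Z].
have lh : L2 0 1 h by apply: L2D; exact: L2Z.
(* The energy norm sees only the second derivative of f, so Poincare is applied to f itself, with
   pi^4 >= 1. *)
have Pf : sqn f <= sqn f2.
  have ch : cchain2 0 1 f (fun x => mu * m1 x - n1 x) f2.
    by apply/cchain2P; split => //; apply: cprimB => //; exact: cprimZ.
  have := cchain2_poincare ch; rewrite /f m00 m01 n00 n01 mulr0 subrr => /(_ erefl erefl).
  have pi4 : (1 : R) <= pi ^+ 4.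
    have : (2 : R) <= pi by exact: pi_ge2.
    by move=> p2; rewrite exprn_ege1// (le_trans _ p2)// ler1n.
  by apply: le_trans; rewrite ler_peMl// sqn_ge0.
have Hh : sqn h <= 2 * sqn g + 2 * s * sqn f2.
  have -> : h = (fun x => g x + (mu + b%:C) * f x).
    by apply/funext => x; rewrite /h /g /f /l; ring.
  apply: le_trans (sqnD_le lg (L2Z _ lf)) _; rewrite sqnZ// -/s.
  rewrite lerD2l mulrA ler_wpM2l// mulr_ge0//.
have [D1 D2] := data_dot D; rewrite !mul0r addr0 in D1 D2.
have [C1 C2] := comb_dot a l l0 lw; rewrite D1 D2 mulr0 add0r in C1 C2.
have [E1 E2] := hK _ _ _ _ _ (sqn_ge0 m0) (cchain2_poincare cm m00 m01) (sqn_ge0 h) C1 C2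
  (fun t => (dot_bound t lh l0).1) (fun t => (dot_bound t lh l0).2).
have En : sqn n0 <= 2 * (t * sqn m0) + 2 * sqn f2.
  have -> : n0 = (fun x => mu * m0 x - f x) by apply/funext => x; rewrite /f subKr.
  apply: le_trans (sqnB_le (L2Z mu l0) lf) _; rewrite sqnZ// -/t.
  by rewrite lerD2l ler_pM2l.
rewrite -/f2 -/g.
have g0 := sqn_ge0 g; have f20 := sqn_ge0 f2.
set G := sqn g in Hh g0 *; set Q := sqn f2 in Hh En f20 *.
set H := sqn h in Hh E1 E2.
have aQ0 : 0 <= a * Q by rewrite mulr_ge0// ltW.
have X1 : a * sqn m2 <= a * (K * H) by rewrite ler_pM2l.
have X2 : t * sqn m0 <= t * (K * H) by rewrite ler_wpM2l.
have X4 : 2 * G + 2 * s * Q <= (2 + 2 * s / a) * (a * Q + G).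
  have -> : (2 + 2 * s / a) * (a * Q + G) = 2 * G + 2 * s * Q + (2 * (a * Q) + 2 * s / a * G).
    by field; rewrite gt_eqF.
  by rewrite lerDl; apply: addr_ge0; [exact: mulr_ge0|exact: (mulr_ge0 z4 g0)].
have X5 : (a + 2 * t) * (K * H) <= (a + 2 * t) * (K * ((2 + 2 * s / a) * (a * Q + G))).
  by rewrite ler_wpM2l// ler_wpM2l// (le_trans Hh).
have X6 : 2 * Q <= 2 / a * (a * Q + G).
  have -> : 2 / a * (a * Q + G) = 2 * Q + 2 / a * G by field; rewrite gt_eqF.
  by rewrite lerDl; exact: (mulr_ge0 z3 g0).
rewrite [X in _ <= X]mulrDl -!(mulrA (a + 2 * t)) -(mulrA K).
move: (K * ((2 + 2 * s / a) * (a * Q + G))) (2 / a * (a * Q + G)) (K * H) X1 X2 X5 X6 En => A B E.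
move: (sqn n0) (sqn m2) (sqn m0) => S1 S2 S3.
by clear; lra.
Qed.

End Energy.

(** * Resolvent set, spectrum and eigenvalues of the beam operator *)

Section Spectrum.
Context {R : realType}.
Local Notation C := R[i].
Local Notation Re := (@complex.Re R).
Local Notation Im := (@complex.Im R).
Implicit Types (c d x a b al xi : R) (phi : R -> R) (U : state R) (mu : C) (f g : R -> C).
Local Open Scope complex_scope.

Lemma is_wderivn_ae k c d (u u' g : R -> C) : L2 c d u -> L2 c d u' -> aeeq c d u u' ->
  is_wderivn k c d u g -> is_wderivn k c d u' g.
Proof.
move=> lu lu' h /is_wderivnP hw; apply/is_wderivnP => phi tphi.
have mphi := itgb_meas (test_itgb c d (test_derive1n k tphi)).
by have [<- <-] := pair_ae lu lu' h mphi; exact: hw.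
Qed.

Lemma cchain2_wderivn (m0 m1 m2 : R -> C) : cchain2 0 1 m0 m1 m2 -> is_wderivn 2 0 1 m0 m2.
Proof.
move=> /cchain2P[p0 p1 _].
exact: cprim_wderivn ler01 (cprim_wderivn ler01 (@is_wderivn0 _ 0 1 m0) p0) p1.
Qed.

Lemma cchain2_zero (m0 m1 m2 : R -> C) : cchain2 0 1 m0 m1 m2 -> aeeq 0 1 m0 (fun=> 0) ->
  aeeq 0 1 m2 (fun=> 0).
Proof.
move=> ch m0z; have /cchain2P[p0 p1 l2m] := ch.
have /is_wderivnP w := cchain2_wderivn ch.
have L0 : L2 0 1 (fun=> 0 : C).
  by apply/L2P; split; apply: l2_cont => x; exact: cvg_cst.
apply: L2_zero => // phi tphi.
have mphi := itgb_meas (test_itgb 0 1 (test_derive1n 2 tphi)).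
have [e1 e2] := w _ tphi.
have [d1 d2] := pair_ae (cprim_L2 p0) L0 m0z mphi.
have z (p : R -> R) : itg 0 1 (fun x => 0 * p x) = 0 :> R.
  by rewrite (@eq_itg _ _ _ _ (fun=> 0)) ?itg_cst ?mul0r// => x _; rewrite mul0r.
move: e1 e2; rewrite d1 d2 /pair_re /pair_im !z expr2 mulrNN !mul1r => <- <- //.
Qed.

Lemma energy_norm_eq a U (m2 : R -> C) : L2 0 1 m2 -> is_wderivn 2 0 1 U.1 m2 -> L2 0 1 U.2 ->
  energy_norm a U = Num.sqrt (a * sqn m2 + sqn U.2).
Proof.
move=> lm wm lU; have [lw aw] := wderivn_spec ltr01 lm wm.
rewrite /energy_norm /energy_dot cintegralE /=; congr Num.sqrt.
rewrite -(sqn_ae lw lm aw) /sqn -itgZ; last exact: sqn_itgb.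
rewrite -itgD; [|exact/itgbZ/sqn_itgb|exact: sqn_itgb].
apply: eq_itg => x _; move: (wderivn 2 0 1 U.1 x) (U.2 x) => [? ?] [? ?] /=; ring.
Qed.

(** The difference of the two states is formed on their [beam_data], where it is literal; the
    estimate with zero right-hand side annihilates it. *)
Lemma beam_resolvent_inj a b xi mu : 0 < a -> 0 < xi -> xi < 1 ->
  0 < 2 * Re mu + b -> 0 < Re mu ^+ 2 + b * Re mu + a * pi ^+ 4 ->
  let T := fun U => state_sub (state_scale mu U) (beam_op a b 0 xi U) in
  forall U V, beam_dom a 0 xi U -> beam_dom a 0 xi V -> state_eq (T U) (T V) -> state_eq U V.
Proof.
move=> a0 x0 x1 hb hl T U V dU dV [E1 E2].
have an0 : a != 0 by rewrite gt_eqF.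
have [K K0 hK] := data_estimate a0 hb hl.
have [m0 [m1 [m2 [n0 [n1 [n2 [w4 [D [am0 wm2 an _] lU1 lU2 [_ aop]]]]]]]]] := beam_dom_data b an0
  x0 x1 dU.
have [m0' [m1' [m2' [n0' [n1' [n2' [w4' [D' [am0' wm2' an' _] lV1 lV2 [_ aop']]]]]]]]] :=
  beam_dom_data b an0 x0 x1 dV.
have DD := beam_data_sub D D'; rewrite mul0r in DD.
have [cm cn lw [m00 m01 n00 n01] _] := DD.
have /cchain2P[p0 p1 l2m] := cm; have /cchain2P[q0 q1 l2n] := cn.
have l0 := cprim_L2 p0; have ln := cprim_L2 q0.
have F0 : aeeq 0 1 (fun x => mu * (m0 x - m0' x) - (n0 x - n0' x)) (fun=> 0).
  have k1 := aeeq_imp2 (f2 := fun x => mu * U.1 x - U.2 x) (g2 := fun x => mu * m0 x - n0 x)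
    (fun x (h1 : U.1 x = m0 x) (h2 : U.2 x = n0 x) => congr2 (fun p q => mu * p - q) h1 h2) am0
      an.
  have k2 := aeeq_imp2 (f2 := fun x => mu * V.1 x - V.2 x) (g2 := fun x => mu * m0' x - n0' x)
    (fun x (h1 : V.1 x = m0' x) (h2 : V.2 x = n0' x) => congr2 (fun p q => mu * p - q) h1 h2)
      am0' an'.
  have k3 := aeeq_trans (aeeq_trans (aeeq_sym k1) E1) k2.
  by apply: aeeq_imp k3 => x /eqP; rewrite -subr_eq0 => /eqP <-; ring.
have chF : cchain2 0 1 (fun x => mu * (m0 x - m0' x) - (n0 x - n0' x))
    (fun x => mu * (m1 x - m1' x) - (n1 x - n1' x)) (fun x => mu * (m2 x - m2' x) - (n2 x - n2'
      x)).
  apply/cchain2P; split; [exact: cprimB (cprimZ mu p0) q0|exact: cprimB (cprimZ mu p1) q1|].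
  exact: L2B (L2Z mu l2m) l2n.
have /cchain2P[_ _ lF2] := chF.
have F20 := cchain2_zero chF F0.
have G0 : aeeq 0 1 (fun x => mu * (n0 x - n0' x) + (a%:C * (w4 x - w4' x) + b%:C * (n0 x - n0'
  x))) (fun=> 0).
  have k1 := aeeq_imp2 (f2 := fun x => mu * U.2 x - (beam_op a b 0 xi U).2 x)
    (fun x (h1 : U.2 x = n0 x) h2 => congr2 (fun p q => mu * p - q) h1 h2) an aop.
  have k2 := aeeq_imp2 (f2 := fun x => mu * V.2 x - (beam_op a b 0 xi V).2 x)
    (fun x (h1 : V.2 x = n0' x) h2 => congr2 (fun p q => mu * p - q) h1 h2) an' aop'.
  have k3 := aeeq_trans (aeeq_trans (aeeq_sym k1) E2) k2.
  apply: aeeq_imp k3 => x /eqP; rewrite -subr_eq0 => /eqP <-; rewrite !rmorphN /=; ring.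
have L0 : L2 0 1 (fun=> 0 : C).
  by apply/L2P; split; apply: l2_cont => x; exact: cvg_cst.
have lG : L2 0 1 (fun x => mu * (n0 x - n0' x) + (a%:C * (w4 x - w4' x) + b%:C * (n0 x - n0' x))).
  by apply: L2D; [exact: L2Z|apply: L2D; exact: L2Z].
have s0 : sqn (fun=> 0 : C) = 0.
  by rewrite /sqn (@eq_itg _ _ _ _ (fun=> 0)) ?itg_cst ?mul0r// => x _ /=; rewrite expr0n addr0.
have := hK _ _ _ _ _ _ _ _ DD.
rewrite (sqn_ae lF2 L0 F20) (sqn_ae lG L0 G0) s0 mulr0 addr0 mulr0 => Z.
have P := cchain2_poincare cm m00 m01.
have pi4 : (0 : R) < pi ^+ 4 by rewrite exprn_gt0// pi_gt0.
have y1 := sqn_ge0 (fun x => n0 x - n0' x); have y2 := sqn_ge0 (fun x => m2 x - m2' x).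
have y3 := sqn_ge0 (fun x => m0 x - m0' x).
have y4 : 0 <= a * sqn (fun x => m2 x - m2' x) by rewrite mulr_ge0// ltW.
have y5 : sqn (fun x => m2 x - m2' x) = 0.
  have /eqP : a * sqn (fun x => m2 x - m2' x) = 0 by lra.
  by rewrite mulf_eq0 gt_eqF//= => /eqP.
have y6 : sqn (fun x => m0 x - m0' x) = 0.
  have : pi ^+ 4 * sqn (fun x => m0 x - m0' x) = 0.
    have : 0 <= pi ^+ 4 * sqn (fun x => m0 x - m0' x) by rewrite mulr_ge0// ltW.
    lra.
  by move/eqP; rewrite mulf_eq0 gt_eqF//= => /eqP.
have y7 : sqn (fun x => n0 x - n0' x) = 0 by lra.
have z0 (f g : R -> C) : aeeq 0 1 (fun x => f x - g x) (fun=> 0) -> aeeq 0 1 f g.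
  by apply: aeeq_imp => x /eqP; rewrite subr_eq0 => /eqP.
split.
  exact: aeeq_trans (aeeq_trans am0 (z0 _ _ (sqn0_ae l0 y6))) (aeeq_sym am0').
exact: aeeq_trans (aeeq_trans an (z0 _ _ (sqn0_ae ln y7))) (aeeq_sym an').
Qed.

Lemma beam_resolvent_bound a b xi mu : 0 < a -> 0 < xi -> xi < 1 ->
  0 < 2 * Re mu + b -> 0 < Re mu ^+ 2 + b * Re mu + a * pi ^+ 4 ->
  let T := fun U => state_sub (state_scale mu U) (beam_op a b 0 xi U) in
  exists K : R, forall U, beam_dom a 0 xi U -> energy_norm a U <= K * energy_norm a (T U).
Proof.
move=> a0 x0 x1 hb hl T.
have an0 : a != 0 by rewrite gt_eqF.
have [K K0 hK] := data_estimate a0 hb hl.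
exists (Num.sqrt K) => U dU.
have [m0 [m1 [m2 [n0 [n1 [n2 [w4 [D [am0 wm2 an _] lU1 lU2 [lop aop]]]]]]]]] := beam_dom_data b
  an0 x0 x1 dU.
rewrite mul0r in D.
have [/cchain2P[p0 p1 l2m] /cchain2P[q0 q1 l2n] lw [m00 m01 n00 n01] _] := D.
have l0 := cprim_L2 p0; have ln := cprim_L2 q0.
rewrite (energy_norm_eq a l2m wm2 lU2) (sqn_ae lU2 ln an).
have ch : cchain2 0 1 (fun x => mu * m0 x - n0 x) (fun x => mu * m1 x - n1 x) (fun x => mu * m2 x
  - n2 x).
  apply/cchain2P; split; [exact: cprimB (cprimZ mu p0) q0|exact: cprimB (cprimZ mu p1) q1|].
  exact: L2B (L2Z mu l2m) l2n.
have /cchain2P[pf _ lf2] := ch.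
have k1 := aeeq_imp2 (f2 := fun x => mu * U.1 x - U.2 x) (g2 := fun x => mu * m0 x - n0 x)
    (fun x (h1 : U.1 x = m0 x) (h2 : U.2 x = n0 x) => congr2 (fun p q => mu * p - q) h1 h2) am0
      an.
have lT1 : L2 0 1 (T U).1 by apply: L2B => //; exact: L2Z.
have wT : is_wderivn 2 0 1 (T U).1 (fun x => mu * m2 x - n2 x).
  apply: is_wderivn_ae (cprim_L2 pf) lT1 _ (cchain2_wderivn ch); exact: aeeq_sym.
have lT2 : L2 0 1 (T U).2 by apply: L2B => //; exact: L2Z.
have k2 : aeeq 0 1 (T U).2 (fun x => mu * n0 x + (a%:C * w4 x + b%:C * n0 x)).
  apply: aeeq_imp2 an aop => x; rewrite /T /= => -> ->; rewrite !rmorphN /=; ring.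
have lg : L2 0 1 (fun x => mu * n0 x + (a%:C * w4 x + b%:C * n0 x)).
  by apply: L2D; [exact: L2Z|apply: L2D; exact: L2Z].
rewrite (energy_norm_eq a lf2 wT lT2) (sqn_ae lT2 lg k2).
by rewrite -sqrtrM// ler_wsqrtr//; exact: hK D.
Qed.

(** The first component imposes v = mu u - f, and the second becomes u'''' = k^2 u + h with a k^2 =
    -l and a h = F2 + (mu + b) f, under Navier conditions. *)
Lemma beam_resolvent_surj a b xi mu : 0 < a -> 0 < xi -> xi < 1 ->
  0 < 2 * Re mu + b -> 0 < Re mu ^+ 2 + b * Re mu + a * pi ^+ 4 ->
  let T := fun U => state_sub (state_scale mu U) (beam_op a b 0 xi U) in
  forall F, energy_space F -> exists U, beam_dom a 0 xi U /\ state_eq (T U) F.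
Proof.
move=> a0 x0 x1 hb hl T [F1 F2] [/= hF1 h10 lF2].
have aC : a%:C != 0 by rewrite eq_complex /= eqxx andbT gt_eqF.
have [f [[pf lf] wf af]] := Hk_chain ltr01 hF1.
have cf : cchain2 0 1 (f 0%N) (f 1%N) (f 2%N).
  by apply/cchain2P; split; [exact: pf|exact: pf|exact: lf].
(* Without the Dirichlet conditions on f, the function v = mu u - f would violate v(0) = v(1) =
   0. *)
have [f00 f01] := H10_ends h10 cf hF1.1 af (wf 1%N isT).
pose l : C := mu ^+ 2 + b%:C * mu.
have [k hk] : exists k : C, k ^+ 2 = - l / a%:C by exists (sqrtC (- l / a%:C)); rewrite sqrtCK.
have lE : l = - (a%:C * k ^+ 2) by rewrite hk mulrC divfK// opprK.
(* Resonance makes k' real and at most -pi^2, so l = -a k'^2 is real and at most -a pi^4. As Re mu >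
   -b/2, a real l forces mu to be real, and [hl] is contradicted. *)
have nr (k' : C) : k' ^+ 2 = k ^+ 2 -> nonresonant k'.
  move=> kk; apply: contrapT => /resonant_le[i0 r0].
  rewrite -kk in lE.
  have re : Re l = - (a * Re k' ^+ 2) by rewrite lE !expr2 !complexE /= i0; ring.
  have im : Im l = 0 by rewrite lE !expr2 !complexE /= i0; ring.
  have im' : Im mu * (2 * Re mu + b) = 0 by rewrite -im /l !expr2 !complexE /=; ring.
  have im0 : Im mu = 0 by move/eqP: im'; rewrite mulf_eq0 (gt_eqF hb) orbF => /eqP.
  have re' : Re l = Re mu ^+ 2 + b * Re mu by rewrite /l !expr2 !complexE /= im0; ring.
  have pi0 := pi_gt0 R.
  have q : pi ^+ 4 <= Re k' ^+ 2.
    rewrite (_ : pi ^+ 4 = (pi ^+ 2) ^+ 2); last by rewrite -exprM.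
    by rewrite -[X in _ <= X]sqrrN lerXn2r ?nnegrE ?exprn_ge0 ?(ltW pi0)//; nra.
  have : a * pi ^+ 4 <= a * Re k' ^+ 2 by rewrite ler_pM2l.
  lra.
have n1 := nr k erefl; have n2 := nr (- k) (sqrrN k).
pose h x : C := a%:C^-1 * (F2 x + (mu + b%:C) * f 0%N x).
have lh : L2 0 1 h by apply/L2Z/L2D => //; apply/L2Z/lf.
have /L2P[lh1 lh2] := lh.
have [u0 [u1 [u2 [u3 [[p0 p1 p2 p3] [u00 u01 u20 u21]]]]]] :=
  navier4_l2 n1 n2 (l2_itgb lh1) (l2_itgb lh2).
pose G j := nth (fun=> 0) [:: u0; u1; u2; u3; fun x => k ^+ 2 * u0 x + h x] j : R -> C.
have hG : cchain 4 0 1 G.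
  split; first by case=> [|[|[|[|]]]].
  case=> [|[|[|[|[|]]]]]//= _; [exact: cprim_L2 p0|exact: cprim_L2 p1|exact: cprim_L2 p2|
    exact: cprim_L2 p3|].
  by apply: L2D => //; apply/L2Z/cprim_L2/p0.
pose v j x := mu * G j x - f j x.
have cv : cchain2 0 1 (v 0%N) (v 1%N) (v 2%N).
  apply/cchain2P; split; [exact: cprimB (cprimZ mu p0) (pf 0%N isT)|
    exact: cprimB (cprimZ mu p1) (pf 1%N isT)|].
  by apply: L2B; [exact/L2Z/cprim_L2/p2|exact: lf].
have /cchain2P[pv _ _] := cv.
exists (G 0%N, v 0%N); split.
  apply: regular_dom hG cv _ _ _ => //.
    by rewrite /v /G /= u00 f00 mulr0 subrr.
  by rewrite /v /G /= u01 f01 mulr0 subrr.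
split => /=.
  apply: aeeq_trans (aeeq_sym af); rewrite /v.
  by apply: aeeq_imp (aeeq_refl 0 1 (f 0%N)) => x _; ring.
have ao := regular_op a b xi hG (cprim_L2 pv).
apply: aeeq_imp ao => x /= ->; rewrite /v /G /= /h !rmorphN /=.
have -> : mu * (mu * u0 x - f 0%N x) - (- a%:C * (k ^+ 2 * u0 x + a%:C^-1 * (F2 x + (mu + b%:C) *
  f 0%N x))
   + - b%:C * (mu * u0 x - f 0%N x)) = (a%:C / a%:C) * F2 x + (a%:C / a%:C - 1) * (mu + b%:C) * f
     0%N x
   + (l + a%:C * k ^+ 2) * u0 x by rewrite /l; ring.
by rewrite divff// subrr !mul0r addr0 mul1r lE addNr mul0r addr0.
Qed.

Lemma beam_resolvent a b xi mu : 0 < a -> 0 < xi -> xi < 1 ->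
  0 < 2 * Re mu + b -> 0 < Re mu ^+ 2 + b * Re mu + a * pi ^+ 4 ->
  ~ beam_spectrum a b 0 xi mu.
Proof.
move=> a0 x0 x1 hb hl; apply; split.
- exact: beam_resolvent_inj.
- exact: beam_resolvent_surj.
- exact: beam_resolvent_bound.
Qed.

Lemma cprim_real c d (f g : R -> R) : prim c d f g ->
  cprim c d (fun x => (f x)%:C) (fun x => (g x)%:C).
Proof.
move=> p; split => //=.
by split => [|x /andP[cx xd]]; [exact: itgb_cst|rewrite itg_cst// mul0r addr0].
Qed.

(** Injectivity of mu - A fails: the first Dirichlet mode and the zero state have the same image. *)
Lemma beam_sin_spectrum a b xi mu : 0 < xi -> xi < 1 ->
  mu ^+ 2 + b%:C * mu + (a * pi ^+ 4)%:C = 0 -> beam_spectrum a b 0 xi mu.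
Proof.
move=> x0 x1 emu [inj _ _].
have dl x : is_derive x 1 (fun y : R => pi * y) pi.
  by apply: der_eq (der_scale pi (is_derive_id x 1)) _; rewrite mulr1.
have ds x : is_derive x 1 (fun y : R => sin (pi * y)) (pi * cos (pi * x)).
  by apply: der_eq (der_comp (is_derive_sin (pi * x)) (dl x)) _; rewrite mulrC.
have dc x : is_derive x 1 (fun y : R => cos (pi * y)) (- (pi * sin (pi * x))).
  by apply: der_eq (der_comp (is_derive_cos (pi * x)) (dl x)) _; rewrite mulNr mulrC.
have cs : {within `[0, 1], continuous (fun x : R => sin (pi * x))}.
  by apply: der_within => x _; exact: ds.
have cc : {within `[0, 1], continuous (fun x : R => cos (pi * x))}.
  by apply: der_within => x _; exact: dc.
have cst (k : R) : {within `[0, 1], continuous (fun _ : R => k)} by move=> x; exact: cvg_cst.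
have ps k l : k * pi = l -> prim 0 1 (fun x => k * sin (pi * x)) (fun x => l * cos (pi * x)).
  move=> <-; apply: prim_deriv; first exact: within_contM.
  by move=> x _; apply: der_eq (der_scale k (ds x)) _; rewrite mulrA.
have pc k l : - (k * pi) = l -> prim 0 1 (fun x => k * cos (pi * x)) (fun x => l * sin (pi * x)).
  move=> <-; apply: prim_deriv; first exact: within_contM.
  by move=> x _; apply: der_eq (der_scale k (dc x)) _; rewrite mulrN mulrA mulNr.
(* The list of successive derivatives; the factor 1 gives the first entry the shape constant times
   sine expected by [ps]. *)
pose g (j : nat) (x : R) : R := nth (fun=> 0) [:: fun x => 1 * sin (pi * x); fun x => pi * cos
  (pi * x);
  fun x => - pi ^+ 2 * sin (pi * x); fun x => - pi ^+ 3 * cos (pi * x);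
  fun x => pi ^+ 4 * sin (pi * x)] j x.
pose G (j : nat) (x : R) : C := (g j x)%:C.
have q0 : cprim 0 1 (G 0%N) (G 1%N) by apply/cprim_real/ps; ring.
have q1 : cprim 0 1 (G 1%N) (G 2%N) by apply/cprim_real/pc; ring.
have q2 : cprim 0 1 (G 2%N) (G 3%N) by apply/cprim_real/ps; ring.
have q3 : cprim 0 1 (G 3%N) (G 4%N) by apply/cprim_real/pc; ring.
have l4 : L2 0 1 (G 4%N).
  by apply/L2P; split; [exact: l2_cont (within_contM (cst (pi ^+ 4)) cs)|exact: l2_cont (cst 0)].
have hG : cchain 4 0 1 G.
  split; first by case=> [|[|[|[|]]]].
  by case=> [|[|[|[|[|]]]]]//= _; [exact: cprim_L2 q0|exact: cprim_L2 q1|exact: cprim_L2 q2|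
    exact: cprim_L2 q3].
have s0 : sin (pi * 0) = 0 :> R by rewrite mulr0 sin0.
have s1 : sin (pi * 1) = 0 :> R by rewrite mulr1 sinpi.
have cn : cchain2 0 1 (fun x => mu * G 0%N x) (fun x => mu * G 1%N x) (fun x => mu * G 2%N x).
  by apply/cchain2P; split; [exact: cprimZ|exact: cprimZ|apply/L2Z/cprim_L2/q2].
have /cchain2P[pn _ _] := cn.
have E0 : [/\ G 0%N 0 = 0, G 0%N 1 = 0, G 2%N 0 = 0 & G 2%N 1 = 0].
  by rewrite /G /g /= s0 s1 !mulr0.
have [E00 E01 _ _] := E0.
have dU : beam_dom a 0 xi (G 0%N, fun x => mu * G 0%N x).
  by apply: regular_dom hG cn E0 _ _ => //=; rewrite ?E00 ?E01 mulr0.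
have z01 : cprim 0 1 (fun=> 0 : C) (fun=> 0).
  by apply: (@cprim_real 0 1 (fun=> 0) (fun=> 0)); apply: prim_deriv => // x _; exact:
    is_derive_cst.
have lz := cprim_L2 z01.
have hZ : cchain 4 0 1 (fun _ _ => 0 : C) by split.
have cZ : cchain2 0 1 (fun=> 0 : C) (fun=> 0) (fun=> 0) by apply/cchain2P; split.
have dV : beam_dom a 0 xi (@state0 R) by apply: regular_dom hZ cZ _ _ _ => //; split.
have aU := regular_op a b xi hG (cprim_L2 pn).
have aV := regular_op a b xi hZ lz.
have [] := inj _ _ dU dV.
  split; first by apply: aeeq_imp (aeeq_refl 0 1 (fun=> 0)) => x _ /=; rewrite mulr0 !subrr.
  have gen (A B : R -> C) : aeeq 0 1 A (fun x => (- a)%:C * G 4 x + (- b)%:C * (mu * G 0%N x)) ->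
      aeeq 0 1 B (fun=> (- a)%:C * 0 + (- b)%:C * 0) ->
      aeeq 0 1 (fun x => mu * (mu * G 0%N x) - A x) (fun x => mu * 0 - B x); last exact: gen aU
        aV.
  apply: aeeq_imp2 => x -> ->; rewrite !mulr0 addr0 subr0 !rmorphN /=.
  transitivity ((mu ^+ 2 + b%:C * mu + (a * pi ^+ 4)%:C) * G 0%N x); last by rewrite emu mul0r.
  by rewrite /G /g /= mul1r !rmorphM /=; ring.
move=> /= /aeeqP[/= z _] _.
(* An a.e. zero mode would vanish at 1/2 by continuity, where the sine equals 1. *)
have := cont_ae0 (@ltr01 R) (prim_cont q0.1) z (x := 2^-1).
rewrite /= /g /= mul1r sin_pihalf => h.
have /eqP := h (ltac:(apply/andP; split; lra)).
by rewrite oner_eq0.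
Qed.

(** [N0], [N2] and [M] are |u|^2, |u''|^2 and |u(xi)|^2. Only these three numbers survive, which
    makes the localisation of mu a question of real algebra. *)
Lemma beam_eigenvalue_identity a b al xi mu : 0 < a -> 0 < xi -> xi < 1 ->
  beam_eigenvalue a b al xi mu -> exists N0 N2 M : R,
  [/\ 0 < N0, pi ^+ 4 * N0 <= N2, 0 <= M, M <= 2 * N2 &
    a * N2 + al * Re mu * M = - Re (mu ^+ 2 + b%:C * mu) * N0 /\
    al * Im mu * M = - Im (mu ^+ 2 + b%:C * mu) * N0].
Proof.
move=> a0 x0 x1 [U [dU U0 [E1 E2]]].
have an0 : a != 0 by rewrite gt_eqF.
have [m0 [m1 [m2 [n0 [n1 [n2 [w4 [D [am0 wm2 an _] lU1 lU2 [lop aop]]]]]]]]] := beam_dom_data b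
  an0 x0 x1 dU.
have [cm /cchain2P[q0 q1 l2n] lw [m00 m01 n00 n01] _] := D.
have /cchain2P[p0 p1 l2m] := cm.
have l0 := cprim_L2 p0; have ln := cprim_L2 q0.
have nm : aeeq 0 1 n0 (fun x => mu * m0 x).
  apply: aeeq_trans (aeeq_sym an) (aeeq_trans E1 _).
  by apply: aeeq_imp am0 => x /= ->.
(* The damping involves a point value, so v = mu u must hold at [xi] and not only a.e.; continuity
   provides this. *)
have nmx : n0 xi = mu * m0 xi.
  have /aeeqP[e1 e2] := nm.
  have [c1 c2] := cprim_cont q0; have [d1 d2] := cprim_cont (cprimZ mu p0).
  have xI : 0 <= xi <= 1 by rewrite !ltW.
  by apply: ceq; [exact: (cont_ae_eq ltr01 c1 d1 e1)|exact: (cont_ae_eq ltr01 c2 d2 e2)].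
pose l : C := mu ^+ 2 + b%:C * mu.
have wz : aeeq 0 1 (fun x => a%:C * w4 x + l * m0 x) (fun=> 0).
  have k := aeeq_trans (aeeq_sym aop) (aeeq_trans E2 (aeeq_imp (f' := fun x => mu * U.2 x)
    (g' := fun x => mu * n0 x) (fun x (h : U.2 x = n0 x) => congr1 (fun p => mu * p) h) an)).
  apply: aeeq_imp2 k nm => x h1 h2; rewrite h2 in h1.
  move/eqP: h1; rewrite -subr_eq0 => /eqP h1.
  rewrite -[RHS]oppr0 -h1 /l !rmorphN /=; ring.
have lh : L2 0 1 (fun x => a%:C * w4 x + l * m0 x) by apply: L2D; exact: L2Z.
have [C1 C2] := comb_dot a l l0 lw.
have L0 : L2 0 1 (fun=> 0 : C).
  by apply/L2P; split; apply: l2_cont => x; exact: cvg_cst.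
have s0 : sqn (fun x => a%:C * w4 x + l * m0 x) = 0.
  rewrite (sqn_ae lh L0 wz).
  by rewrite /sqn (@eq_itg _ _ _ _ (fun=> 0)) ?itg_cst ?mul0r// => x _ /=; rewrite expr0n addr0.
have N00 := sqn_ge0 m0.
(* The residual has norm 0, so 2 t |p| <= t^2 N0 for all t. The choice t = |p| / (N0 + 1) forces p =
   0, and the added 1 avoids a division by zero. *)
have dz (p : R) : (forall t, 2 * t * `|p| <= t ^+ 2 * sqn m0 + 0) -> p = 0.
  move=> h; apply/eqP; rewrite -normr_le0 leNgt; apply/negP => pp0.
  have := h (`|p| / (sqn m0 + 1)).
  have S1 : 0 < sqn m0 + 1 by rewrite ltr_wpDl.
  rewrite addr0 => {}h; set r := `|p| in pp0 h; set S := sqn m0 in h N00 S1.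
  have e1 : 2 * (r / (S + 1)) * r = 2 * (r / (S + 1)) ^+ 2 * (S + 1) by field; rewrite gt_eqF.
  rewrite e1 in h.
  have : 0 < (r / (S + 1)) ^+ 2 by rewrite exprn_gt0// divr_gt0.
  nra.
have b1 t := (dot_bound t lh l0).1; have b2 t := (dot_bound t lh l0).2.
rewrite s0 in b1 b2.
have {b1 b2} [z1 z2] := conj (dz _ b1) (dz _ b2).
have [D1 D2] := data_dot D.
rewrite C1 D1 nmx in z1; rewrite C2 D2 nmx in z2.
exists (sqn m0), (sqn m2), (sqmod (m0 xi)); split.
- rewrite lt_neqAle N00 andbT; apply/eqP => /esym N0.
  apply: U0; split.
    exact: aeeq_trans am0 (sqn0_ae l0 N0).
  apply: aeeq_trans an (aeeq_trans nm _) => /=.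
  by apply: aeeq_imp (sqn0_ae l0 N0) => x ->; rewrite mulr0.
- exact: cchain2_poincare cm m00 m01.
- exact: sqmod_ge0.
- by apply: cchain2_sup cm m00 m01 _; rewrite !ltW.
have al_a : a * (al / a) = al by rewrite mulrC divfK.
split.
  transitivity (a * sqn m2 + (a * (al / a)) * Re mu * sqmod (m0 xi)); first by rewrite al_a.
  move: z1; rewrite !cReM !cImM /sqmod -/l => z1; apply/eqP; rewrite -subr_eq0 -[X in _ == X]z1.
  by apply/eqP; ring.
transitivity ((a * (al / a)) * Im mu * sqmod (m0 xi)); first by rewrite al_a.
move: z2; rewrite !cReM !cImM /sqmod -/l => z2; apply/eqP; rewrite -subr_eq0 -[X in _ == X]z2.
by apply/eqP; ring.
Qed.

(** Both regimes of [b] enter only through [om] and the lower bound eps^2 on the quadratic beyond om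
    + eps. Past that point the imaginary part of the identity leaves only real mu, and the real part
    has no solution. *)
Lemma beam_eigenvalue_le a b al xi mu (om eps : R) : 0 < a -> 0 < b -> 0 < xi -> xi < 1 ->
  0 < eps -> 0 < al -> al * b < a -> al * (b * pi ^+ 4) < eps ^+ 2 -> - (b / 2) <= om ->
  (forall x, om + eps < x -> eps ^+ 2 <= x ^+ 2 + b * x + a * pi ^+ 4) ->
  beam_eigenvalue a b al xi mu -> Re mu <= om + eps.
Proof.
move=> a0 b0 x0 x1 e0 al0 alb ale hom hx /(beam_eigenvalue_identity a0 x0 x1).
move=> [N0 [N2 [M [N00 N20 M0 M2 [I1 I2]]]]].
rewrite leNgt; apply/negP => hmu.
have imE : - Im (mu ^+ 2 + b%:C * mu) = - (Im mu * (2 * Re mu + b)).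
  by rewrite expr2 !complexE /=; ring.
have im0 : Im mu = 0.
  apply/eqP; apply/negPn/negP => imn0.
  have /eqP : Im mu * (al * M + (2 * Re mu + b) * N0) = 0 by rewrite imE in I2; lra.
  rewrite mulf_eq0 (negbTE imn0)/= => /eqP.
  have : 0 <= al * M by rewrite mulr_ge0// ltW.
  have : 0 < (2 * Re mu + b) * N0 by rewrite mulr_gt0//; lra.
  lra.
have reE : - Re (mu ^+ 2 + b%:C * mu) = - (Re mu ^+ 2 + b * Re mu).
  by rewrite !expr2 !complexE /= im0; ring.
rewrite reE in I1.
have := hx _ hmu.
move: (Re mu) I1 hmu => x I1 hmu hq.
have pi4 : (0 : R) < pi ^+ 4 by rewrite exprn_gt0// pi_gt0.
set P := pi ^+ 4 in N20 ale hq pi4.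
have N2p : 0 < N2 by apply: lt_le_trans N20; rewrite mulr_gt0.
have [x_ge0|x_lt0] := leP 0 x.
  have : 0 < a * N2 by rewrite mulr_gt0.
  have : 0 <= al * x * M by rewrite !mulr_ge0// ltW.
  have xx : 0 <= x ^+ 2 + b * x by rewrite addr_ge0 ?sqr_ge0// mulr_ge0// ltW.
  have : 0 <= (x ^+ 2 + b * x) * N0 by rewrite mulr_ge0// ltW.
  lra.
have xb : - (b / 2) < x by lra.
(* From -b/2 < x < 0 and M <= 2 N2: the worst contribution of the damping is a fraction of a N2, as
   al b < a. *)
have h1 : - (al * b * N2) <= al * x * M.
  have : al * (- x) * M <= al * (b / 2) * (2 * N2).
    rewrite -(mulrA al (- x)) -(mulrA al (b / 2)) ler_pM2l//.
    by rewrite ler_pM// ?oppr_ge0 ?(ltW x_lt0)// lerNl ltW.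
  have -> : al * (b / 2) * (2 * N2) = al * b * N2 by field.
  lra.
have h2 : (a - al * b) * (P * N0) <= (a - al * b) * N2 by rewrite ler_wpM2l// subr_ge0 ltW.
have h3 : (x ^+ 2 + b * x + a * P - al * (b * P)) * N0 <= 0.
  have -> : (x ^+ 2 + b * x + a * P - al * (b * P)) * N0 =
    (a - al * b) * (P * N0) + (x ^+ 2 + b * x) * N0 by ring.
  lra.
have : 0 < (x ^+ 2 + b * x + a * P - al * (b * P)) * N0 by rewrite mulr_gt0//; lra.
lra.
Qed.

End Spectrum.

Theorem theorem5p1 (R : realType) (a b xi : R)
  (ha : 0 < a) (hb : 0 < b) (hxi0 : 0 < xi) (hxi1 : xi < 1)
  (hirr : irrational xi) :
  [/\ b <= 2 * Num.sqrt a * pi ^+ 2 ->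
        ereal_sup [set (complex.Re mu)%:E | mu in beam_spectrum a b 0 xi]
          = (- (b / 2))%:E,
      2 * Num.sqrt a * pi ^+ 2 < b ->
        ereal_sup [set (complex.Re mu)%:E | mu in beam_spectrum a b 0 xi]
          = (2^-1 * (- b + Num.sqrt (b ^+ 2 - 4 * a * pi ^+ 4)))%:E
    & forall eps : R, 0 < eps -> exists2 alpha0 : R, 0 < alpha0 &
        forall alpha : R, 0 < alpha -> alpha < alpha0 ->
        forall mu : R[i], beam_eigenvalue a b alpha xi mu ->
          (b <= 2 * Num.sqrt a * pi ^+ 2 -> complex.Re mu <= - (b / 2) + eps) /\
          (2 * Num.sqrt a * pi ^+ 2 < b ->
             complex.Re mu <= 2^-1 * (- b + Num.sqrt (b ^+ 2 - 4 * a * pi ^+ 4))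
                      + eps)].
Proof.
have pi0 := pi_gt0 R.
have P0 : (0 : R) < pi ^+ 4 by rewrite exprn_gt0.
have sq : (2 * Num.sqrt a * pi ^+ 2) ^+ 2 = 4 * a * pi ^+ 4.
  by rewrite !exprMn sqr_sqrtr ?ltW//; ring.
have s0 : 0 <= 2 * Num.sqrt a * pi ^+ 2 :> R by rewrite !mulr_ge0 ?sqrtr_ge0 ?exprn_ge0 ?ltW.
have c1 : b <= 2 * Num.sqrt a * pi ^+ 2 -> b ^+ 2 <= 4 * a * pi ^+ 4.
  by move=> h; rewrite -sq lerXn2r// ?nnegrE ltW.
have c2 : 2 * Num.sqrt a * pi ^+ 2 < b -> 4 * a * pi ^+ 4 < b ^+ 2.
  by move=> h; rewrite -sq ltrXn2r// ?nnegrE// ltW.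
(* In both regimes the supremum is attained, so it suffices to exhibit one spectral point of real
   part [om] and to clear the half-plane to its right. *)
have sup_eq (om : R) (z : R[i]) : complex.Re z = om -> beam_spectrum a b 0 xi z ->
    (forall mu, om < complex.Re mu -> ~ beam_spectrum a b 0 xi mu) ->
    ereal_sup [set (complex.Re mu)%:E | mu in beam_spectrum a b 0 xi] = om%:E.
  move=> zo zs h; apply/eqP; rewrite eq_le; apply/andP; split.
    apply: ge_ereal_sup => _ [mu hmu <-]; rewrite lee_fin leNgt; apply/negP => /h; exact.
  by apply: ereal_sup_ubound; exists z => //; rewrite zo.
split.
- move=> /c1 hle.
  have d0 : 0 <= a * pi ^+ 4 - b ^+ 2 / 4 by lra.
  apply: (sup_eq _ (Complex (- (b / 2)) (Num.sqrt (a * pi ^+ 4 - b ^+ 2 / 4)))) => //.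
    apply: beam_sin_spectrum => //.
    have := sqr_sqrtr d0; set r := Num.sqrt _ => hr.
    have {}hr : r * r = a * pi ^+ 4 - b ^+ 2 / 4 by rewrite -expr2.
    apply: ceq; rewrite expr2 !complexE /=; last by field.
    have -> : a * pi ^+ 4 = r * r + b ^+ 2 / 4 by rewrite hr subrK.
    by field.
  move=> mu hmu; apply: beam_resolvent => //; first lra.
  have : 0 < (complex.Re mu + b / 2) ^+ 2 by rewrite exprn_gt0//; lra.
  have -> : (complex.Re mu + b / 2) ^+ 2 = complex.Re mu ^+ 2 + b * complex.Re mu
    + b ^+ 2 / 4 by field.
  lra.
- move=> /c2 hlt.
  have d0 : 0 <= b ^+ 2 - 4 * a * pi ^+ 4 by lra.
  have := sqr_sqrtr d0; have := sqrtr_ge0 (b ^+ 2 - 4 * a * pi ^+ 4).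
  set r := Num.sqrt _ => r0 hr.
  apply: (sup_eq _ (Complex (2^-1 * (- b + r)) 0)) => //.
    apply: beam_sin_spectrum => //.
    apply: ceq; rewrite expr2 !complexE /=; last by field.
    have -> : a * pi ^+ 4 = (b ^+ 2 - r ^+ 2) / 4 by rewrite hr; field.
    by field.
  move=> mu hmu; apply: beam_resolvent => //; first lra.
  have : r ^+ 2 < (2 * complex.Re mu + b) ^+ 2 by rewrite ltrXn2r// ?nnegrE//; lra.
  have -> : (2 * complex.Re mu + b) ^+ 2 =
    4 * (complex.Re mu ^+ 2 + b * complex.Re mu) + b ^+ 2 by ring.
  lra.
move=> eps e0.
(* The first bound keeps a - alpha b positive; the second keeps the loss alpha b pi^4 below
   eps^2. *)
exists (Num.min (a / b) (eps ^+ 2 / (b * pi ^+ 4))).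
  by rewrite lt_min !divr_gt0 ?mulr_gt0 ?exprn_gt0.
move=> al al0; rewrite lt_min => /andP[]; rewrite !ltr_pdivlMr ?mulr_gt0// => hal1 hal2 mu hmu.
split.
(* As b^2/4 <= a pi^4, the quadratic dominates (x + b/2)^2, which exceeds eps^2 beyond -b/2 +
   eps. *)
- move=> /c1 hle; apply: (beam_eigenvalue_le (a := a) (b := b) (al := al) (xi := xi)) => // x hx.
  have : eps ^+ 2 <= (x + b / 2) ^+ 2 by rewrite lerXn2r// ?nnegrE; lra.
  have -> : (x + b / 2) ^+ 2 = x ^+ 2 + b * x + b ^+ 2 / 4 by field.
  lra.
- move=> /c2 hlt.
  have d0 : 0 <= b ^+ 2 - 4 * a * pi ^+ 4 by lra.
  have := sqr_sqrtr d0; have := sqrtr_ge0 (b ^+ 2 - 4 * a * pi ^+ 4).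
  set r := Num.sqrt _ => r0 hr.
  apply: (beam_eigenvalue_le (a := a) (b := b) (al := al) (xi := xi)) => //; first lra.
  move=> x hx.
  (* The quadratic equals (x + b/2)^2 - r^2/4 and x + b/2 exceeds r/2 + eps; the cross term r eps is
     nonnegative and is dropped. *)
  have : (r / 2 + eps) ^+ 2 <= (x + b / 2) ^+ 2 by rewrite lerXn2r// ?nnegrE; lra.
  have -> : (x + b / 2) ^+ 2 = x ^+ 2 + b * x + b ^+ 2 / 4 by field.
  have -> : (r / 2 + eps) ^+ 2 = r ^+ 2 / 4 + r * eps + eps ^+ 2 by field.
  have : 0 <= r * eps by rewrite mulr_ge0// ltW.
  lra.
Qed.
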